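(* Let $\Delta$ be a thick building of type $(W,S)$. Then the following are equivalent. (I) For any apartment system $\mathcal{A}$ of $\Delta$, the convex closure of any two given chambers $C$ and $D$ is the intersection of two (possibly equal) apartments in $\mathcal{A}$. (II) For any apartment system $\mathcal{A}$ of $\Delta$, every convex finite set $\kappa$ of chambers contained in some member of $\mathcal{A}$ is the intersection of two (possibly equal) apartments in $\mathcal{A}$. (III) For every finite subset $F$ of chambers of the Coxeter complex $\Sigma(W,S)$, there exist two chambers $C,D\in\Sigma(W,S)$ such that $F$ is contained in the convex closure of $C$ and $D$. Moreover, if every panel of $\Delta$ is contained in at least four chambers and condition (III) is satisfied, then, with respect to any apartment system $\mathcal{A}$ of $\Delta$, every finite convex subcomplex contained in an apartment in $\mathcal{A}$ is the intersection of two (possibly equal) apartments in $\mathcal{A}$.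
   Context: Buildings are finite-dimensional simplicial complexes (chamber complexes admitting a system of apartments satisfying Tits' axioms), of arbitrary type. Chambers are the maximal simplices, panels the simplices of codimension 1; $\Delta$ is thick if each panel is contained in at least three chambers. $\Delta$ is of type $(W,S)$, for a Coxeter system $(W,S)$, if its apartments are isomorphic to the standard Coxeter complex $\Sigma(W,S)$. Let $\widetilde{\mathcal{A}}$ be the complete (maximal) apartment system of $\Delta$, consisting of all simplicial subcomplexes isomorphic to $\Sigma(W,S)$; an apartment system of $\Delta$ is any subset $\mathcal{A}\subseteq\widetilde{\mathcal{A}}$ such that any two chambers of $\Delta$ are contained in some member of $\mathcal{A}$. Two chambers are adjacent if they are different and share a panel; a gallery of length $n$ is a sequence $(C_0,\dots,C_n)$ of chambers with $C_{i-1},C_i$ adjacent for all $i$; $\mathrm{d}(C,D)$ is the minimal length of a gallery from $C$ to $D$. A chamber subcomplex is convex if it contains every gallery of length $\mathrm{d}(C,D)$ between any two of its chambers $C,D$. An arbitrary subcomplex is convex if it is an intersection of convex chamber subcomplexes. The convex closure (convex hull) of a set of simplices is the intersection of all convex subcomplexes containing it. A convex set of chambers is identified with the convex chamber subcomplex it generates (the chambers together with all their faces). *)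

(* Defs.v *)
From HB Require Import structures.
From mathcomp Require Import all_boot finmap.
From mathcomp Require Import boolp classical_sets functions cardinality.

Set Implicit Arguments.
Unset Strict Implicit.
Unset Printing Implicit Defensive.

Local Open Scope group_scope.
Local Open Scope fset_scope.
Local Open Scope classical_set_scope.

(* A simplicial complex is the set of its simplices.  The empty simplex is one
   of them; so in rank 1 the empty simplex is the only panel, and in rank 0 it
   is the only chamber.  The complex need not use all elements of V as
   vertices, so that a subcomplex is a complex over the same V. *)
Section Complexes.
Variable V : choiceType.
Implicit Types (K L Sigma : set {fset V}) (A B C D P : {fset V}).

Definition simplicial_complex K :=
  K fset0 /\ forall A B, (B `<=` A)%fset -> K A -> K B.

Definition subcomplex L K := simplicial_complex L /\ L `<=` K.

Definition vertices K : set V := [set v | K [fset v]].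

Definition chamber K C := K C /\ forall A, K A -> (C `<=` A)%fset -> A = C.

Definition panel K P := exists C,
  [/\ chamber K C, (P `<=` C)%fset & #|` C| = #|` P|.+1].

Definition adjacent K C D :=
  [/\ chamber K C, chamber K D, C <> D &
      exists P, [/\ panel K P, (P `<=` C)%fset & (P `<=` D)%fset]].

(* C :: p is a gallery from C to D; its length is size p. *)
Definition gallery K C D (p : seq {fset V}) :=
  [/\ chamber K C, path (fun A B => `[< adjacent K A B >]) C p & last C p = D].

(* size p = d(C, D) *)
Definition minimal_gallery K C D p :=
  gallery K C D p /\ forall q, gallery K C D q -> size p <= size q.

Definition chamber_complex K :=
  [/\ simplicial_complex K,
      exists n, forall A, K A -> #|` A| <= n,
      forall C D, chamber K C -> chamber K D -> #|` C| = #|` D| &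
      forall C D, chamber K C -> chamber K D -> exists p, gallery K C D p].

Definition at_least_chambers_per_panel n K := forall P, panel K P ->
  exists X : {fset {fset V}}, n <= #|` X| /\
    forall C, C \in X -> chamber K C /\ (P `<=` C)%fset.

Definition thick K := at_least_chambers_per_panel 3 K.

Definition chamber_subcomplex K L :=
  [/\ subcomplex L K, chamber_complex L & chamber L `<=` chamber K].

Definition convex_chambers K (kappa : set {fset V}) :=
  kappa `<=` chamber K /\
  forall C D p, kappa C -> kappa D -> minimal_gallery K C D p ->
    forall E, E \in p -> kappa E.

Definition convex_chamber_subcomplex K L :=
  chamber_subcomplex K L /\ convex_chambers K (chamber L).

Definition convex_subcomplex K L := exists2 F : set (set {fset V}),
  F !=set0 /\ F `<=` convex_chamber_subcomplex K &
  L = \bigcap_(M in F) M.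

Definition convex_closure K (X : set {fset V}) : set {fset V} :=
  \bigcap_(L in [set L | convex_subcomplex K L /\ X `<=` L]) L.

Definition generated_subcomplex (kappa : set {fset V}) : set {fset V} :=
  [set A | exists2 C, kappa C & (A `<=` C)%fset].

Definition intersection_of_two (Aps : set (set {fset V})) L :=
  exists Sigma1 Sigma2, [/\ Aps Sigma1, Aps Sigma2 & L = Sigma1 `&` Sigma2].

End Complexes.

Definition simplicial_iso (V V' : choiceType) (K : set {fset V})
    (K' : set {fset V'}) (f : V -> V') :=
  {in vertices K &, injective f} /\ [set (f @` A)%fset | A in K] = K'.

Section Coxeter.
Variable W : groupType.
Implicit Types (S J : {fset W}) (w : W).

Definition generated_subgroup J : set W :=
  \bigcap_(H in [set H : set W | group_closed (mem H) /\ [set` J] `<=` H]) H.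

(* S is a finite set of elements of order 2 and W has the presentation
   < S | (s t)^m(s,t) = 1 >, with m(s,t) the order of s t; the exponents n with
   (s t)^n = 1 are the multiples of m(s,t), and only 0 if that order is
   infinite. *)
Definition coxeter_system S :=
  [/\ forall s, s \in S -> s <> 1 /\ s * s = 1,
      generated_subgroup S = setT &
      forall (G : groupType) (f : W -> G),
        (forall s t n, s \in S -> t \in S ->
           (s * t) ^+ n = 1 -> (f s * f t) ^+ n = 1) ->
        exists g : {multiplicative W -> G}, {in S, g =1 f}].

(* The vertex of type s of the chamber w: the coset w W_(S \ {s}). *)
Definition coxeter_vertex S w (s : W) : set W :=
  [set w * x | x in generated_subgroup (S `\ s)%fset].

(* Sigma(W, S) is the poset of standard cosets under reverse inclusion.  The
   simplex w W_(S \ J) is represented by the set of its vertices, that is, of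
   the maximal proper standard cosets containing it. *)
Definition coxeter_complex S : set {fset (set W)} :=
  [set A | exists w, exists2 J, (J `<=` S)%fset &
             A = [fset coxeter_vertex S w s | s in J]%fset].

Definition isomorphic_to_coxeter S (V : choiceType) (Sigma : set {fset V}) :=
  exists f : V -> set W, simplicial_iso Sigma (coxeter_complex S) f.

Definition tits_axioms S (V : choiceType) (Delta : set {fset V})
    (Aps : set (set {fset V})) :=
  [/\ forall Sigma, Aps Sigma ->
        subcomplex Sigma Delta /\ isomorphic_to_coxeter S Sigma,
      forall A B, Delta A -> Delta B ->
        exists Sigma, [/\ Aps Sigma, Sigma A & Sigma B] &
      forall Sigma Sigma' A B, Aps Sigma -> Aps Sigma' ->
        Sigma A -> Sigma B -> Sigma' A -> Sigma' B ->
        exists2 f : V -> V, simplicial_iso Sigma Sigma' f &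
          {in A, f =1 id} /\ {in B, f =1 id}].

Definition building S (V : choiceType) (Delta : set {fset V}) :=
  chamber_complex Delta /\ exists Aps, tits_axioms S Delta Aps.

Definition complete_apartment_system S (V : choiceType) (Delta : set {fset V}) :
    set (set {fset V}) :=
  [set Sigma | subcomplex Sigma Delta /\ isomorphic_to_coxeter S Sigma].

Definition apartment_system S (V : choiceType) (Delta : set {fset V})
    (Aps : set (set {fset V})) :=
  Aps `<=` complete_apartment_system S Delta /\
  forall C D, chamber Delta C -> chamber Delta D ->
    exists Sigma, [/\ Aps Sigma, Sigma C & Sigma D].

Definition hulls_are_intersections S (V : choiceType) (Delta : set {fset V}) :=
  forall Aps, apartment_system S Delta Aps ->
  forall C D, chamber Delta C -> chamber Delta D ->
    intersection_of_two Aps (convex_closure Delta [set C; D]).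

(* The empty set of chambers is excluded: it generates no
   simplex at all, whereas all apartments share the empty simplex. *)
Definition convex_sets_are_intersections S (V : choiceType)
    (Delta : set {fset V}) :=
  forall Aps, apartment_system S Delta Aps ->
  forall kappa : set {fset V}, finite_set kappa -> kappa !=set0 ->
    convex_chambers Delta kappa ->
    (exists2 Sigma, Aps Sigma & kappa `<=` Sigma) ->
    intersection_of_two Aps (generated_subcomplex kappa).

Definition finite_sets_in_hulls S :=
  forall F : set {fset (set W)}, finite_set F ->
    F `<=` chamber (coxeter_complex S) ->
    exists C D, [/\ chamber (coxeter_complex S) C,
      chamber (coxeter_complex S) D &
      F `<=` convex_closure (coxeter_complex S) [set C; D]].

End Coxeter.

(* Main.v *)
(* The chambers of a building carry a W-valued distance dl for which apartments
   are the isometric images of W; a simplex becomes a residue, given by a chamber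
   and a cotype K, and the hull of two chambers is a weak-order interval.

   (III) => (II): let kappa be a finite convex subcomplex of an apartment f.
   Choose a maximal simplex of kappa and in its link a chamber in general position
   with respect to f; for this the panels of the link need a fourth chamber.
   Starting from that chamber, build an isometry g that follows f along kappa and
   leaves f at each wall bounding kappa.  Projections then show that every
   apartment agreeing with g on a suitable finite set F meets f in kappa only.  By
   (III), F lies in the hull of two chambers, and any apartment through these two
   agrees with g on F.  The link is empty if kappa contains a chamber.

   (II) => (I): the hull of two chambers is finite and convex.

   (I) => (III): it suffices to enlarge the hull of two chambers C and D so as to
   contain a given neighbour Y.  If this were impossible, then the apartments not
   containing both C and D, together with those containing C, D and Y, would form
   an apartment system in which all apartments through C and D share Y. *)

Require Import Defs.
From HB Require Import structures.
From mathcomp Require Import all_boot finmap.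
From mathcomp Require Import zify.
From mathcomp Require Import boolp classical_sets functions cardinality.

Set Implicit Arguments.
Unset Strict Implicit.
Unset Printing Implicit Defensive.

Local Open Scope classical_set_scope.
Local Open Scope group_scope.

(** * Coxeter groups *)

(** Isometries are grown one panel at a time. If nothing known lies beyond the wall, every further
    chamber of the panel is admissible; if something does, its projection is the only choice and
    causes no conflict with the rest. This is why the walls bounding kappa can be treated almost
    independently of each other. The number four comes from an induction on the rank of the link.
    Folding f along a wall yields two apartments that together cover f, and each of them projects to
    a given panel of the chamber under construction in at most one chamber besides that chamber
    itself. So three chambers of the panel must be avoided. Apart from finiteness, only the closure
    of kappa under faces and projections is used. Both pass to the intersection of f with another
    apartment, so one structure result serves both sides of the equation to be proved: every wall
    through a maximal simplex contains all the other simplices. A member of an apartment system is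
    only abstractly isomorphic to the Coxeter complex and may permute the types. It becomes an
    isometry after reparametrization by an endomorphism of W that undoes the permutation. *)

Section SignedReflections.
Variable W : groupType.

(** The semidirect product of the functions from [W] to Z/2 with [W], acting by conjugation. A
    homomorphism from [W] that is the identity in the second component is a cocycle in the first;
    the one sending each generator to its indicator function counts modulo 2 how often a gallery
    crosses each wall. *)
Definition inversion_pair : Type := (W -> bool) * W.
HB.instance Definition _ := Choice.on inversion_pair.

Implicit Types p q r : inversion_pair.

Definition ip_mul p q : inversion_pair :=
  (fun x => p.1 x (+) q.1 (x ^ p.2), p.2 * q.2).
Definition ip_one : inversion_pair := (fun=> false, 1).
Definition ip_inv p : inversion_pair := (fun x => p.1 (x ^ p.2^-1), p.2^-1).

Lemma ip_mulA : associative ip_mul.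
Proof.
move=> p q r; congr pair => /=; last exact: mulgA.
by apply/funext => x; rewrite conjgM addbA.
Qed.
Lemma ip_mul1 : left_id ip_one ip_mul.
Proof.
by case=> f w; congr pair => /=; [apply/funext => x; rewrite conjg1|exact: mul1g].
Qed.
Lemma ip_mul1r : right_id ip_one ip_mul.
Proof.
by case=> f w; congr pair => /=; [apply/funext => x; rewrite addbF|exact: mulg1].
Qed.
Lemma ip_mulV : left_inverse ip_one ip_inv ip_mul.
Proof.
by case=> f w; congr pair => /=; [apply/funext => x; rewrite addbb|exact: mulVg].
Qed.
Lemma ip_mulVr : right_inverse ip_one ip_inv ip_mul.
Proof.
case=> f w; congr pair => /=; last exact: mulgV.
by apply/funext => x; rewrite conjgK addbb.
Qed.
HB.instance Definition _ :=
  isGroup.Build inversion_pair ip_mulA ip_mul1 ip_mul1r ip_mulV ip_mulVr.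

End SignedReflections.

(* Rewriting with mulgA, invgM etc. would change the coercion path from groupType
   to the multiplication, and later rewrites would no longer match. *)
Section GroupEquations.
Variable W : groupType.
Implicit Types x y z : W.

Lemma gmulA x y z : x * (y * z) = x * y * z. Proof. exact: mulgA. Qed.
Lemma ginvM x y : (x * y)^-1 = y^-1 * x^-1. Proof. exact: invgM. Qed.
Lemma gconjE x y : x ^ y = y^-1 * (x * y). Proof. exact: conjgE. Qed.
Lemma gconjC x y : x * y = y * x ^ y. Proof. exact: conjgC. Qed.

End GroupEquations.

Section Words.
Variables (W : groupType) (S : {fset W}).
Implicit Types (p q : seq W) (s t x w : W) (J : {fset W}).

Definition wprod p : W := foldr *%g 1 p.

Definition word J p := all (fun s => s \in J) p.

Definition inW J w := exists2 p, word J p & wprod p = w.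

Lemma wprod_cat p q : wprod (p ++ q) = wprod p * wprod q.
Proof. by elim: p => [|s p IH] /=; rewrite ?mul1g // IH gmulA. Qed.

Lemma word_cat J p q : word J (p ++ q) = word J p && word J q.
Proof. exact: all_cat. Qed.

(** The reflections in the walls crossed, in this order, by the gallery that starts at 1 and follows
    the letters of [p]. *)
Fixpoint refls p := if p is s :: p' then s :: [seq x ^ s | x <- refls p'] else [::].

Lemma size_refls p : size (refls p) = size p.
Proof. by elim: p => //= s p IH; rewrite size_map IH. Qed.

Definition reduced_words w : set (seq W) := [set p |
  [/\ word S p, wprod p = w &
      forall q, word S q -> wprod q = w -> size p <= size q]].

Definition rword w := xget [::] (reduced_words w).
Definition len w := size (rword w).
(** For a reflection [x]: its wall separates 1 from [w]. The parity is what survives for words that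
    are not reduced, which may cross a wall several times. *)
Definition inverts w x := odd (count_mem x (refls (rword w))).
Definition btw u v w := len (u^-1 * v) + len (v^-1 * w) = len (u^-1 * w).
Definition reflection x := exists w s, s \in S /\ x = s ^ w.

End Words.

Ltac len_lia := clear; lia.

Section Coxeter.
Variables (W : groupType) (S : {fset W}).
Hypothesis hWS : coxeter_system S.
Implicit Types (p q : seq W) (s t x r u v w j k a b c d y z : W) (J K : {fset W}).

Local Notation len := (len S).
Local Notation inv := (inverts S).
Local Notation word := (@word W).
Local Notation refl := (reflection S).

Lemma gen_neq1 s : s \in S -> s <> 1.
Proof. by case: hWS => h _ _ /h[]. Qed.

Lemma gen_sq s : s \in S -> s * s = 1.
Proof. by case: hWS => h _ _ /h[]. Qed.

Lemma gen_inv s : s \in S -> s^-1 = s.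
Proof. by move=> sS; apply: (mulgI s); rewrite mulgV gen_sq. Qed.

Lemma genK s w : s \in S -> s * (s * w) = w.
Proof. by move=> sS; rewrite gmulA gen_sq // mul1g. Qed.

Lemma genKr s w : s \in S -> w * s * s = w.
Proof. by move=> sS; rewrite -gmulA gen_sq // mulg1. Qed.

Lemma gen_conj s x : s \in S -> x ^ s = s * x * s.
Proof. by move=> sS; rewrite gconjE gen_inv // gmulA. Qed.

Lemma gen_conjK s x : s \in S -> (x ^ s) ^ s = x.
Proof. by move=> sS; rewrite -conjgM gen_sq // conjg1. Qed.

Lemma refl_gen s : s \in S -> refl s.
Proof. by move=> sS; exists 1, s; rewrite conjg1. Qed.

Lemma refl_conj r w : refl r -> refl (r ^ w).
Proof. by case=> u [s [sS ->]]; exists (u * w), s; rewrite conjgM. Qed.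

Lemma refl_sq r : refl r -> r * r = 1.
Proof. by case=> u [s [sS ->]]; rewrite -conjMg gen_sq // conj1g. Qed.

Lemma reflK r w : refl r -> r * (r * w) = w.
Proof. by move=> rr; rewrite gmulA refl_sq // mul1g. Qed.

Lemma inW1 J : inW J 1.
Proof. by exists [::]. Qed.

Lemma inW_gen J s : s \in J -> inW J s.
Proof. by move=> sJ; exists [:: s]; rewrite /= ?sJ ?mulg1. Qed.

Lemma inWM J u v : inW J u -> inW J v -> inW J (u * v).
Proof.
case=> p pJ <- [q qJ <-]; exists (p ++ q); last exact: wprod_cat.
by rewrite word_cat pJ.
Qed.

Lemma inWV J w : (J `<=` S)%fset -> inW J w -> inW J w^-1.
Proof.
move=> JS [p + <-]; elim: p => [|s p IH] /=; first by rewrite invg1 => _; exact: inW1.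
case/andP => sJ pJ; rewrite ginvM (gen_inv (fsubsetP JS _ sJ)).
by apply: inWM; [exact: IH|exact: inW_gen].
Qed.

Lemma inWS J K w : (J `<=` K)%fset -> inW J w -> inW K w.
Proof.
move=> /fsubsetP JK [p pJ <-]; exists p => //.
by apply/allP => s /(allP pJ)/JK.
Qed.

Lemma generated_inW J w : (J `<=` S)%fset -> generated_subgroup J w <-> inW J w.
Proof.
move=> JS; split=> [|[p pJ <-] H /= [[H1 HB] JH]].
  apply; split=> /=; last by move=> s; exact: inW_gen.
  split=> [|u v]; rewrite !inE; first exact: inW1.
  by move=> uJ vJ; apply: inWM => //; exact: inWV.
have HV x : H x -> H x^-1.
  move=> /mem_set xH; apply: set_mem; rewrite -div1g; exact: HB.
elim: p pJ => [_|s p IH /= /andP[sJ pJ]]; first exact: set_mem.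
rewrite -[wprod p]invgK; apply: set_mem; apply: HB; apply/mem_set; first exact: JH.
exact/HV/IH.
Qed.

Lemma inW_full w : inW S w.
Proof. by apply/generated_inW => //; case: hWS => _ -> _. Qed.

Lemma rwordP w : reduced_words S w (rword S w).
Proof.
apply: (@xgetPex _ [::] (reduced_words S w)).
have ex : exists n, `[< exists p, [/\ word S p, wprod p = w & size p = n] >].
  by have [p pS <-] := inW_full w; exists (size p); apply/asboolP; exists p.
case: (ex_minnP ex) => n /asboolP[p [pS pw <-]] nmin; exists p; split=> // q qS qw.
by apply: nmin; apply/asboolP; exists q.
Qed.

Lemma len_wprod p : word S p -> len (wprod p) <= size p.
Proof. by move=> pS; case: (rwordP (wprod p)) => _ _; apply. Qed.

Lemma len1 : len 1 = 0.
Proof. by apply/eqP; rewrite -leqn0; apply: (@len_wprod [::]). Qed.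

Lemma len_eq0 w : len w = 0 -> w = 1.
Proof. by move=> /size0nil e; case: (rwordP w); rewrite e. Qed.

Lemma lenM u v : len (u * v) <= len u + len v.
Proof.
case: (rwordP u) (rwordP v) => uS uE _ [vS vE _].
by rewrite -{1}uE -{1}vE -wprod_cat -size_cat len_wprod // word_cat uS.
Qed.

Lemma lenV w : len w^-1 = len w.
Proof.
suff le v : len v^-1 <= len v by apply/eqP; rewrite eqn_leq le -{1}[w]invgK le.
suff le p : word S p -> len (wprod p)^-1 <= size p.
  by case: (rwordP v) => vS vE _; rewrite -{1}vE; exact: le.
elim: p => [_|s p IH /= /andP[sS pS]]; first by rewrite invg1 len1.
rewrite ginvM (gen_inv sS) -addn1; apply: leq_trans (lenM _ _) _.
by apply: leq_add; [exact: IH|have := @len_wprod [:: s]; rewrite /= mulg1 sS; apply].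
Qed.

Lemma len_gen s : s \in S -> len s = 1%N.
Proof.
move=> sS; apply/eqP; rewrite eqn_leq lt0n.
have := @len_wprod [:: s]; rewrite /= mulg1 sS => -> //.
by apply/eqP => /len_eq0; exact: gen_neq1.
Qed.

Lemma exchange p x : word S p -> x \in refls p ->
  exists p1 s p2, p = p1 ++ s :: p2 /\ x * wprod p = wprod (p1 ++ p2).
Proof.
elim: p x => //= s p IH x /andP[sS pS]; rewrite inE => /orP[/eqP->|].
  by exists [::], s, p; rewrite genK.
case/mapP => y /(IH _ pS)[p1 [t [p2 [-> e]]]] ->; exists (s :: p1), t, p2; split=> //=.
by rewrite gen_conj // -!gmulA genK // e.
Qed.

Lemma exchange_inv p x : word S p -> x \in refls p -> len (x * wprod p) < size p.
Proof.
move=> pS /(exchange pS)[p1 [s [p2 [pE ->]]]]; move: pS; rewrite pE.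
rewrite word_cat => /andP[p1S /andP[_ p2S]].
apply: leq_ltn_trans (len_wprod _) _; first by rewrite word_cat p1S.
by rewrite !size_cat addnS.
Qed.

(** The presentation of [W] gives the homomorphism into the semidirect product; its first component
    is a crossing parity that depends on the element only and not on the word. *)
Lemma inv_wprod_ex : exists g : W -> W -> bool,
  [/\ forall u v x, g (u * v) x = g u x (+) g v (x ^ u),
      forall s x, s \in S -> g s x = (x == s) & forall x, g 1 x = false].
Proof.
pose f w : inversion_pair W := (fun x => x == w, w).
case: hWS => _ _ /(_ _ f)[].
  move=> s t n sS tS st1.
  (* The alternating word of length 2n crosses the walls of the reflections (s t)^i s for i < 2n. *)
  have -> : (f s * f t) ^+ n =
      (fun x => odd (count (fun i => x == (s * t) ^+ i * s) (iota 0 n.*2)), (s * t) ^+ n).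
    elim: n {st1} => [|n IH]; first by congr pair.
    rewrite expgS IH; congr pair; last by rewrite /= expgS.
    apply/funext => x /=; rewrite expg0 mul1g expg1 !oddD.
    rewrite -addbA !oddb; congr addb; congr addb.
      by rewrite gen_conj // -[RHS](inj_eq (mulgI s)) -[RHS](inj_eq (@mulIg _ s)) -!gmulA gen_sq // mulg1 genK.
    rewrite (iotaDl 2 0) count_map; congr (odd _); apply: eq_count => i /=.
    rewrite -[in RHS](inj_eq (conjg_inj (s * t))); congr (_ == _).
    rewrite gconjE ginvM (gen_inv sS) (gen_inv tS) expgS expgS -!gmulA.
    by rewrite !(genK _ sS) !(genK _ tS) !gmulA -expgS expgSr !gmulA (genKr _ tS).
  congr pair => //; apply/funext => x.
  (* As (s t)^n = 1, the second n walls repeat the first n, so every wall is crossed an even number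
     of times. *)
  rewrite -addnn iotaD count_cat add0n -{2}[n]addn0 iotaDl count_map.
  rewrite (@eq_count _ _ (fun i => x == (s * t) ^+ i * s)) ?addnn ?odd_double //.
  by move=> i /=; rewrite expgnDr st1 mul1g.
move=> g gE.
have g1 : g 1 = 1 by apply: (mulgI (g 1)); rewrite -gmulfM !mulg1.
have g2 w : (g w).2 = w.
  have [p pS <-] := inW_full w; elim: p pS => [|s p IH /= /andP[sS pS]]; first by rewrite g1.
  by rewrite gmulfM /= gE //= IH.
exists (fun w => (g w).1); split=> [u v x|s x sS|x]; last by rewrite g1.
  by rewrite gmulfM /= g2.
by rewrite gE.
Qed.

Lemma inv_spec : [/\ forall u v x, inv (u * v) x = inv u x (+) inv v (x ^ u),
  forall s x, s \in S -> inv s x = (x == s) &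
  forall p x, word S p -> inv (wprod p) x = odd (count_mem x (refls p))].
Proof.
have [g [gM gS g1]] := inv_wprod_ex.
have gw p x : word S p -> g (wprod p) x = odd (count_mem x (refls p)).
  elim: p x => [|s p IH] x /=; first by rewrite g1.
  case/andP => sS pS; rewrite gM gS // IH // oddD oddb count_map eq_sym.
  congr (_ (+) odd _); apply: eq_count => y /=.
  by rewrite -(inj_eq (conjg_inj s)) gen_conjK // eq_sym.
have ginv : inv = g.
  apply/funext => w; apply/funext => x; case: (rwordP w) => wS wE _.
  by rewrite -{2}wE gw.
by rewrite ginv.
Qed.

Lemma invertsM u v x : inv (u * v) x = inv u x (+) inv v (x ^ u).
Proof. by case: inv_spec. Qed.

Lemma inv_gen s x : s \in S -> inv s x = (x == s).
Proof. by case: inv_spec => _ + _; apply. Qed.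

Lemma inv_wprod p x : word S p -> inv (wprod p) x = odd (count_mem x (refls p)).
Proof. by case: inv_spec => _ _; apply. Qed.

Lemma inverts1 x : inv 1 x = false.
Proof. exact: (@inv_wprod [::]). Qed.

Lemma invertsV w x : inv w^-1 x = inv w (x ^ w^-1).
Proof. by apply/eqP; rewrite -negb_add -invertsM mulVg inverts1. Qed.

Lemma inv_refls p x : word S p -> inv (wprod p) x -> x \in refls p.
Proof. by move=> pS; rewrite inv_wprod // -has_pred1 has_count; case: count. Qed.

Lemma inv_len w x : inv w x -> len (x * w) < len w.
Proof.
case: (rwordP w) => wS wE _ ix.
by rewrite -{1}wE; apply: exchange_inv => //; apply: inv_refls; rewrite // wE.
Qed.

Lemma inv_self r : refl r -> inv r r.
Proof.
case=> w [s [sS ->]]; rewrite {1}gconjE invertsM invertsM invertsV conjgK (inv_gen _ sS) eqxx.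
by rewrite [s ^ s]gconjE mulKg addTb addbN addbb.
Qed.

Lemma inv_reflM r w : refl r -> inv (r * w) r = ~~ inv w r.
Proof. by move=> rr; rewrite invertsM inv_self // gconjE mulKg. Qed.

Lemma inv_lenE r w : refl r -> inv w r = (len (r * w) < len w).
Proof.
move=> rr; case E: (inv w r); first by rewrite inv_len.
have : inv (r * w) r by rewrite inv_reflM // E.
by move=> /inv_len; rewrite reflK // => /ltnW; rewrite leqNgt => /negbTE.
Qed.

Lemma lenSl s w : s \in S ->
  if inv w s then len w = (len (s * w)).+1 else len (s * w) = (len w).+1.
Proof.
move=> sS; have le1 v : len (s * v) <= (len v).+1.
  by apply: leq_trans (lenM _ _) _; rewrite len_gen.
case E: (inv w s).
  by apply/eqP; rewrite eqn_leq inv_len // andbT -{1}[w](genK _ sS) le1.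
have : inv (s * w) s by rewrite inv_reflM ?E //; exact: refl_gen.
by move/inv_len; rewrite genK // => h; apply/eqP; rewrite eqn_leq le1.
Qed.

Lemma lenSr s w : s \in S ->
  if inv w^-1 s then len w = (len (w * s)).+1 else len (w * s) = (len w).+1.
Proof.
move=> sS; have := lenSl w^-1 sS.
have -> : s * w^-1 = (w * s)^-1 by rewrite ginvM (gen_inv sS).
by rewrite !lenV.
Qed.

(** If both stretches of the gallery cross the wall of [r], reflecting the part in between shortens
    each of them without moving the end. Conversely, the letters of a reduced word of [u] are put in
    front of [v] one by one. *)
Lemma lenM_eqP u v : len (u * v) = len u + len v <->
  forall r, refl r -> inv u r -> inv v (r ^ u) -> False.
Proof.
split=> [e r rr ru rv|].
  have := leq_ltn_trans (lenM (r * u) (r ^ u * v)) (leq_add (inv_len ru) (ltnW (inv_len rv))).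
  by rewrite gconjE -e -!gmulA mulVKg reflK // ltnn.
move En : (len u) => n; elim: n u En => [|n IH] u un no.
  by rewrite (len_eq0 un) mul1g.
case: (rwordP u) => uS uE; have : size (rword S u) = n.+1 by [].
case: (rword S u) uS uE => //= s p /andP[sS pS] uE [sp] _.
have lp : len (wprod p) = n.
  apply/eqP; rewrite eqn_leq -{1}sp len_wprod //= -ltnS -un -uE.
  by apply: leq_trans (lenM _ _) _; rewrite len_gen.
have nis : inv (wprod p) s = false.
  by apply/negP => /inv_len; rewrite uE un lp ltnNge leqnSn.
have ep : len (wprod p * v) = n + len v.
  apply: IH => // r rr rp rv; apply: (no (r ^ s)).
  - exact: refl_conj.
  - rewrite -uE invertsM gen_conjK // rp inv_gen // addbT.
    apply/negP => /eqP rs; have : r = s by apply: (conjg_inj s); rewrite rs [s ^ s]gconjE mulKg.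
    by move=> rs'; rewrite -rs' rp in nis.
  - by rewrite -uE conjgM gen_conjK.
have := lenSl (wprod p * v) sS; rewrite gmulA uE ep; case: ifP => // h.
rewrite invertsM nis /= in h; case: (no s (refl_gen sS)).
  by rewrite -uE inv_reflM ?nis //; exact: refl_gen.
by rewrite -uE conjgM [s ^ s]gconjE mulKg.
Qed.

(** The hull of two elements as an intersection of half-spaces; in this form betweenness composes
    without any computation of lengths. *)
Lemma btwP u v w : btw S u v w <->
  forall r, refl r -> inv u r = inv w r -> inv v r = inv u r.
Proof.
have -> : btw S u v w = (len (u^-1 * v) + len (v^-1 * w) = len (u^-1 * v * (v^-1 * w))).
  by rewrite -gmulA mulVKg.
set a := u^-1 * v; set b := v^-1 * w.
apply: (@iff_trans _ (len (a * b) = len a + len b)); first by split.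
apply: (iff_trans (lenM_eqP a b)).
have ea r : inv a (r ^ u) = (inv u r != inv v r).
  by rewrite invertsM invertsV conjgK -negb_eqb.
have eb r : inv b ((r ^ u) ^ a) = (inv v r != inv w r).
  by rewrite -conjgM mulVKg invertsM invertsV conjgK -negb_eqb.
split=> [no r rr uw|no r rr].
  apply/eqP; rewrite eq_sym -[_ == _]negbK; apply/negP => /[dup] ru.
  by rewrite -ea => h; apply: (no (r ^ u)); rewrite ?eb -?uw // 1?eq_sym //; exact: refl_conj.
rewrite -(conjgKV u r) ea eb; have rr' : refl (r ^ u^-1) by exact: refl_conj.
move: (no _ rr'); case: (inv u _) (inv v _) (inv w _) => [] [] [] //= ; by move/(_ erefl).
Qed.

Lemma btw_trans a b u v w : btw S a u b -> btw S a v b -> btw S u w v -> btw S a w b.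
Proof.
rewrite !btwP => hu hv hw r rr ab; rewrite -(hu r rr ab); apply: hw => //.
by rewrite hu // hv.
Qed.

Lemma btw_l u v : btw S u u v.
Proof. by rewrite btwP. Qed.

Lemma btw_r u v : btw S u v v.
Proof. by rewrite btwP => r _ ->. Qed.

Lemma ball_finite n : finite_set [set w | len w <= n].
Proof.
elim: n => [|n IH].
  apply: (@sub_finite_set _ _ [set 1]); last exact: finite_set1.
  by move=> w /=; rewrite leqn0 => /eqP /len_eq0.
apply: (@sub_finite_set _ _ ([set 1] `|`
    [set s * w | s in [set` S] & w in [set w | len w <= n]])).
  move=> w /= wn; case: (rwordP w) => wS wE _; have wn' : size (rword S w) <= n.+1 by [].
  case: (rword S w) wS wE wn' => [|s p] /=; first by left.
  case/andP => sS pS <- sp; right; exists s => //; exists (wprod p) => //.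
  exact: leq_trans (len_wprod pS) sp.
rewrite finite_setU; split; first exact: finite_set1.
by apply: finite_image2 => //; exact: finite_fset.
Qed.

(** * Parabolic subgroups and shortest coset representatives *)

Section Parabolic.
Variable J : {fset W}.
Hypothesis JS : (J `<=` S)%fset.

Lemma word_sub p : word J p -> word S p.
Proof. by move=> pJ; apply/allP => s /(allP pJ); exact: (fsubsetP JS). Qed.

Lemma gen_sub s : s \in J -> s \in S.
Proof. exact: (fsubsetP JS). Qed.

(** When a new letter shortens the word, exchange absorbs it by deleting another letter, so no
    letter outside [J] ever appears. *)
Lemma inW_reduced y : inW J y -> exists p, [/\ word J p, wprod p = y & size p = len y].
Proof.
case=> q qJ <-; elim: q qJ => [_|s q IH /= /andP[sJ qJ]].
  by exists [::]; rewrite len1.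
have [p [pJ pE sp]] := IH qJ; have sS := gen_sub sJ.
have := lenSl (wprod q) sS; case: ifPn => [h e|_ e].
  rewrite -pE in h; have := exchange (word_sub pJ) (inv_refls (word_sub pJ) h).
  case=> p1 [t [p2 [ep e2]]]; exists (p1 ++ p2); split.
  - by move: pJ; rewrite ep !word_cat /= => /andP[-> /andP[_ ->]].
  - by rewrite -e2 pE.
  - by apply: succn_inj; rewrite -e -sp ep !size_cat addnS.
by exists (s :: p) => /=; rewrite sJ pJ pE e sp.
Qed.

Lemma inW_descent y : inW J y -> y <> 1 -> exists2 s : W, s \in J & inv y s.
Proof.
move=> /inW_reduced[[|s p] [/= pJ <- e]] // _; case/andP: pJ => sJ pJ.
exists s => //; have sS := gen_sub sJ; rewrite inv_lenE; last exact: refl_gen.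
by rewrite genK // -e ltnS len_wprod // word_sub.
Qed.

Lemma inW_refls p x : word J p -> x \in refls p -> inW J x.
Proof.
elim: p x => //= s p IH x /andP[sJ pJ]; rewrite inE => /orP[/eqP->|].
  exact: inW_gen.
case/mapP => y /(IH _ pJ) yJ ->; rewrite gen_conj ?gen_sub //.
by apply: inWM; [apply: inWM|]; rewrite //; exact: inW_gen.
Qed.

Lemma inW_inv y x : inW J y -> inv y x -> inW J x.
Proof.
case=> p pJ <- /(inv_refls (word_sub pJ)); exact: inW_refls.
Qed.

Lemma gen_inW s : s \in S -> inW J s -> s \in J.
Proof.
move=> sS /inW_reduced[p [+ + sp]]; rewrite len_gen // in sp.
by case: p sp => [|t []] //= _ /andP[tJ _]; rewrite mulg1 => <-.
Qed.

Lemma inW_desc y s : inW J y -> s \in S -> inv y s -> s \in J.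
Proof. by move=> yJ sS /(inW_inv yJ) /(gen_inW sS). Qed.

Lemma inW_len1 y : inW J y -> len y = 1%N -> y \in J.
Proof.
move=> yJ y1; have [p [pJ pE sp]] := inW_reduced yJ; rewrite y1 in sp.
by case: p pJ pE sp => [|s []] //= /andP[sJ _] <- _; rewrite mulg1.
Qed.
End Parabolic.

(** That is, [v] is the shortest element of the coset W_J v; [lmin J v^-1] is the same condition for
    v W_J. *)
Definition lmin J v := forall s, s \in J -> inv v s = false.

(** A left descent of [y] belongs to [S] without [s] for every [s] in [T], hence lies outside [T],
    and can be split off. *)
Lemma inW_all (T : {fset W}) y : (forall s, s \in T -> inW (S `\ s)%fset y) ->
  inW (S `\` T)%fset y.
Proof.
have gensD1_sub s : (S `\ s `<=` S)%fset by exact: fsubD1set.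
move En : (len y) => n; elim: n y En => [|n IH] y yn h.
  by rewrite (len_eq0 yn); exact: inW1.
have [y1|yn1] := eqVneq y 1; first by rewrite y1; exact: inW1.
have [//|s sS ys] := inW_descent (fsubset_refl S) (inW_full y); first exact/eqP.
have nT : s \notin T.
  by apply/negP => sT; have := inW_desc (gensD1_sub s) (h s sT) sS ys; rewrite !inE eqxx.
rewrite -(genK y sS); apply: inWM; first by apply: inW_gen; rewrite inE nT.
apply: IH => [|t tT]; first by have := lenSl y sS; rewrite ys yn => -[].
apply: inWM; last exact: h.
apply: inW_gen; rewrite !inE sS andbT; apply: contraNneq nT => ->; exact: tT.
Qed.

Lemma lmin_decomp J w : (J `<=` S)%fset ->
  exists y v, [/\ w = y * v, inW J y, lmin J v & len w = len y + len v].
Proof.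
move=> JS; move En : (len w) => n; elim: n w En => [|n IH] w wn.
  exists 1, w; split; rewrite ?mul1g ?len1 //; first exact: inW1.
  by move=> s _; rewrite (len_eq0 wn) inverts1.
have [[s sJ ws]|no] := pselect (exists2 s : W, s \in J & inv w s); last first.
  exists 1, w; split; rewrite ?mul1g ?len1 //; first exact: inW1.
  by move=> s sJ; apply/negP => h; apply: no; exists s.
have sS := gen_sub JS sJ; have := lenSl w sS; rewrite ws wn => -[e].
have [y [v [e2 yJ vm e3]]] := IH _ (esym e).
have wE : w = s * y * v by rewrite -gmulA -e2 genK.
have syJ : inW J (s * y) by apply: inWM => //; exact: inW_gen.
exists (s * y), v; split=> //; apply/eqP; rewrite eqn_leq -{1}wn {1}wE lenM /=.
have := lenSl y sS; case: ifP => _ h; last by rewrite h e3.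
by rewrite e3 h addSn ltnW // ltnS ltnW.
Qed.

Lemma lmin_refl J v x : (J `<=` S)%fset -> lmin J v -> refl x -> inW J x -> inv v x = false.
Proof.
move=> JS vm rx xJ.
pose P n := `[< exists y, inW J y /\ len (y * v) = n >].
have exP : exists n, P n by exists (len v); apply/asboolP; exists 1; rewrite mul1g; split=> //; exact: inW1.
case: (ex_minnP exP) => n /asboolP[y [yJ yn]] nmin; set u := y * v in yn.
have um r : refl r -> inW J r -> inv u r = false.
  move=> rr rJ; apply/negP => /inv_len; rewrite yn ltnNge nmin //.
  by apply/asboolP; exists (r * y); rewrite gmulA; split=> //; exact: inWM.
suff y1 : y = 1 by rewrite -(um x rx xJ) /u y1 mul1g.
apply: contrapT => yn1.
have y1J := inWV JS yJ.
have [|s sJ ys] := inW_descent JS y1J; first by move=> e; apply: yn1; rewrite -[y]invgK e invg1.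
have := vm s sJ; have -> : v = y^-1 * u by rewrite mulKg.
have sS := gen_sub JS sJ.
rewrite invertsM ys um //; first by apply: refl_conj; exact: refl_gen.
by rewrite gconjE invgK; apply: inWM => //; apply: inWM => //; exact: inW_gen.
Qed.

Lemma lminM J y v : (J `<=` S)%fset -> lmin J v -> inW J y -> len (y * v) = len y + len v.
Proof.
move=> JS vm yJ; apply/lenM_eqP => r rr yr; rewrite (lmin_refl JS) //.
  exact: refl_conj.
have rJ := inW_inv JS yJ yr.
by rewrite gconjE; apply: inWM; [exact: inWV|exact: inWM].
Qed.

Lemma rminM K d y : (K `<=` S)%fset -> lmin K d^-1 -> inW K y -> len (d * y) = len d + len y.
Proof.
by move=> KS dm yK; rewrite -lenV ginvM (lminM KS dm (inWV KS yK)) !lenV addnC.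
Qed.

Lemma lmin_uniq J y v y' v' : (J `<=` S)%fset -> lmin J v -> lmin J v' ->
  inW J y -> inW J y' -> y * v = y' * v' -> y = y' /\ v = v'.
Proof.
move=> JS vm vm' yJ yJ' e.
have e2 : v = (y^-1 * y') * v' by rewrite -gmulA -e mulKg.
have e3 : v' = (y'^-1 * y) * v by rewrite -gmulA e mulKg.
have zJ : inW J (y^-1 * y') by apply: inWM => //; exact: inWV.
have zJ' : inW J (y'^-1 * y) by apply: inWM => //; exact: inWV.
have h1 := lminM JS vm' zJ; have h2 := lminM JS vm zJ'.
rewrite -e2 in h1; rewrite -e3 in h2.
have z1 : y'^-1 * y = 1 by apply: len_eq0; move: h1 h2; len_lia.
split; first by rewrite -[y'](mulg1 _) -z1 mulVKg.
by rewrite e3 z1 mul1g.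
Qed.

(** The wall of [s] is crossed only inside the coset d W_K, so [s ^ d] is a reflection of W_K; as
    [s * d] is just one longer than [d], this reflection has length 1. *)
Lemma double_descent K d k s : (K `<=` S)%fset -> lmin K d^-1 -> inW K k -> s \in S ->
  inv d s = false -> inv (d * k) s -> exists2 k1 : W, k1 \in K & s * d = d * k1.
Proof.
move=> KS dm kK sS ds; rewrite invertsM ds /= => h; have rK := inW_inv KS kK h.
exists (s ^ d); last by rewrite gconjC.
apply: inW_len1 => //; apply/eqP; rewrite -(eqn_add2l (len d)) -(rminM KS dm rK).
by rewrite -gconjC; have := lenSl d sS; rewrite ds => ->; rewrite addn1.
Qed.

(** The weak order: a reduced word of [u] is the beginning of one of [d]. *)
Definition weak_le u d := len u + len (u^-1 * d) = len d.

Lemma weak_le_inv u d r : weak_le u d -> refl r -> inv u r -> inv d r.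
Proof.
rewrite /weak_le -[X in _ = len X](mulVKg u) => /esym/lenM_eqP no rr ur.
rewrite -(mulVKg u d) invertsM ur /=; apply/negP => h; exact: no h.
Qed.

Lemma weak_le_lmin J u d : (J `<=` S)%fset -> weak_le u d -> lmin J d -> lmin J u.
Proof.
move=> JS ud dm j jJ; apply/negP => uj; have := dm j jJ.
by rewrite (weak_le_inv ud _ uj) //; apply: refl_gen; exact: gen_sub jJ.
Qed.

(* The exchange condition moves each letter of y in turn to the front of w. *)
Lemma descents_weak_le J w y : (J `<=` S)%fset -> (forall s, s \in J -> inv w s) ->
  inW J y -> weak_le y w.
Proof.
move=> JS wJ /(inW_reduced JS)[p [pJ <-]].
elim: p pJ => [_ _|s p IH /= /andP[sJ pJ] sp]; first by rewrite /weak_le len1 invg1 mul1g.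
have sS := gen_sub JS sJ.
have sp' : size p = len (wprod p).
  apply/eqP; rewrite eqn_leq len_wprod ?andbT ?(word_sub JS) // -ltnS sp.
  by apply: leq_trans (lenM _ _) _; rewrite len_gen.
have := IH pJ sp'; rewrite /weak_le; set u := _^-1 * w => e.
have psm : inv (wprod p) s = false.
  by apply/negP => /inv_len; rewrite -sp -sp' ltnNge leqnSn.
have := wJ s sJ; rewrite -[w in inv w](mulVKg (wprod p)) -/u invertsM psm /= => /inv_len lu.
have E : (s * wprod p)^-1 * w = s ^ wprod p * u.
  by rewrite ginvM (gen_inv sS) /u gconjE -!gmulA mulVKg.
apply/eqP; rewrite eqn_leq -[X in _ && (len X <= _)](mulVKg (s * wprod p) w) lenM andbT.
by rewrite E -sp -e -sp' addSn -addnS leq_add2l.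
Qed.

(* Geometrically: if the simplices 1 W_J and d W_K of the link of rank |J| + 1
   lie in the same walls, then they are opposite, so that d is the longest
   element among those without a left descent in J. *)
Lemma opposite_weak_le J t d v : ((t |` J)%fset `<=` S)%fset ->
  inW (t |` J)%fset d -> d <> 1 -> lmin J d ->
  (forall j, j \in J -> exists2 k : W, k \in S & j * d = d * k) ->
  inW (t |` J)%fset v -> lmin J v -> weak_le v d.
Proof.
set J0 := (t |` J)%fset => J0S dJ0 d1 dm dJ.
have JJ0 : (J `<=` J0)%fset by exact: fsubsetU1.
have JS : (J `<=` S)%fset := fsubset_trans JJ0 J0S.
(* The conjugates of the elements of [J] by [d] are simple and no right descents. Together with one
   right descent [r] they exhaust [J0] by counting. *)
have rdesc s : s \in J0 -> inv d^-1 s \/ exists2 j : W, j \in J & d * s = j * d.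
  move=> sJ0; case ds : (inv d^-1 s); [by left|right].
  have [|r rJ0 dr] := inW_descent J0S (inWV J0S dJ0).
    by move=> e; apply: d1; rewrite -[d]invgK e invg1.
  pose K := [fset j ^ d | j in J]%fset.
  have KJ0 (k : W) : k \in K -> k \in J0 /\ inv d^-1 k = false.
    move=> kK; have [j jJ ->] : exists2 j : W, j \in J & k = j ^ d.
      by case/imfsetP: kK => j; exists j.
    have [k' k'S e] := dJ j jJ.
    have e' : j ^ d = k' by rewrite gconjE e mulKg.
    rewrite e'; split.
      apply: (gen_inW J0S k'S); rewrite -e' gconjE.
      apply: inWM; first exact: inWV.
      by apply: inWM => //; apply: inW_gen; exact: (fsubsetP JJ0).
    have := lenSr d k'S; case: ifP => // _; rewrite -e => h.
    have := lenSl d (gen_sub JS jJ); rewrite (dm _ jJ) => h2.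
    by move: h; rewrite h2; len_lia.
  have rK : r \notin K by apply/negP => /KJ0[_]; rewrite dr.
  have KrJ0 : ((r |` K) `<=` J0)%fset.
    by apply/fsubsetP => k /fset1UP[->|/KJ0[]].
  have eK : (r |` K)%fset = J0.
    apply/eqP; rewrite eqEfcard KrJ0 /= /J0 !cardfsU1 rK card_imfset /=; last exact: conjg_inj.
    by rewrite leq_add2r; case: (t \notin J).
  move: sJ0; rewrite -eK => /fset1UP[sr|/imfsetP[j /= jJ ->]]; first by rewrite sr dr in ds.
  by exists j; rewrite // -gconjC.
(* Climbing in the weak order among the elements without left descent in [J] never leaves the
   interval below [d]; the induction is on the remaining distance to [d]. *)
have step m : forall v1 s, len d - len v1 < m -> inW J0 v1 -> weak_le v1 d -> s \in J0 ->
    lmin J (v1 * s) -> len (v1 * s) = (len v1).+1 -> weak_le (v1 * s) d.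
  elim: m => // m IH v1 s dv v1J0 pv sJ0 vsm lvs; have sS := gen_sub J0S sJ0.
  have v1m := weak_le_lmin JS pv dm.
  set z := v1^-1 * d; have dE : d = v1 * z by rewrite mulVKg.
  have lz : len v1 + len z = len d := pv.
  have lsz : (v1 * s)^-1 * d = s * z by rewrite ginvM (gen_inv sS) dE -!gmulA mulVKg.
  rewrite /weak_le lsz lvs; have := lenSl z sS; case: ifP => [_|zs _]; first by move: lz; len_lia.
  exfalso.
  have zJ0 : inW J0 z by apply: inWM => //; exact: inWV.
  have z1 : z <> 1.
    move=> z1; have vd : v1 = d by rewrite dE z1 mulg1.
    rewrite vd in vsm lvs; case: (rdesc s sJ0) => [ds|[j jJ e]].
      by have := lenSr d sS; rewrite ds lvs /=; len_lia.
    have := vsm j jJ; rewrite e inv_reflM ?dm //.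
    exact: refl_gen (gen_sub JS jJ).
  have [s' s'J0 zs'] := inW_descent J0S zJ0 z1; have s'S := gen_sub J0S s'J0.
  (* If [s] is no descent of [z], the dihedral part [x0] of [z] for [s] and [s'] is not longest, so
     some [a] prolongs it. If [v1 * x0 * a] is admissible, induction puts it below [d], and [a] is a
     descent of [z0], which has none in [I]. Otherwise some [j] in [J] is conjugated by [v1] to [s]
     or [s'], and either case gives an element without left descent in [J] that is inverted by
     [j]. *)
  pose I := [fset s; s']%fset.
  have IJ0 : (I `<=` J0)%fset by apply/fsubsetP => k /fset2P[]->.
  have IS : (I `<=` S)%fset := fsubset_trans IJ0 J0S.
  have sI : s \in I by rewrite !inE eqxx.
  have s'I : s' \in I by rewrite !inE eqxx orbT.
  have [x0 [z0 [zE x0I z0m lz0]]] := lmin_decomp z IS.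
  have invz k : k \in I -> inv z k = inv x0 k.
    move=> kI; rewrite zE invertsM (lmin_refl IS z0m) ?addbF //.
      by apply: refl_conj; apply: refl_gen; exact: gen_sub kI.
    by rewrite gconjE; apply: inWM; [exact: inWV|apply: inWM => //; exact: inW_gen].
  have [a aI x0a] : exists2 a : W, a \in I & inv x0^-1 a = false.
    apply: contrapT => no; have all_desc k : k \in I -> inv x0^-1 k.
      by move=> kI; apply: contrapT => /negP/negbTE h; apply: no; exists k.
    have yI : inW I (x0^-1 * s) by apply: inWM; [exact: inWV|exact: inW_gen].
    have := descents_weak_le IS all_desc yI; rewrite /weak_le.
    have := lenSl x0 sS; rewrite -invz // zs /= => h.
    rewrite -(lenV (x0^-1 * s)) ginvM invgK (gen_inv sS) h lenV addSn => /eqP.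
    by rewrite eqn_leq ltnNge leq_addr.
  have aS := gen_sub IS aI.
  have v1I : lmin I v1^-1.
    move=> k; rewrite !inE => /orP[] /eqP->.
      by have := lenSr v1 sS; case: ifP => // _; rewrite lvs; len_lia.
    have := lenSr v1 s'S; case: ifP => // _ h.
    have := lenSl z s'S; rewrite zs' /= => h2.
    have h3 : len d <= len (v1 * s') + len (s' * z).
      by have := lenM (v1 * s') (s' * z); rewrite -!gmulA genK // -dE.
    by exfalso; move: h3 lz h h2; len_lia.
  have lvx : len (v1 * x0) = len v1 + len x0 by rewrite (rminM IS v1I).
  have pvx : weak_le (v1 * x0) d.
    by rewrite /weak_le lvx dE zE ginvM -!gmulA mulKg mulKg -addnA -lz0 -zE -dE.
  have lx0a : len (x0 * a) = (len x0).+1 by have := lenSr x0 aS; rewrite x0a.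
  have x0aI : inW I (x0 * a) by apply: inWM => //; exact: inW_gen.
  have x01 : 0 < len x0.
    by rewrite lt0n; apply/eqP => /len_eq0 e; have := invz s' s'I; rewrite zs' e inverts1.
  have lvxa : len (v1 * x0 * a) = (len (v1 * x0)).+1.
    by rewrite -gmulA (rminM IS v1I) // lx0a addnS lvx.
  have vxJ0 : inW J0 (v1 * x0) by apply: inWM => //; exact: inWS x0I.
  have [vxam|] := pselect (lmin J (v1 * x0 * a)).
    have ll : len d - len (v1 * x0) < m.
      by rewrite lvx; move: dv x01 pvx; rewrite /weak_le lvx; len_lia.
    have aJ0 : a \in J0 by exact: (fsubsetP IJ0).
    have := IH _ a ll vxJ0 pvx aJ0 vxam lvxa; rewrite /weak_le lvxa dE zE.
    rewrite !ginvM (gen_inv aS) -!gmulA mulKg mulKg -zE -dE.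
    by have := lenSl z0 aS; rewrite z0m //= => ->; move: pvx; rewrite /weak_le dE zE ginvM -!gmulA !mulKg -zE -dE; len_lia.
  move=> /existsNP[j /not_implyP[jJ /eqP]]; rewrite eqbF_neg negbK invertsM.
  have rj := refl_gen (gen_sub JS jJ).
  rewrite (weak_le_lmin JS pvx dm) //= inv_gen // => /eqP ja.
  have rI : inW I (j ^ v1).
    have -> : j ^ v1 = x0 * a * x0^-1.
      by rewrite -ja conjgM gconjE -!gmulA mulVKg mulgV mulg1.
    by apply: inWM; [apply: inWM => //; exact: inW_gen|exact: inWV].
  have := rminM IS v1I rI; rewrite -gconjC.
  have := lenSl v1 (gen_sub JS jJ); rewrite v1m //= => -> h.
  have : j ^ v1 \in I by apply: inW_len1 => //; move: h; len_lia.
  rewrite !inE => /orP[] /eqP jv.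
    by have := vsm j jJ; rewrite -jv -gconjC inv_reflM // v1m.
  have pvs' : weak_le (v1 * s') d.
    have := lenSl z s'S; rewrite zs' /= => h2.
    rewrite /weak_le ginvM (gen_inv s'S) dE -!gmulA mulKg.
    have := lenSr v1 s'S; rewrite v1I //= => ->; rewrite -dE; move: h2 lz; len_lia.
  by have := weak_le_lmin JS pvs' dm jJ; rewrite -jv -gconjC inv_reflM // v1m.
move=> vJ0; move En : (len v) => n; elim: n v En vJ0 => [|n IH] v vn vJ0 vm.
  by rewrite /weak_le (len_eq0 vn) len1 invg1 mul1g.
have v1 : v <> 1 by move=> e; rewrite e len1 in vn.
have [|s sJ0 vs] := inW_descent J0S (inWV J0S vJ0).
  by move=> e; apply: v1; rewrite -[v]invgK e invg1.
have sS := gen_sub J0S sJ0; have := lenSr v sS; rewrite vs /= => h.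
have vsJ0 : inW J0 (v * s) by apply: inWM => //; exact: inW_gen.
have pvs : weak_le (v * s) v.
  by rewrite /weak_le ginvM -gmulA mulVg mulg1 (gen_inv sS) (len_gen sS) h addn1.
rewrite -(genKr v sS); apply: (step (len d).+1) => //.
- by rewrite ltnS leq_subr.
- by apply: IH => //; [by move: h vn; clear; lia|exact: weak_le_lmin pvs vm].
- by rewrite genKr.
- by rewrite genKr.
Qed.

(** * Alternating words in two generators *)

Lemma expg_rot n s t : s * (t * s) ^+ n * t = s * t * (s * t) ^+ n.
Proof.
elim: n => [|n IH]; first by rewrite !mulg1.
by rewrite !expgSr !gmulA IH -!gmulA.
Qed.

Fixpoint altw n s t := if n is n'.+1 then s :: altw n' t s else [::].

Lemma refls_altw n s t : s \in S -> t \in S ->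
  refls (altw n s t) = [seq (s * t) ^+ i * s | i <- iota 0 n].
Proof.
elim: n s t => //= n IH s t sS tS; rewrite mul1g IH // (iotaDl 1 0) -!map_comp.
congr cons; apply: eq_map => i /=; rewrite gen_conj // expgS !gmulA; congr (_ * _).
exact: expg_rot.
Qed.

Lemma word_altw n s t : s \in S -> t \in S -> word S (altw n s t).
Proof. by elim: n s t => //= n IH s t sS tS; rewrite sS IH. Qed.

Lemma uniq_refls p : word S p -> uniq (refls p) -> len (wprod p) = size p.
Proof.
move=> pS up; apply/eqP; rewrite eqn_leq len_wprod //= -(size_refls p) -[len _]size_refls.
apply: uniq_leq_size => // x xp; case: (rwordP (wprod p)) => rS rE _.
apply: inv_refls => //; rewrite rE inv_wprod // count_uniq_mem // xp //.
Qed.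

(** Two equal walls along the alternating word would make a smaller power of [s * t] trivial, so the
    walls are distinct and the word is reduced. *)
Lemma len_altw n s t : s \in S -> t \in S ->
  (forall m : nat, 0 < m < n -> (s * t) ^+ m <> 1) -> len (wprod (altw n s t)) = n.
Proof.
move=> sS tS st; have sz : size (altw n s t) = n by elim: n s t {st sS tS} => //= n IH s t; rewrite IH.
rewrite uniq_refls ?word_altw // refls_altw // map_inj_in_uniq ?iota_uniq // => i j.
rewrite !mem_iota /= !add0n.
wlog ij : i j / i < j.
  move=> h ii jj e; case: (ltngtP i j) => // ij; first exact: h.
  by apply/esym/h.
move=> _ jn /mulIg e; case: (st (j - i)); first by lia.
by rewrite expgnFr ?(ltnW ij) // -e mulgV.
Qed.

(** The braid relation of length [n] holds exactly when the power on the right is trivial. *)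
Lemma altw_div n s t : s \in S -> t \in S ->
  wprod (altw n s t) * (wprod (altw n t s))^-1 = (s * t) ^+ n.
Proof.
elim: n s t => [|n IH] s t sS tS /=; first by rewrite mulgV.
by rewrite ginvM (gen_inv tS) !gmulA -(gmulA s) IH // expgS expg_rot.
Qed.

End Coxeter.

(** * W-metric spaces and their apartments *)

Section Metric.
Variables (W : groupType) (S : {fset W}) (Ch : Type) (dl : Ch -> Ch -> W).

(** The descent condition in the second case of [dl_step] is what makes the chamber of a panel
    nearest to [D] unique. *)
Record wmetric : Prop := WMetric {
  dl_eq : forall C D, dl C D = 1 <-> C = D;
  dl_sym : forall C D, dl D C = (dl C D)^-1;
  dl_step : forall (s : W) C C' D, s \in S -> dl C C' = s ->
    dl C' D = s * dl C D \/ (dl C' D = dl C D /\ inverts S (dl C D) s);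
  dl_ex : forall (s : W) C D, s \in S ->
    exists C', dl C C' = s /\ dl C' D = s * dl C D }.

(** Only neighbours are compared; that such a map preserves all distances is [apt_dl]. *)
Definition apt (f : W -> Ch) := forall w s : W, s \in S -> dl (f w) (f (w * s)) = s.

(** Partial isometries are given by their graphs, so that unions and Zorn's lemma apply directly. *)
Definition iso (G : set (W * Ch)) :=
  forall p q, G p -> G q -> dl p.2 q.2 = p.1^-1 * q.1.

Definition dbtw C E D := len S (dl C E) + len S (dl E D) = len S (dl C D).

Hypotheses (hWS : coxeter_system S) (hM : wmetric).
Implicit Types (p q : seq W) (s t x r u v w j k a b c d y z : W) (J K : {fset W}).
Implicit Types (C D E X Y Z : Ch) (f g h : W -> Ch) (G M : set (W * Ch)).

Local Notation len := (len S).
Local Notation inv := (inverts S).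

Lemma dlxx C : dl C C = 1.
Proof. exact/(dl_eq hM). Qed.

Lemma dl_eq1 C D : dl C D = 1 -> C = D.
Proof. by move/(dl_eq hM). Qed.

Lemma dlC s C D : s \in S -> dl C D = s -> dl D C = s.
Proof. by move=> sS e; rewrite (dl_sym hM) e (gen_inv hWS). Qed.

Lemma dl_up s C C' D : s \in S -> dl C C' = s -> inv (dl C D) s = false ->
  dl C' D = s * dl C D.
Proof. by move=> sS e i; case: (dl_step hM D sS e) => // -[_]; rewrite i. Qed.

Lemma len_pos n u : len u = n.+1 -> exists2 s : W, s \in S & inv u s /\ len (s * u) = n.
Proof.
move=> un; have [|s sS us] := inW_descent hWS (fsubset_refl S) (inW_full hWS u).
  by move=> e; rewrite e (len1 hWS) in un.
by exists s => //; split=> //; have := lenSl hWS u sS; rewrite us un => -[].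
Qed.

Lemma inv_up s u : s \in S -> len u < len (s * u) -> inv u s = false.
Proof. by move=> sS h; apply/negP => /(inv_len hWS); rewrite ltnNge (ltnW h). Qed.

Lemma lenS_le s u : s \in S -> len u <= (len (s * u)).+1.
Proof.
by move=> sS; have := lenSl hWS u sS; case: ifP => _ ->; rewrite // leqW.
Qed.

Lemma dl_add C D E : len (dl C D * dl D E) = len (dl C D) + len (dl D E) ->
  dl C E = dl C D * dl D E.
Proof.
move En : (len (dl C D)) => n; elim: n C En => [|n IH] C Cn.
  by have e := len_eq0 hWS Cn; rewrite e mul1g => _; rewrite (dl_eq1 e).
move=> ad; have [s sS [us un]] := len_pos Cn.
have [C' [CC' C'D]] := dl_ex hM C D sS.
have l1 := lenSl hWS (dl C' D * dl D E) sS.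
have l2 := lenM hWS (dl C' D) (dl D E).
have e1 : s * (dl C' D * dl D E) = dl C D * dl D E by rewrite C'D -!gmulA (genK hWS).
rewrite e1 in l1; rewrite {2}C'D un in l2.
have ns : inv (dl C' D * dl D E) s = false.
  by apply: inv_up => //; rewrite e1 ad; lia.
rewrite ns ad in l1.
have e2 : dl C' E = dl C' D * dl D E by apply: IH; rewrite C'D //; rewrite -C'D; lia.
by rewrite (dl_up sS (dlC sS CC')) e2 ?e1.
Qed.

Lemma dl_split C D u v : dl C D = u * v -> len (u * v) = len u + len v ->
  exists E, dl C E = u /\ dl E D = v.
Proof.
move=> CD; move En : (len u) => n; elim: n C u CD En => [|n IH] C u CD un ad.
  by exists C; rewrite dlxx CD (len_eq0 hWS un) mul1g.
have [s sS [us sn]] := len_pos un; have [C' [CC' C'D]] := dl_ex hM C D sS.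
rewrite CD gmulA in C'D; have [|E [C'E ED]] := IH _ _ C'D sn.
  apply/eqP; rewrite eqn_leq -{1}sn (lenM hWS) /= -ltnS -addSn -ad -gmulA.
  exact: lenS_le.
exists E; split=> //; rewrite (dl_up sS (dlC sS CC')) C'E ?(genK hWS) //.
by apply: inv_up; rewrite // (genK hWS) // sn un.
Qed.

Lemma proj_uniq s C X Y D : s \in S -> dl C X = s -> dl C Y = s -> inv (dl C D) s ->
  dl X D = s * dl C D -> dl Y D = s * dl C D -> X = Y.
Proof.
move=> sS CX CY i XD YD; case: (dl_step hM Y sS CX) => [|[+ _]]; rewrite CY.
  by rewrite (gen_sq hWS) // => /dl_eq1.
move=> XY; have := @dl_up s X Y D sS XY; rewrite XD YD (genK hWS) //.
have ii : inv (s * dl C D) s = false by rewrite (inv_reflM hWS) ?i //; exact: refl_gen.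
by move/(_ ii) => e; have := inv_len hWS i; rewrite -e (genK hWS) ?e ?ltnn.
Qed.

Lemma dl_uniq C D X Y : dl C X = dl C Y -> dl X D = dl Y D ->
  len (dl C X * dl X D) = len (dl C X) + len (dl X D) -> X = Y.
Proof.
move En : (len (dl C X)) => n; elim: n C En => [|n IH] C Cn.
  by have e := len_eq0 hWS Cn; rewrite e => e2 _ _; rewrite -(dl_eq1 e); apply: dl_eq1.
move=> eC eD ad; have [s sS [us un]] := len_pos Cn.
have [C1 [CC1 C1X]] := dl_ex hM C X sS; have [C2 [CC2 C2Y]] := dl_ex hM C Y sS.
rewrite -eC in C2Y.
have ad1 : len (s * (dl C X * dl X D)) = n + len (dl X D).
  apply/eqP; rewrite eqn_leq -{1}un gmulA (lenM hWS) /= -ltnS -addSn -ad -gmulA.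
  exact: lenS_le.
have CD : dl C D = dl C X * dl X D by apply: dl_add; rewrite ad Cn.
have C1D : dl C1 D = s * dl C D.
  by rewrite CD gmulA -C1X; apply: dl_add; rewrite C1X un -gmulA.
have C2D : dl C2 D = s * dl C D.
  by rewrite CD gmulA -C2Y eD; apply: dl_add; rewrite C2Y -eD un -gmulA.
have i : inv (dl C D) s.
  have := lenSl hWS (dl C D) sS; rewrite CD ad ad1; case: ifP => // _ h.
  by exfalso; move: h; len_lia.
have e12 := proj_uniq sS CC1 CC2 i C1D C2D; rewrite -e12 in C2Y.
by apply: (IH C1); rewrite ?C1X ?C2Y // -gmulA.
Qed.

Lemma dl_stepr s C D D' : s \in S -> dl D D' = s ->
  dl C D' = dl C D * s \/ dl C D' = dl C D.
Proof.
move=> sS e; rewrite !(dl_sym hM _ C); case: (dl_step hM C sS e) => [->|[-> _]]; [left|by right].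
by rewrite ginvM (gen_inv hWS sS).
Qed.

(** Each step of a gallery from [X] to [D] either multiplies the distance from [C] by its letter or
    leaves it unchanged. *)
Lemma dl_subseq p C X D : word S p -> dl X D = wprod p ->
  exists2 q, subseq q p & dl C D = dl C X * wprod q.
Proof.
elim: p X => [|s p IH] X /=; first by move=> _ /dl_eq1->; exists [::]; rewrite //= mulg1.
case/andP => sS pS XD; have [X' [XX' X'D]] := dl_ex hM X D sS.
have [|q qp CD] := IH X' pS; first by rewrite X'D XD (genK hWS).
case: (dl_stepr C sS XX') => e; rewrite CD e.
  by exists (s :: q); rewrite /= ?eqxx // gmulA.
by exists q; first exact: (subseq_trans qp (subseq_cons p s)).
Qed.

(** Additivity of the lengths leaves no room for a dropped letter, so the subword given by
    [dl_subseq] is the whole word. *)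
Lemma dbtw_mul C E D : dbtw C E D -> dl C D = dl C E * dl E D.
Proof.
case: (rwordP hWS (dl E D)) => pS pE _; rewrite /dbtw => b.
have [q qp CD] := dl_subseq C pS (esym pE).
have qS : word S q by apply/allP => s /(mem_subseq qp)/(allP pS).
have qs : size (rword S (dl E D)) <= size q.
  have := lenM hWS (dl C E) (wprod q); have := len_wprod hWS qS.
  rewrite -CD -b => h1 h2; rewrite -(leq_add2l (len (dl C E))).
  by apply: leq_trans h2 _; rewrite leq_add2l.
rewrite CD -{1}pE; congr (_ * wprod _); apply/eqP.
by rewrite -(size_subseq_leqif qp) eqn_leq qs size_subseq.
Qed.

Lemma apt_dl f a b : apt f -> dl (f a) (f b) = a^-1 * b.
Proof.
move=> fA; move En : (len (a^-1 * b)) => n; elim: n a En => [|n IH] a an.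
  have e := len_eq0 hWS an; rewrite e; apply/(dl_eq hM); congr f.
  by rewrite -[a]mulg1 -e mulVKg.
have [s sS [us un]] := len_pos an.
have e : (a * s)^-1 * b = s * (a^-1 * b) by rewrite ginvM (gen_inv hWS) // gmulA.
have := IH (a * s); rewrite e => /(_ un) h.
rewrite (@dl_up s (f (a * s))) ?h ?(genK hWS) //; first by apply: dlC => //; exact: fA.
by rewrite (inv_reflM hWS) ?us //; exact: refl_gen.
Qed.

Lemma apt_mul f a : apt f -> apt (fun w => f (a * w)).
Proof. by move=> fA w s sS; rewrite gmulA; exact: fA. Qed.

Lemma apt_inj f a b : apt f -> f a = f b -> a = b.
Proof.
move=> fA /(dl_eq hM); rewrite apt_dl // => e.
by rewrite -[a]mulg1 -e mulVKg.
Qed.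

(** A chamber on a minimal gallery is determined by its distances to the two ends. This rigidity
    carries agreement at two chambers over to their whole hull. *)
Lemma apt_btw f g a c b : apt f -> apt g -> f a = g a -> f b = g b ->
  btw S a c b -> f c = g c.
Proof.
move=> fA gA ea eb bt; apply: (@dl_uniq (f a) (f b)).
- by rewrite {2}ea !apt_dl.
- by rewrite {2}eb !apt_dl.
- by rewrite !apt_dl // bt -gmulA mulVKg.
Qed.

Lemma apt_eq f g a b k : apt f -> apt g -> f k = g k -> f a = g b -> a = b.
Proof.
move=> fA gA ek eab; have := apt_dl k a fA; rewrite ek eab apt_dl //.
by move/mulgI.
Qed.

Lemma dbtw_apt f a b E : apt f -> dbtw (f a) E (f b) -> exists2 c : W, E = f c & btw S a c b.
Proof.
move=> fA bt; have := dbtw_mul bt; rewrite apt_dl // => e.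
pose c := a * dl (f a) E.
have ec : c^-1 * b = dl E (f b) by rewrite /c ginvM -gmulA e mulKg.
exists c; last by rewrite /btw ec /c mulKg; move: bt; rewrite /dbtw apt_dl.
apply: (@dl_uniq (f a) (f b)); rewrite ?apt_dl //; first by rewrite mulKg.
by rewrite -e; move: bt; rewrite /dbtw apt_dl.
Qed.

Lemma apt_dbtw f a c b : apt f -> btw S a c b -> dbtw (f a) (f c) (f b).
Proof. by move=> fA; rewrite /btw /dbtw !apt_dl. Qed.

(** [Z] is the projection of [C] to the residue of type [K] of [D]; distances from the residue to
    [C] factor through it. *)
Lemma gate_ex K C D : (K `<=` S)%fset ->
  exists Z, inW K (dl D Z) /\ lmin S K (dl Z C).
Proof.
move=> KS; have [y [v [e yK vm l]]] := lmin_decomp hWS (dl D C) KS.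
have [|Z [DZ ZC]] := @dl_split D C y v e; first by rewrite -e.
by exists Z; rewrite DZ ZC.
Qed.

Lemma gate_add K Z C X : (K `<=` S)%fset -> lmin S K (dl Z C) -> inW K (dl X Z) ->
  dl X C = dl X Z * dl Z C.
Proof. by move=> KS zm xK; apply: dl_add; exact: (lminM hWS KS zm xK). Qed.

Lemma gate_uniq K Z Z' C : (K `<=` S)%fset -> lmin S K (dl Z C) -> lmin S K (dl Z' C) ->
  inW K (dl Z Z') -> Z = Z'.
Proof.
move=> KS zm zm' zz; apply: dl_eq1.
have e := gate_add KS zm' zz.
have [|<-//] := @lmin_uniq _ _ hWS K 1 (dl Z C) (dl Z Z') (dl Z' C) KS zm zm' (inW1 K) zz.
by rewrite mul1g.
Qed.

Lemma iso_add G m : iso G -> (forall m', G m' -> dl m.2 m'.2 = m.1^-1 * m'.1) ->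
  iso (G `|` [set m]).
Proof.
move=> iG h n n' [Gn|->] [Gn'|->] /=; [exact: iG| |exact: h|by rewrite dlxx mulVg].
by rewrite (dl_sym hM) h // ginvM invgK.
Qed.

(** Nothing known lies beyond the wall, so passing from [X] to any other chamber of the panel
    lengthens all distances in the same way. *)
Lemma iso_free G x s X E : iso G -> s \in S -> G (x, X) -> dl X E = s ->
  (forall m, G m -> inv (x^-1 * m.1) s = false) -> iso (G `|` [set (x * s, E)]).
Proof.
move=> iG sS GX XE no; apply: iso_add => // m Gm.
have := iG _ _ GX Gm => /= e.
by rewrite (dl_up sS XE) ?e ?no // ginvM (gen_inv hWS sS) gmulA.
Qed.

(** A known chamber beyond the wall determines [E] by projection. Suppose another one, [Z], had a
    different projection [E']. From [Y] one reaches [Z] through [E'], and the distance from [Y] to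
    [Z] would then require an element of greater length than the subword available for it. *)
Lemma iso_forced G x s X E y Y : iso G -> s \in S -> G (x, X) -> G (y, Y) ->
  inv (x^-1 * y) s -> dl X E = s -> dl E Y = s * (x^-1 * y) ->
  iso (G `|` [set (x * s, E)]).
Proof.
move=> iG sS GX GY iy XE EY; apply: iso_add => // [[z Z]] Gm /=.
have e := iG _ _ GX Gm; rewrite /= in e.
have eE : (x * s)^-1 * z = s * (x^-1 * z) by rewrite ginvM (gen_inv hWS sS) gmulA.
rewrite eE; case iz : (inv (x^-1 * z) s); last by rewrite (dl_up sS XE) e.
case: (dl_step hM Z sS XE) => [|[bad _]]; first by rewrite e.
exfalso.
have [E' [XE' E'Z]] := dl_ex hM X Z sS; rewrite e in E'Z bad.
have lz := lenSl hWS (x^-1 * z) sS; rewrite iz in lz.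
have EE' : dl E E' = s.
  case: (dl_step hM E' sS XE) => [|[-> _]]; last exact: XE'.
  rewrite XE' (gen_sq hWS) // => /dl_eq1 EE; rewrite EE E'Z in bad.
  by move: lz; rewrite bad => /eqP; rewrite eqn_leq ltnn andbF.
have YE : dl Y E = (x^-1 * y)^-1 * s by rewrite (dl_sym hM) EY ginvM (gen_inv hWS sS).
have YE' : dl Y E' = (x^-1 * y)^-1.
  rewrite (dl_sym hM) (@dl_up s E E' Y) //; last first.
    by rewrite EY (inv_reflM hWS) ?iy //; exact: refl_gen.
  by rewrite EY (genK hWS).
case: (rwordP hWS (dl E' Z)) => pS pE _.
have [q qp YZ] := dl_subseq Y pS (esym pE).
have qS : word S q by apply/allP => t /(mem_subseq qp)/(allP pS).
have := iG _ _ GY Gm; rewrite /= YZ YE' => eq1.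
have eq2 : wprod q = x^-1 * z.
  by apply: (mulgI (x^-1 * y)^-1); rewrite eq1 ginvM invgK -!gmulA mulVKg.
have := len_wprod hWS qS; rewrite eq2 lz ltnNge -E'Z.
by rewrite (size_subseq qp).
Qed.

(** [Q] restricts the pairs that may be added; this allows a first round of extensions obeying
    prescriptions before the unrestricted one. *)
Lemma max_iso G (Q : set (W * Ch)) : iso G ->
  exists M, [/\ iso M, G `<=` M, M `<=` G `|` Q &
    forall m, Q m -> iso (M `|` [set m]) -> M m].
Proof.
(* [G] is joined to [A] instead of being required inside it, so that the union of the empty chain
   qualifies. *)
move=> iG; pose P A := iso (A `|` G) /\ A `<=` Q.
have [|A [[iA AQ] Amax]] := @Zorn_bigcup _ P.
  move=> F FP tot; split; last by move=> m [A /FP[_ AQ] Am]; exact: AQ.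
  have inA A m n : F A -> (A `|` G) m -> (A `|` G) n -> dl m.2 n.2 = m.1^-1 * n.1.
    by move=> /FP[iA _]; exact: iA.
  move=> m n [[A FA Am]|Gm] [[B FB Bn]|Gn]; last exact: iG.
  - by case: (tot A B FA FB) => AB; [apply: (inA B)|apply: (inA A)] => //; left; auto.
  - by apply: (inA A) => //; [left|right].
  - by apply: (inA B) => //; [right|left].
exists (A `|` G); split=> //.
  by move=> m [/AQ Qm|Gm]; [right|left].
move=> m Qm im.
apply: contrapT => nm; apply: (Amax (A `|` [set m])).
  split=> [n An|]; first by left.
  by move=> h; apply: nm; left; apply: h; right.
split; last by move=> n [/AQ//|->].
by rewrite -setUA (setUC [set m]) setUA.
Qed.

(** A maximal isometry can be continued across every panel, by projection if something is known
    beyond the wall and arbitrarily otherwise. *)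
Lemma iso_extend G m : iso G -> G m -> exists f, apt f /\ forall n, G n -> f n.1 = n.2.
Proof.
move=> iG Gm; have [M [iM GM _ Mmax]] := max_iso setT iG.
have dom w : exists X, M (w, X).
  have [p pS pw] := inW_full hWS (m.1^-1 * w).
  have -> : w = m.1 * wprod p by rewrite pw mulVKg.
  elim/last_ind: p pS {pw} => [_|p s IH]; first by exists m.2; rewrite mulg1 -surjective_pairing; exact: GM.
  rewrite -cats1 word_cat wprod_cat /= mulg1 gmulA => /andP[pS /andP[sS _]].
  have [X MX] := IH pS; set x := m.1 * wprod p.
  have [[n [Mn ni]]|no] := pselect (exists n, M n /\ inv (x^-1 * n.1) s).
    have [E [XE EY]] := dl_ex hM X n.2 sS; exists E; apply: Mmax => //.
    apply: (iso_forced (y := n.1) (Y := n.2) iM sS MX) => //.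
      by rewrite -surjective_pairing.
    by rewrite EY; congr (_ * _); exact: (iM _ _ MX Mn).
  have [E [XE _]] := dl_ex hM X X sS; exists E; apply: Mmax => //.
  apply: (iso_free iM sS MX XE) => n Mn; apply/negP => h; apply: no.
  by exists n.
have [f fM] := choice dom; exists f; split.
  by move=> w s sS; rewrite (iM _ _ (fM w) (fM (w * s))) /= mulKg.
by move=> n Gn; apply: dl_eq1; rewrite (iM _ _ (fM n.1) (GM _ Gn)) /= mulVg.
Qed.

(* Two prescriptions at the same wall determine each other by projection and are
   therefore compatible. *)
Lemma iso_avoid G m f (bd : set (W * W)) :
  (forall (s : W) C E, s \in S -> exists C', dl C C' = s /\ C' <> E) ->
  apt f -> iso G -> G m ->
  (forall c t, bd (c, t) -> [/\ t \in S, G (c, f c) &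
     forall n, G n -> inv (c^-1 * n.1) t = false]) ->
  exists g, [/\ apt g, forall n, G n -> g n.1 = n.2 &
    forall c t, bd (c, t) -> g (c * t) <> f (c * t)].
Proof.
move=> thick fA iG Gm bdP.
pose Q : set (W * Ch) := [set n | exists c t, [/\ bd (c, t), n.1 = c * t & n.2 <> f (c * t)]].
have [M [iM GM MQ Mmax]] := max_iso Q iG.
have bdM c t : bd (c, t) -> exists Y, M (c * t, Y) /\ Y <> f (c * t).
  move=> bct; have [tS Gc no] := bdP _ _ bct; have Mc := GM _ Gc.
  have [[n [Mn ni]]|noM] := pselect (exists n, M n /\ inv (c^-1 * n.1) t).
    have [E [XE EY]] := dl_ex hM (f c) n.2 tS.
    have eY := iM _ _ Mc Mn; rewrite /= in eY; rewrite eY in EY.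
    suff nE : E <> f (c * t).
      exists E; split=> //; apply: Mmax; first by exists c, t.
      apply: (iso_forced (y := n.1) (Y := n.2) iM tS Mc) => //.
      by rewrite -surjective_pairing.
    (* A pair of [M] beyond the wall does not come from [G], so it was added at some [(c', t')], and
       this turns out to be the same wall. If [E] were [f (c * t)], both [n.2] and [f (c' * t')]
       would be its projection to the panel at [f c']. *)
    move=> eE; case: (MQ _ Mn) => [/no|[c' [t' [bct' n1 n2]]]]; first by rewrite ni.
    have [t'S Gc' no'] := bdP _ _ bct'; have Mc' := GM _ Gc'.
    have [g gdef] : exists g : W, c^-1 * c' = g by exists (c^-1 * c').
    have gt : inv g t = false by rewrite -gdef; exact: no _ Gc'.
    have tg : t ^ g = t'.
      move: ni; rewrite n1 gmulA gdef (invertsM hWS) gt /= (inv_gen hWS) // => /eqP //.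
    have tg2 : t * g = g * t' by rewrite -tg -gconjC.
    have EYg : dl E n.2 = g.
      have e : c^-1 * n.1 = g * t' by rewrite n1 gmulA gdef.
      by rewrite EY e -tg2 (genK hWS).
    have gt' : inv g^-1 t' = false by rewrite (invertsV hWS) -tg conjgK.
    have gE : c'^-1 * (c * t) = t' * g^-1.
      rewrite gmulA; have -> : c'^-1 * c = g^-1 by rewrite -gdef ginvM invgK.
      by rewrite -tg gconjE -!gmulA mulgV mulg1.
    have fE : dl (f c') E = t' * g^-1 by rewrite eE apt_dl.
    apply: n2; apply: (@proj_uniq t' (f c') n.2 (f (c' * t')) E t'S).
    - by have := iM _ _ Mc' Mn; rewrite /= n1 mulKg.
    - exact: fA.
    - rewrite fE (inv_reflM hWS) ?gt' //; exact: refl_gen.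
    - by rewrite fE (genK hWS) // (dl_sym hM) EYg.
    - by rewrite fE eE apt_dl // ginvM -!gmulA (gen_inv hWS t'S) gE.
  have [E [XE nE]] := thick t (f c) (f (c * t)) tS; exists E; split=> //.
  apply: Mmax; first by exists c, t.
  apply: (iso_free iM tS Mc XE) => n Mn; apply/negP => h; apply: noM.
  by exists n.
have [g [gA gM]] := iso_extend iM (GM _ Gm); exists g; split=> // [n Gn|c t bct].
  by apply: gM; exact: GM.
by have [Y [MY nY]] := bdM _ _ bct; rewrite (gM _ MY).
Qed.

(** Three half-apartments have a common wall. The half shared by [f] and [g] is discarded and the
    two others are glued, that of [f] after reflection by [s]. *)
Lemma apt_fold f g s : s \in S -> apt f -> apt g ->
  (forall w, inv w s -> g w = f w) -> g 1 <> f 1 ->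
  apt (fun w => if inv w s then f (s * w) else g w).
Proof.
move=> sS fA gA gf g1.
have gs : g s = f s by apply: gf; rewrite (inv_gen hWS).
have cross w t : t \in S -> inv w s = false -> inv (w * t) s -> dl (g w) (f (s * (w * t))) = t.
  move=> tS ws; rewrite (invertsM hWS) ws /= (inv_gen hWS) // => /eqP swt.
  have wt : w * t = s * w by rewrite -swt -gconjC.
  have e : s * (w * t) = w by rewrite wt (genK hWS).
  rewrite e; have gwt : g (w * t) = f (w * t).
    by apply: gf; rewrite wt (inv_reflM hWS) ?ws //; exact: refl_gen.
  have h1 := dlC tS (gA w t tS); have h2 := dlC tS (fA w t tS).
  case: (dl_step hM (f w) tS h1) => [|[-> _]]; last by rewrite gwt h2.
  rewrite gwt h2 (gen_sq hWS) // => /dl_eq1 gw; case: g1.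
  apply: (@proj_uniq s (f s) (g 1) (f 1) (f w) sS).
  - by rewrite -gs apt_dl // mulg1 (gen_inv hWS).
  - by rewrite apt_dl // mulg1 (gen_inv hWS).
  - rewrite apt_dl // (gen_inv hWS) // (inv_reflM hWS) ?ws //; exact: refl_gen.
  - by rewrite -gw !apt_dl // gw apt_dl // invg1 mul1g (gen_inv hWS) // (genK hWS).
  - by rewrite !apt_dl // invg1 mul1g (gen_inv hWS) // (genK hWS).
move=> w t tS; case ws : (inv w s); case wts : (inv (w * t) s).
- by rewrite gmulA; exact: fA.
- apply: dlC => //; rewrite -{2}(genKr hWS w tS); apply: cross => //.
  by rewrite (genKr hWS).
- exact: cross.
- exact: gA.
Qed.
End Metric.

(** * Generic chambers *)

Section Generic.
Variables (W : groupType) (S : {fset W}) (Ch : Type) (dl : Ch -> Ch -> W).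
Hypotheses (hWS : coxeter_system S) (hM : wmetric S dl).
Implicit Types (p q : seq W) (s t x r u v w j k a b c d e y z : W) (J K L : {fset W}).
Implicit Types (C D E X Y Z : Ch) (f g h : W -> Ch) (G M : set (W * Ch)).

Local Notation len := (len S).
Local Notation inv := (inverts S).
Local Notation apt := (apt S dl).

(** [C] itself is already excluded by the distance [s], so two chambers of the panel are avoided
    here and three in [thick4]. *)
Definition thick3 := forall s C E, s \in S -> exists C', dl C C' = s /\ C' <> E.
Definition thick4 := forall s C E E', s \in S ->
  exists C', [/\ dl C C' = s, C' <> E & C' <> E'].

(** [X] is the projection of [C] to the panel of type [s] of [D]; the descent condition says that
    [D] itself is not. *)
Definition isproj s D X C := [/\ dl D X = s, inv (dl D C) s & dl X C = s * dl D C].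

Lemma isproj_uniq s D X Y C : s \in S -> isproj s D X C -> isproj s D Y C -> X = Y.
Proof. by move=> sS [DX i XC] [DY _ YC]; exact: (proj_uniq hWS hM sS DX DY i). Qed.

Lemma res_trans K X Y Z : inW K (dl X Y) -> inW K (dl Y Z) -> (K `<=` S)%fset -> inW K (dl X Z).
Proof.
move=> xy [p pK pE] KS.
have [q qp ->] := dl_subseq hWS hM X (word_sub KS pK) (esym pE).
apply: inWM => //; exists q => //.
by apply/allP => s /(mem_subseq qp)/(allP pK).
Qed.

Lemma res_sym K X Y : (K `<=` S)%fset -> inW K (dl X Y) -> inW K (dl Y X).
Proof. by move=> KS h; rewrite (dl_sym hM); exact: (inWV hWS). Qed.

Lemma lmin_inv K s y v : (K `<=` S)%fset -> s \in K -> inW K y -> lmin S K v ->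
  inv (y * v) s = inv y s.
Proof.
move=> KS sK yK vm; rewrite (invertsM hWS) (lmin_refl hWS KS vm) ?addbF //.
  by apply: refl_conj; apply: refl_gen; exact: gen_sub sK.
rewrite gconjE; apply: inWM; first exact: (inWV hWS).
by apply: inWM => //; exact: inW_gen.
Qed.

Lemma isproj_gate K s D X C Z : (K `<=` S)%fset -> s \in K -> inW K (dl D Z) ->
  lmin S K (dl Z C) -> isproj s D X C -> isproj s D X Z.
Proof.
move=> KS sK dz zm [DX i XC]; have sS := gen_sub KS sK.
have eDC := gate_add hWS hM KS zm dz.
have xz : inW K (dl X Z).
  by apply: res_trans dz KS; rewrite (dlC hWS hM sS DX); exact: inW_gen.
split=> //; first by move: i; rewrite eDC (lmin_inv KS).
by move: XC; rewrite eDC (gate_add hWS hM KS zm xz) gmulA => /mulIg.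
Qed.

Lemma apt_isproj f s w a : apt f -> s \in S -> inv (w^-1 * a) s ->
  isproj s (f w) (f (w * s)) (f a).
Proof.
move=> fA sS i; split; [exact: fA|by rewrite (apt_dl hWS hM)|].
by rewrite !(apt_dl hWS hM) // ginvM (gen_inv hWS) // gmulA.
Qed.

Lemma inW_factor K u v : (K `<=` S)%fset -> len (u * v) = len u + len v ->
  inW K (u * v) -> inW K u.
Proof.
move=> KS; move En : (len u) => n; elim: n u En => [|n IH] u un ad uvK.
  by rewrite (len_eq0 hWS un); exact: inW1.
have [s sS [us sn]] := len_pos hWS un.
have uvs : inv (u * v) s.
  apply: (weak_le_inv hWS (u := u)) us; last exact: refl_gen.
  by rewrite /weak_le mulKg ad un.
have sK := inW_desc hWS KS uvK sS uvs.
rewrite -(genK hWS u sS); apply: inWM; first exact: inW_gen.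
have lsuv := lenSl hWS (u * v) sS; rewrite uvs ad in lsuv.
apply: IH => //; first by apply: succn_inj; rewrite -gmulA -lsuv.
by rewrite -gmulA; apply: inWM => //; exact: inW_gen.
Qed.

(** A third chamber of the panel is never the projection of a chamber of [f], so it is as far from
    [f w] as the farther one of [f 1] and [f s]. *)
Lemma apt_third f s D1 w : s \in S -> apt f -> dl (f 1) D1 = s -> D1 <> f s ->
  dl D1 (f w) = if inv w s then w else s * w.
Proof.
move=> sS fA fD nD; have e : dl (f 1) (f w) = w by rewrite (apt_dl hWS hM) // invg1 mul1g.
case: ifP => i; last by rewrite (dl_up hM sS fD) ?e.
case: (dl_step hM (f w) sS fD) => [|[-> _]]; rewrite e //.
move=> bad; case: nD; apply: (@isproj_uniq s (f 1) D1 (f s) (f w) sS).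
  by split; rewrite ?e.
by have := @apt_isproj f s 1 w fA sS; rewrite mul1g invg1 mul1g; apply.
Qed.

(** The residue of type [J] of [f 1] is the link. [D'] shares no vertex of a type in [J] with the
    chambers of [f] there, and [E s] is a neighbour of [D'] which is not the projection of any of
    them. The claim on types [r] outside [J] carries the induction: the projections to the panel of
    type [r], as far as they differ from [D'], take a single value. Finally [g] follows [f] along
    the simplices parallel to that of cotype [J]. *)
Lemma generic_chamber n J : #|` J| = n -> (J `<=` S)%fset -> J = fset0 \/ thick4 ->
  forall f, apt f -> exists D' (E : W -> Ch) g,
  [/\ apt g /\ g 1 = D', inW J (dl (f 1) D'),
   (forall w s, inW J w -> s \in J -> ~ inW (S `\ s)%fset (dl (f w) D')) /\
   (forall s, s \in J -> dl D' (E s) = s /\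
      forall w, inW J w -> ~ isproj s D' (E s) (f w)),
   (forall h r, apt h -> (forall w, inW J w -> h w = f w) -> r \in S -> r \notin J ->
      exists X0, forall w X, inW (r |` J)%fset w -> isproj r D' X (h w) -> X = X0) &
   (forall e K, (K `<=` S)%fset -> lmin S J e ->
      (forall j, j \in J -> exists2 k : W, k \in K & j * e = e * k) ->
      inW K (dl (f e) (g e)))].
Proof.
elim: n J => [|n IH] J Jn JS thk f fA.
  have J0 : J = fset0 by apply/cardfs0_eq.
  subst J; exists (f 1), (fun=> f 1), f; split=> //.
  - by rewrite (dlxx hM); exact: inW1.
  - move=> h r hA hf rS _; exists (h r) => w X _ pX.
    have h1 : h 1 = f 1 by apply: hf; exact: inW1.
    case: (pX) => _ i _; rewrite -h1 in i pX; rewrite (apt_dl hWS hM) // in i.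
    apply: (isproj_uniq rS pX); have := @apt_isproj h r 1 w hA rS.
    by rewrite mul1g; apply.
  - by move=> e K _ _ _; rewrite (dlxx hM); exact: inW1.
have [s sJ] : exists s, s \in J by apply/fset0Pn; rewrite -cardfs_gt0 Jn.
have thk4 : thick4 by case: thk => // J0; rewrite J0 inE in sJ.
have sS := gen_sub JS sJ.
pose J' := (J `\ s)%fset.
have J'J : (J' `<=` J)%fset by exact: fsubD1set.
have J'S := fsubset_trans J'J JS.
have J'n : #|` J'| = n by move: Jn; rewrite (cardfsD1 s) sJ => -[].
have nsJ' : s \notin J' by rewrite !inE eqxx.
have EJ : (s |` J' = J)%fset by exact: fsetD1K.
have [D1 [fD1 nD1 _]] := thk4 s (f 1) (f s) (f s) sS.
have D11 : D1 <> f 1.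
  by move=> e; have := gen_neq1 hWS sS; rewrite -fD1 e (dlxx hM).
have inv_nos K y : (K `<=` S)%fset -> s \notin K -> inW K y -> inv y s = false.
  by move=> KS sK yK; apply/negP => /(inW_desc hWS KS yK sS); apply/negP.
(* [hp] keeps the half of [h] beyond the wall of [s] and continues it by a new half containing the
   values of [g0]; [hm] joins this new half to the reflected other half of [h]. Together they cover
   [h]. *)
have half h (Q : {fset W}) (g0 : W -> Ch) : apt h -> h 1 = f 1 -> g0 1 = D1 ->
    (forall y y', inW Q y -> inW Q y' -> dl (g0 y) (g0 y') = y^-1 * y') ->
    (forall w y, inv w s -> inW Q y -> dl (h w) (g0 y) = w^-1 * y) ->
    exists hp hm, [/\ apt hp, apt hm, (forall y, inW Q y -> hp y = g0 y) &
      [/\ forall w, inv w s -> hp w = h w, forall w, inv w s = false -> hm (s * w) = h w &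
       forall w, inv w s = false -> hm w = hp w]].
  move=> hA h1 g01 gg hg.
  pose G := [set m : W * Ch | (inv m.1 s /\ m.2 = h m.1) \/ (inW Q m.1 /\ m.2 = g0 m.1)].
  have iG : iso dl G.
    move=> [x X] [y Y] [] /= [xi ->] [] /= [yi ->].
    - by rewrite (apt_dl hWS hM).
    - exact: hg.
    - by rewrite (dl_sym hM) hg // ginvM invgK.
    - exact: gg.
  have G1 : G (1, g0 1) by right; split=> //; exact: inW1.
  have [hp [hpA hpG]] := iso_extend hWS hM iG G1.
  have hph w : inv w s -> hp w = h w by move=> i; apply: (hpG (w, h w)); left.
  have hp1 : hp 1 <> h 1 by rewrite (hpG (1, g0 1) G1) /= g01 h1.
  exists hp, (fun w => if inv w s then h (s * w) else hp w); split=> //.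
  - exact: (apt_fold hWS hM sS hA hpA hph hp1).
  - by move=> y yQ; apply: (hpG (y, g0 y)); right.
  - split=> // w i; last by rewrite i.
    by rewrite (inv_reflM hWS) ?i ?(genK hWS) //; exact: refl_gen.
have inW0 y : inW fset0 y -> y = 1 by case=> [[|k p]] //=; rewrite inE.
have third w : dl D1 (f w) = if inv w s then w else s * w by exact: apt_third.
have [fp [fm [fpA fmA fp1 [fpf fmf fmp]]]] : exists hp hm, [/\ apt hp, apt hm,
    (forall y, inW fset0 y -> hp y = D1) &
    [/\ forall w, inv w s -> hp w = f w, forall w, inv w s = false -> hm (s * w) = f w &
     forall w, inv w s = false -> hm w = hp w]].
  apply: (half f fset0 (fun=> D1)) => //.
    by move=> y y' /inW0-> /inW0->; rewrite (dlxx hM) mulVg.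
  by move=> w y i /inW0->; rewrite (dl_sym hM) third i mulg1.
have {}fp1 : fp 1 = D1 by apply: fp1; exact: inW1.
have [D' [E' [g [[gA g1] D'D1 [ha hb] hc hd]]]] := IH J' J'n J'S (or_intror thk4) fp fpA.
rewrite fp1 in D'D1.
have D'D1' := res_sym J'S D'D1.
have D1D' := D'D1.
have D'Z K y : (K `<=` S)%fset -> (J' `<=` K)%fset -> inW K y -> inW K (dl D' (fp y)).
  move=> KS J'K yK; apply: (res_trans (Y := D1)) => //; first exact: (inWS J'K D'D1').
  by rewrite -fp1 (apt_dl hWS hM) // invg1 mul1g.
(* Each chamber of [h] lies in [hp] or in [hm], and these agree on W_K since [s] is not in [K]. So
   its projection to the residue of type [K] can be computed inside one apartment. *)
have proj K h hp hm w : (K `<=` S)%fset -> (J' `<=` K)%fset -> s \notin K ->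
    apt hp -> apt hm -> (forall w, inv w s -> hp w = h w) ->
    (forall w, inv w s = false -> hm (s * w) = h w) ->
    (forall w, inv w s = false -> hm w = hp w) ->
    exists2 y : W, inW K y & lmin S K (dl (hp y) (h w)).
  move=> KS J'K sK hpA hmA hph hmh hmp; case i : (inv w s).
    have [y [v [e yK vm _]]] := lmin_decomp hWS w KS; exists y => //.
    by rewrite -hph // (apt_dl hWS hM) // e mulKg.
  have [y [v [e yK vm _]]] := lmin_decomp hWS (s * w) KS; exists y => //.
  have ys : inv y s = false by exact: inv_nos yK.
  by rewrite -hmh // -hmp // (apt_dl hWS hM) // e mulKg.
have projf w : exists2 y : W, inW J' y & lmin S J' (dl (fp y) (f w)).
  exact: (proj J' f fp fm).
have rJE r : r \in S -> r \notin J -> ((r |` J') `<=` S)%fset.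
  by move=> rS rJ; apply/fsubsetP => k /fset1UP[->//|]; exact: (fsubsetP J'S).
have halves h : apt h -> (forall w, inW J w -> h w = f w) ->
    exists hp hm, [/\ apt hp, apt hm, (forall y, inW J' y -> hp y = fp y) &
      [/\ forall w, inv w s -> hp w = h w, forall w, inv w s = false -> hm (s * w) = h w &
       forall w, inv w s = false -> hm w = hp w]].
  move=> hA hf; apply: half => //.
  - by apply: hf; exact: inW1.
  - by move=> y y' _ _; rewrite (apt_dl hWS hM).
  move=> w y i yJ'; have [y0 [v [e y0J vm _]]] := lmin_decomp hWS w JS.
  have y0i : inv y0 s by rewrite -(lmin_inv JS sJ y0J vm) -e.
  have hy0 : h y0 = fp y0 by rewrite fpf // hf.
  have h1 : dl (h y0) (h w) = v by rewrite (apt_dl hWS hM) // e mulKg.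
  have h2 : dl (fp y) (h y0) = y^-1 * y0 by rewrite hy0 (apt_dl hWS hM).
  have h3 : inW J (dl (fp y) (h y0)).
    by rewrite h2; apply: inWM => //; exact: (inWV hWS JS (inWS J'J yJ')).
  rewrite (dl_sym hM) (gate_add hWS hM JS (Z := h y0) _ h3) h1 // h2.
  by rewrite -gmulA -e ginvM invgK.
(* All relevant projections from [fp] to the panel of type [s] of [D'] equal [ep], and all those
   from [fm] equal [em]. The new neighbour must avoid [D'], [ep] and [em]: this is where the fourth
   chamber is spent. *)
have [ep epP] := hc fp s fpA (fun _ _ => erefl) sS nsJ'.
have [em emP] : exists X0, forall w X, inW (s |` J')%fset w -> isproj s D' X (fm w) -> X = X0.
  apply: (hc fm s) => // w wJ'; apply: fmp; exact: inv_nos wJ'.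
have [C' [D'C' C'p C'm]] := thk4 s D' ep em sS.
exists D', (fun k => if k == s then C' else E' k), g; split=> //.
- apply: (res_trans (Y := D1)) => //; last exact: (inWS J'J D1D').
  by rewrite fD1; exact: inW_gen.
- split.
    move=> w k wJ kJ; have [ks|ks] := eqVneq k s.
      rewrite ks => bad; have SsS : (S `\ s `<=` S)%fset by exact: fsubD1set.
      have h : inW (S `\ s)%fset (dl D1 (f w)).
        apply: (res_trans (Y := D')) => //; last exact: res_sym.
        by apply: (inWS (fsetSD _ _) D1D').
      have := inW_desc hWS SsS h sS; rewrite third !inE eqxx.
      case: ifP => [i|i]; first by rewrite i => /(_ isT).
      by rewrite (inv_reflM hWS) ?i; [move/(_ isT)|exact: refl_gen].
    have kJ' : k \in J' by rewrite !inE ks.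
    have SkS : (S `\ k `<=` S)%fset by exact: fsubD1set.
    have [y yJ' ym] := projf w => bad; apply: (ha y k) => //.
    apply: res_sym => //; have dz := D'Z _ _ J'S (fsubset_refl _) yJ'.
    apply: (inW_factor SkS (v := dl (fp y) (f w))); first exact: (lminM hWS J'S).
    by rewrite -(gate_add hWS hM J'S ym dz); exact: res_sym.
  move=> k kJ; case: ifP => [/eqP->|/negbT ks].
    split=> // w wJ pX; have [i|i] := boolP (inv w s).
      by apply: C'p; apply: (epP w); rewrite ?EJ // fpf.
    apply: C'm; apply: (emP (s * w)); rewrite ?fmf //; last exact/negbTE.
    by rewrite EJ; apply: inWM => //; exact: inW_gen.
  have kJ' : k \in J' by rewrite !inE ks.
  have [D'k hbk] := hb k kJ'; split=> // w wJ pX.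
  have [y yJ' ym] := projf w; apply: (hbk y) => //.
  by apply: (isproj_gate J'S kJ' _ ym) => //; apply: D'Z.
- move=> h r hA hf rS rJ; have [hp [hm [hpA hmA hpf [hph hmh hmp]]]] := halves h hA hf.
  have rs : r != s by apply: contraNneq rJ => ->.
  have rJ' : r \notin J' by apply: contra rJ; exact: (fsubsetP J'J).
  have [X0 X0P] := hc hp r hpA hpf rS rJ'; exists X0 => w X _ pX.
  have KS := rJE r rS rJ; pose K := (r |` J')%fset.
  have sK : s \notin K by rewrite !inE negb_or eq_sym rs eqxx.
  have J'K : (J' `<=` K)%fset by exact: fsubsetU1.
  have [y yK ym] := proj K h hp hm w KS J'K sK hpA hmA hph hmh hmp.
  apply: (X0P y) => //; apply: (isproj_gate KS _ _ ym) => //; first by rewrite !inE eqxx.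
  apply: (res_trans (Y := D1)) => //; first exact: (inWS J'K D'D1').
  rewrite -fp1 -(hpf 1); last exact: inW1.
  by rewrite (apt_dl hWS hM) // invg1 mul1g.
- move=> e K KS em0 eJ; apply: (res_trans (Y := fp e)) => //; last first.
    apply: hd => // [k kJ'|k kJ']; [apply: em0|apply: eJ]; exact: (fsubsetP J'J).
  (* [f] and [fp] agree at [s * e = e * k], which is beyond the wall of [s]; so [f e] and [fp e] lie
     in a common panel of type [k]. *)
  have [k kK se] := eJ s sJ; have kS := gen_sub KS kK.
  have i : inv (e * k) s.
    by rewrite -se (inv_reflM hWS) ?em0 //; exact: refl_gen.
  apply: (res_trans (Y := f (e * k))) => //; first by rewrite fA //; exact: inW_gen.
  rewrite -fpf //; apply: res_sym => //; rewrite fpA //; exact: inW_gen.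
Qed.
End Generic.

(** * Separating a convex set of residues *)

Section Residues.
Variables (W : groupType) (S : {fset W}) (Ch : Type) (dl : Ch -> Ch -> W).
Hypotheses (hWS : coxeter_system S) (hM : wmetric S dl).
Implicit Types (p q : seq W) (s t x r u v w j k a b c d e y z : W) (J K L : {fset W}).
Implicit Types (C D E X Y Z : Ch) (f g h : W -> Ch) (M : Ch -> {fset W} -> Prop).

Local Notation len := (len S).
Local Notation inv := (inverts S).
Local Notation apt := (apt S dl).

(* The simplex of cotype K of a chamber C is given by the pair (C, K) and
   contained in a chamber D if and only if dl C D lies in W_K. *)
Definition simplex_closed M := [/\ forall C K, M C K -> (K `<=` S)%fset,
  forall C D K, M C K -> inW K (dl C D) -> M D K &
  forall C K L, M C K -> (K `<=` L)%fset -> (L `<=` S)%fset -> M C L].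

(* The hypothesis on (Z, L) says that this simplex is contained in the projection
   to (C', K') of each chamber containing (C, K). *)
Definition projection_closed M := forall C K C' K' Z L,
  M C K -> M C' K' -> (L `<=` S)%fset ->
  (forall X Y, inW K (dl C X) -> inW K' (dl C' Y) -> lmin S K' (dl Y X) -> inW L (dl Z Y)) ->
  M Z L.

Definition aptM f C K := (K `<=` S)%fset /\ exists w, inW K (dl (f w) C).

(* All walls containing the simplex of cotype J of 1 contain that of cotype K of d. *)
Definition parallel J d K := [/\ lmin S J d, lmin S K d^-1 &
  forall j, j \in J -> exists2 k : W, k \in K & j * d = d * k].

Lemma aptM_closed f : simplex_closed (aptM f).
Proof.
split=> [C K []//|C D K [KS [w wC]] CD|C K L [KS [w wC]] KL LS].
  by split=> //; exists w; exact: (res_trans hWS hM wC CD).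
by split=> //; exists w; exact: inWS KL wC.
Qed.

Lemma aptM_projection f : apt f -> projection_closed (aptM f).
Proof.
move=> fA C K C' K' Z L [KS [w wC]] [K'S [w' wC']] LS h; split=> //.
have [y [v [e yK' vm _]]] := lmin_decomp hWS (w'^-1 * w) K'S.
have ew : w = w' * y * v by rewrite -gmulA -e mulVKg.
exists (w' * y); apply: (res_sym hWS hM LS).
apply: (h (f w) (f (w' * y))).
- exact: (res_sym hWS hM).
- apply: (res_trans hWS hM (Y := f w')) => //; first exact: (res_sym hWS hM).
  by rewrite (apt_dl hWS hM) // mulKg.
- by rewrite (apt_dl hWS hM) // ew mulKg.
Qed.

(** Each letter of [z] is a descent of [d * k] but not of [d], so [d] conjugates it into [K] by
    [double_descent]. A letter not conjugated into [K] cannot occur. *)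
Lemma projection_letters J K d z e k s : (J `<=` S)%fset -> (K `<=` S)%fset ->
  lmin S J d -> lmin S K d^-1 -> inW J z -> inW K k ->
  z * e = d * k -> len (z * e) = len z + len e ->
  (forall k1, k1 \in K -> s * d <> d * k1) -> inW (J `\ s)%fset z.
Proof.
move=> JS KS dm dm'; move En : (len z) => n; elim: n z k En => [|n IH] z k zn zJ kK ze ad no.
  by rewrite (len_eq0 hWS zn); exact: inW1.
have [s1 s1S [zs1 s1n]] := len_pos hWS zn.
have s1J : s1 \in J := inW_desc hWS JS zJ s1S zs1.
have ds1 : inv (d * k) s1.
  rewrite -ze; apply: (weak_le_inv hWS (u := z)) zs1; last exact: refl_gen.
  by rewrite /weak_le mulKg ad zn.
have [k1 k1K sd] := double_descent hWS KS dm' kK s1S (dm s1 s1J) ds1.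
have s1s : s1 \in (J `\ s)%fset.
  by rewrite !inE s1J andbT; apply/eqP => e1; case: (no k1 k1K); rewrite -e1.
rewrite -(genK hWS z s1S); apply: inWM; first exact: inW_gen.
apply: (IH _ (k1 * k)) => //.
- by apply: inWM => //; exact: inW_gen.
- by apply: inWM => //; exact: inW_gen.
- by rewrite -gmulA ze gmulA sd gmulA.
- have l1 := lenSl hWS (z * e) s1S.
  have i : inv (z * e) s1 by rewrite ze.
  rewrite i ad in l1; apply: succn_inj; rewrite -gmulA -l1 //.
Qed.

Lemma parallel_move J K d y : (K `<=` S)%fset ->
  (forall j, j \in J -> exists2 k : W, k \in K & j * d = d * k) ->
  inW J y -> exists2 k : W, inW K k & y * d = d * k.
Proof.
move=> KS h [p + <-]; elim: p => [|s p IH] /=.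
  by exists 1; [exact: inW1|rewrite mul1g mulg1].
case/andP => sJ /IH[k kK e]; have [k1 k1K e1] := h s sJ.
exists (k1 * k); first by apply: inWM => //; exact: inW_gen.
by rewrite -gmulA e gmulA e1 gmulA.
Qed.

(** [d] is the shortest element of the double coset W_J w W_K. If some [s] in [J] were not
    conjugated into [K], the projection of the simplex [(f w, K)] to [(f 1, J)] would be a larger
    simplex in [M], of cotype inside [J] without [s]. *)
Lemma projection_closed_parallel M f J w K : apt f -> simplex_closed M -> projection_closed M ->
  M (f 1) J -> (forall C K', M C K' -> inW J (dl (f 1) C) -> (K' `<=` J)%fset -> K' = J) ->
  M (f w) K -> exists d, parallel J d K /\ inW K (d^-1 * w).
Proof.
move=> fA [MS Mres _] Mproj MJ Mmax MK.
have JS := MS _ _ MJ; have KS := MS _ _ MK.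
have [y [v [ew yJ vm _]]] := lmin_decomp hWS w JS.
have [k' [d' [ev kK' dm' l]]] := lmin_decomp hWS v^-1 KS.
pose d := d'^-1; pose k := k'^-1.
have kK : inW K k by exact: (inWV hWS KS).
have {}dm' : lmin S K d^-1 by rewrite invgK.
have {}ev : v = d * k by rewrite -[v]invgK ev ginvM.
have dm : lmin S J d.
  apply: (weak_le_lmin hWS JS) vm; rewrite /weak_le ev mulKg.
  by rewrite (rminM hWS KS dm' kK).
have claim s : s \in J -> exists2 k1 : W, k1 \in K & s * d = d * k1.
  move=> sJ; apply: contrapT => no.
  have JsS : (J `\ s `<=` S)%fset by apply: fsubset_trans JS; exact: fsubD1set.
  have fy : inW J (dl (f 1) (f y)) by rewrite (apt_dl hWS hM) // invg1 mul1g.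
  have bad : M (f y) (J `\ s)%fset.
    apply: (Mproj _ _ _ _ _ _ MK MJ JsS) => X Y wX oneY YX.
    have ydX : inW K (dl (f (y * d)) X).
      apply: (res_trans hWS hM _ wX KS).
      have -> : w = y * d * k by rewrite ew ev gmulA.
      by rewrite (apt_dl hWS hM) // mulKg.
    have dfyd : dl (f y) (f (y * d)) = d by rewrite (apt_dl hWS hM) // mulKg.
    have yX : dl (f y) X = d * dl (f (y * d)) X.
      have := @dl_add _ _ _ _ hWS hM (f y) (f (y * d)) X.
      by rewrite dfyd; apply; exact: (rminM hWS KS).
    have yY : inW J (dl (f y) Y) by apply: (res_trans hWS hM _ oneY JS); exact: (res_sym hWS hM).
    have yX2 := gate_add hWS hM JS YX yY.
    apply: (projection_letters JS KS dm dm' yY ydX (e := dl Y X)).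
    - by rewrite -yX2 yX.
    - exact: (lminM hWS JS).
    - by move=> k1 k1K e; apply: no; exists k1.
  have e := Mmax _ _ bad fy (fsubD1set _ _).
  by move: sJ; rewrite -e !inE eqxx.
have [k1 k1K e1] := parallel_move KS claim yJ.
exists d; split; first by split.
have -> : w = d * (k1 * k) by rewrite ew ev gmulA e1 gmulA.
by rewrite mulKg; exact: inWM.
Qed.

Lemma parallel1 J : (J `<=` S)%fset -> parallel J 1 J.
Proof.
split=> [j _|j _|j jJ]; rewrite ?invg1 ?(inverts1 hWS) //.
by exists j; rewrite // mulg1 mul1g.
Qed.

Lemma parallel_conj c j k : j * c = c * k -> j ^ c = k.
Proof. by move=> e; rewrite gconjE e mulKg. Qed.

Section Separation.
Variables (f : W -> Ch) (M : Ch -> {fset W} -> Prop) (J : {fset W}).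
Hypotheses (fA : apt f) (Mclosed : simplex_closed M) (Mproj : projection_closed M).
Hypotheses (Msub : forall C K, M C K -> aptM f C K) (MJ : M (f 1) J).
Hypotheses (Jmin : forall C K, M C K -> #|` J| <= #|` K|).

Let MS C K : M C K -> (K `<=` S)%fset. Proof. by case: Mclosed => h _ _; apply: h. Qed.
Let Mres C D K : M C K -> inW K (dl C D) -> M D K.
Proof. by case: Mclosed => _ h _; apply: h. Qed.
Let Mface C K L : M C K -> (K `<=` L)%fset -> (L `<=` S)%fset -> M C L.
Proof. by case: Mclosed => _ _ h; apply: h. Qed.
Let JS : (J `<=` S)%fset := MS MJ.

(* The simplices of M parallel to the maximal simplex (f 1, J) and of the same
   dimension. *)
Definition full c K := [/\ K = [fset (j ^ c : W) | j in J]%fset, (K `<=` S)%fset & lmin S J c].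

(** By [projection_closed_parallel] these elements represent all simplices of [M]. Only shortest
    representatives are taken, which keeps the set finite in [separation]. *)
Definition core e := exists K, M (f e) K /\ parallel J e K.

(* Walls of f bounding M, at the chamber f c. *)
Definition edge c t := exists K, [/\ full c K, M (f c) K, t \in S, t \notin K &
  forall L d, M (f (c * d)) L -> parallel K d L -> inv d t = false].

Lemma full1 : full 1 J.
Proof.
split=> // [|j _]; last by rewrite (inverts1 hWS).
by apply/fsetP => k; apply/idP/imfsetP => [kJ|[j /= jJ ->]]; [exists k|]; rewrite /= ?conjg1.
Qed.

Lemma fullP c K k : full c K -> k \in K -> exists2 j : W, j \in J & k = j ^ c.
Proof. by case=> -> _ _ /imfsetP[j /= jJ ->]; exists j. Qed.

Lemma full_in c K j : full c K -> j \in J -> j ^ c \in K.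
Proof. by case=> -> _ _ jJ; apply/imfsetP; exists j. Qed.

Lemma full_card c K : full c K -> #|` K| = #|` J|.
Proof. by case=> -> _ _; rewrite card_imfset //; exact: conjg_inj. Qed.

Lemma full_parallel c K : full c K -> parallel J c K /\ parallel K c^-1 J.
Proof.
move=> cK; have [_ KS cm] := cK; do 2?split.
- exact: cm.
- by move=> k /(fullP cK)[j jJ ->]; rewrite (invertsV hWS) conjgK cm.
- by move=> j jJ; exists (j ^ c); [exact: full_in|exact: gconjC].
- by move=> k /(fullP cK)[j jJ ->]; rewrite (invertsV hWS) conjgK cm.
- by rewrite invgK.
- by move=> k /(fullP cK)[j jJ ->]; exists j; rewrite // gconjE -!gmulA mulgV mulg1.
Qed.

Lemma full_lmin c K d : full c K -> lmin S K d -> lmin S J (c * d).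
Proof.
move=> cK dm j jJ; have [_ _ cm] := cK.
by rewrite (invertsM hWS) cm //= dm //; exact: full_in.
Qed.

Lemma edge_core c t : edge c t -> core c.
Proof. by case=> K [cK MK _ _ _]; exists K; split=> //; case: (full_parallel cK). Qed.

(** An edge controls the representatives [d] that are shortest as seen from [c], whereas [e] is
    shortest as seen from 1. If the wall separated the two, it would contain the simplex, and [e]
    would not be shortest in its coset. *)
Lemma core_side c t e : edge c t -> core e -> inv (c^-1 * e) t = false.
Proof.
case=> K [cK MK tS tK tno] [L [ML [em em' eL]]]; have [[_ cm' _] [cVm _ cVJ]] := full_parallel cK.
have KS := MS MK; have LS := MS ML.
have cV : inv c^-1 t = false.
  by apply: (tno J); rewrite ?mulgV //; case: (full_parallel cK).
have gm : lmin S K (c^-1 * e).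
  move=> k kK; rewrite (invertsM hWS) cVm //=.
  by have [j jJ ->] := fullP cK kK; rewrite conjgK em.
have gK k : k \in K -> exists2 l : W, l \in L & k * (c^-1 * e) = c^-1 * e * l.
  move=> kK; have [j jJ ->] := fullP cK kK; have [l lL jl] := eL j jJ; exists l => //.
  by rewrite -[RHS]gmulA -jl gconjE -!gmulA mulVKg.
have [g gdef] : exists g : W, g = c^-1 * e by exists (c^-1 * e).
rewrite -gdef in gm gK *.
have [l' [d' [ev lL dm' l]]] := lmin_decomp hWS g^-1 LS.
pose d := d'^-1; pose l0 := l'^-1.
have l0L : inW L l0 by exact: (inWV hWS LS).
have {}dm' : lmin S L d^-1 by rewrite invgK.
have {}ev : g = d * l0 by rewrite -[g]invgK ev ginvM.
have dm : lmin S K d.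
  apply: (weak_le_lmin hWS KS) gm; rewrite /weak_le ev mulKg.
  by rewrite (rminM hWS LS dm' l0L).
have Kd k : k \in K -> exists2 l1 : W, l1 \in L & k * d = d * l1.
  move=> kK; have [l1 l1L e1] := gK k kK; have kS := gen_sub KS kK.
  apply: (double_descent hWS LS dm' (k := l0 * l1)) => //.
  - by apply: inWM => //; exact: inW_gen.
  - exact: dm.
  - rewrite gmulA -ev -e1 (inv_reflM hWS) ?gm //; exact: refl_gen.
have dt : inv d t = false.
  apply: (tno L) => //; apply: Mres ML _.
  have ee : e = c * d * l0 by rewrite -gmulA -ev gdef mulVKg.
  have -> : c * d = e * l0^-1 by rewrite ee mulgK.
  by rewrite (apt_dl hWS hM) // mulKg; exact: (inWV hWS LS).
apply/negP => gt; rewrite ev in gt.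
have [l1 l1L e1] := double_descent hWS LS dm' l0L tS dt gt.
have := gt; rewrite -ev gdef (invertsM hWS) cV /=.
have -> : inv e (t ^ c^-1) = inv e^-1 (t ^ g).
  by rewrite (invertsV hWS) gdef -conjgM mulgK.
rewrite (lmin_refl hWS LS em') //; first by apply: refl_conj; exact: refl_gen.
rewrite ev conjgM (parallel_conj e1) gconjE; apply: inWM; first exact: (inWV hWS LS).
by apply: inWM => //; exact: inW_gen.
Qed.

Lemma edge_side c t s : edge c t -> s \in J -> inv (c^-1 * s) t = false.
Proof.
move=> ct sJ; have c1 : core 1 by exists J; split=> //; exact: parallel1.
have := core_side ct c1; rewrite mulg1 (invertsM hWS) => -> /=.
case: ct => K [cK MK tS tK _]; rewrite (inv_gen hWS) ?(gen_sub JS sJ) //.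
apply: contraNF tK => /eqP e; rewrite -(conjgKV c t) e; exact: full_in.
Qed.

(* The face of (f c, K) obtained by dropping the vertex of type t and the
   projection of (f (c * d'), L') to it yield a simplex of M next to (f c, K)
   which by the uniqueness of opposites is passed on the way to (f (c * d), L). *)
Lemma neighbour c K d L d' L' t : full c K -> M (f c) K -> t \in S ->
  (L `<=` S)%fset -> parallel K d L -> inv d t ->
  M (f (c * d')) L' -> parallel K d' L' -> inv d' t ->
  exists y z K', [/\ d = y * z, full (c * y) K', M (f (c * y)) K', parallel K' z L &
    len z < len d].
Proof.
move=> cK MK tS LS [dm dm' dL] dt ML' [d'm d'm' d'L] d't.
have KS := MS MK; have L'S := MS ML'.
have tK : t \notin K by apply/negP => /dm; rewrite dt.
pose K0 := (t |` K)%fset; have K0S : (K0 `<=` S)%fset.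
  by apply/fsubsetP => k /fset1UP[->//|]; exact: (fsubsetP KS).
have tK0 : t \in K0 by exact: fset1U1.
have KK0 : (K `<=` K0)%fset by exact: fsubsetU1.
have split0 a N : (N `<=` S)%fset -> lmin S K a -> lmin S N a^-1 -> inv a t ->
    (forall j, j \in K -> exists2 k : W, k \in N & j * a = a * k) ->
    exists y z, [/\ a = y * z, inW K0 y, lmin S K0 z, len a = len y + len z &
     [/\ y <> 1, lmin S K y, lmin S N z^-1 &
     forall j, j \in K -> exists k, [/\ k \in N, j ^ y \in K0, j * y = y * j ^ y & j ^ y * z = z * k]]].
  move=> NS am am' at0 aN; have [y [z [e yK0 zm l]]] := lmin_decomp hWS a K0S.
  have wle : weak_le S y a by rewrite /weak_le e mulKg -e.
  have ym : lmin S K y := weak_le_lmin hWS KS wle am.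
  have zm' : lmin S N z^-1.
    apply: (weak_le_lmin hWS NS) am'; rewrite /weak_le invgK !(lenV hWS).
    have -> : z * a^-1 = y^-1 by rewrite e ginvM mulVKg.
    by rewrite !(lenV hWS) l addnC.
  exists y, z; split=> //; split=> // [y1|j jK].
    by move: at0; rewrite e (lmin_inv hWS K0S tK0 yK0 zm) y1 (inverts1 hWS).
  have [k kN jk] := aN j jK; have kS := gen_sub NS kN; have jS := gen_sub KS jK.
  have jyz : (j * y) * z = y * (z * k) by rewrite -gmulA -e jk e -gmulA.
  have jyK0 : inW K0 (j * y).
    by apply: inWM => //; apply: inW_gen; exact: (fsubsetP KK0).
  have [zkm|] := pselect (lmin S K0 (z * k)).
    have [jy _] := lmin_uniq hWS K0S zm zkm jyK0 yK0 jyz.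
    by case: (gen_neq1 hWS jS); apply: (@mulIg _ y); rewrite mul1g.
  move=> /existsNP[s /not_implyP[sK0 /eqP]]; rewrite eqbF_neg negbK => zks.
  have sS := gen_sub K0S sK0.
  have kmin : lmin S [fset k]%fset z^-1 by move=> k1 /fset1P->; exact: zm'.
  have kS' : ([fset k] `<=` S)%fset by rewrite fsub1set.
  have [k1 /fset1P-> sz] := double_descent hWS kS' kmin (inW_gen (fset11 k)) sS (zm s sK0) zks.
  have jys : j * y = y * s by apply: (@mulIg _ z); rewrite jyz -gmulA sz.
  have js : j ^ y = s := parallel_conj jys.
  by exists k; rewrite js.
have [y [z [dE yK0 zm ld [y1 ym zm' yK]]]] := split0 d L LS dm dm' dt dL.
have [y' [z' [d'E y'K0 z'm ld' [y'1 y'm z'm' y'K]]]] := split0 d' L' L'S d'm d'm' d't d'L.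
(* Both are opposites of the same simplex in the residue of type [K0], so each is below the other in
   the weak order. *)
have yy : y' = y.
  have le1 : weak_le S y' y.
    apply: (opposite_weak_le hWS (J := K) (t := t)) => // j jK.
    by have [k [_ h1 h2 _]] := yK j jK; exists (j ^ y); first exact: gen_sub h1.
  have le2 : weak_le S y y'.
    apply: (opposite_weak_le hWS (J := K) (t := t)) => // j jK.
    by have [k [_ h1 h2 _]] := y'K j jK; exists (j ^ y'); first exact: gen_sub h1.
  have l0 : len (y'^-1 * y) = 0.
    have e1 : len (y'^-1 * y) = len (y^-1 * y') by rewrite -(lenV hWS) ginvM invgK.
    by move: le1 le2; rewrite /weak_le -e1; len_lia.
  by rewrite -[y']mulg1 -(len_eq0 hWS l0) mulVKg.
subst y'; pose K' := [fset (j ^ (c * y) : W) | j in J]%fset.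
have inK' k : k \in K' -> exists2 j : W, j \in K & k = j ^ y.
  case/imfsetP => j /= jJ ->; exists (j ^ c); last exact: conjgM.
  exact: (full_in cK).
have memK' j : j \in K -> j ^ y \in K'.
  move=> /(fullP cK)[i iJ ->]; apply/imfsetP; exists i => //.
  by rewrite /= conjgM.
have K'K0 : (K' `<=` K0)%fset.
  by apply/fsubsetP => k /inK'[j jK ->]; have [_ [_ h _ _]] := yK j jK.
have K'S := fsubset_trans K'K0 K0S.
have fullK' : full (c * y) K'.
  by split=> //; exact: (full_lmin cK).
exists y, z, K'; split=> //.
- apply: (Mproj ML' (Mface MK KK0 K0S) K'S) => X Y ydX cY YX.
  have [s sK0 sK'] : exists2 s : W, s \in K0 & s \notin K'.
    apply: contrapT => no; have : (K0 `<=` K')%fset.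
      apply/fsubsetP => k kK0; apply: contrapT => /negP kK'; apply: no.
      by exists k.
    move=> /fsubset_leq_card; rewrite /K0 cardfsU1 tK add1n.
    by rewrite (full_card cK) (full_card fullK') ltnn.
  have K0s : (K0 `\ s `<=` K')%fset.
    have cK0 : #|` K0| = #|` K'|.+1.
      by rewrite /K0 cardfsU1 tK add1n (full_card cK) (full_card fullK').
    have sub : (K' `<=` K0 `\ s)%fset.
      apply/fsubsetP => k kK'; apply/fsetD1P; split; last exact: (fsubsetP K'K0).
      by apply: contraNneq sK' => <-.
    have -> // : (K0 `\ s = K')%fset.
    apply/esym/eqP; rewrite eqEfcard sub /= -ltnS -cK0.
    by rewrite (cardfsD1 s K0) sK0.
  apply: (inWS K0s).
  have zX : dl (f (c * y)) X = z' * dl (f (c * d')) X.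
    have e : dl (f (c * y)) (f (c * d')) = z'.
      by rewrite (apt_dl hWS hM) // d'E gmulA mulKg.
    have := @dl_add _ _ _ _ hWS hM (f (c * y)) (f (c * d')) X.
    by rewrite e; apply; exact: (rminM hWS L'S).
  have yY : inW K0 (dl (f (c * y)) Y).
    apply: (res_trans hWS hM _ cY K0S); rewrite (apt_dl hWS hM) // ginvM mulgVK.
    exact: (inWV hWS).
  have eYX := gate_add hWS hM K0S YX yY.
  apply: (projection_letters K0S L'S z'm z'm' yY ydX (e := dl Y X)).
  - by rewrite -eYX zX.
  - exact: (lminM hWS K0S).
  (* If [z'] conjugated [s] into [L'] as well, it would do so with all of [K0]; then [d' = y * z']
     would be [z' * k] with [k] nontrivial in W_L', and [d'] would not be shortest in its coset. *)
  move=> k1 k1L' sz.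
  have all0 j : j \in K0 -> exists2 k : W, k \in L' & j * z' = z' * k.
    move=> jK0; have [->|js] := eqVneq j s; first by exists k1.
    have [i iK ->] : exists2 i : W, i \in K & j = i ^ y.
      by apply: inK'; apply: (fsubsetP K0s); apply/fsetD1P.
    by have [k [kL' _ _ h]] := y'K i iK; exists k.
  have [k kL' yz] := parallel_move L'S all0 yK0.
  have lk : len k = len y.
    by have := rminM hWS L'S z'm' kL'; rewrite -yz -d'E ld' addnC => /addnI.
  have k1' : k^-1 <> 1.
    by move=> e; apply: y1; apply: (len_eq0 hWS); rewrite -lk -[k]invgK e invg1 (len1 hWS).
  have [j jL' kj] := inW_descent hWS L'S (inWV hWS L'S kL') k1'.
  have := d'm' j jL'; rewrite d'E yz ginvM.
  rewrite (lmin_inv hWS L'S jL' (inWV hWS L'S kL') z'm') kj //.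
- split=> //.
    by move=> k /(fsubsetP K'K0); exact: zm.
  by move=> k /inK'[j jK ->]; have [l [lL _ _ h]] := yK j jK; exists l.
- rewrite ld -[X in X < _]add0n ltn_add2r lt0n; apply/eqP => /(len_eq0 hWS); exact: y1.
Qed.

(** If the way to the simplex starts at an edge, both [h (c * d)] and [p (c * d)] are the projection
    of [h c = p c] to the residue of that simplex. Hence they coincide, and so do their projections
    back to the edge, against [nep]. If it does not start at an edge, [neighbour] supplies a start
    in [M] closer to the goal. *)
Lemma reach (p h : W -> Ch) : apt p -> apt h ->
  (forall e K, (K `<=` S)%fset -> lmin S J e ->
    (forall j, j \in J -> exists2 k : W, k \in K & j * e = e * k) -> inW K (dl (f e) (p e))) ->
  (forall e, core e -> h e = p e) -> (forall c t, edge c t -> h (c * t) <> p (c * t)) ->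
  forall n c K d L, len d < n -> full c K -> M (f c) K -> aptM h (f (c * d)) L ->
    parallel K d L -> M (f (c * d)) L.
Proof.
move=> pA hA pf hp nep; elim=> // n IH c K d L dn cK MK hL par.
have [LS [w hw]] := hL; have [dm dm' dL] := par.
have [d1|/eqP d1] := eqVneq d 1.
  rewrite d1 mulg1; apply: (Mface MK) => //; apply/fsubsetP => k kK.
  by have [l lL] := dL k kK; rewrite d1 mulg1 mul1g => ->.
have [t tS dt] := inW_descent hWS (fsubset_refl S) (inW_full hWS d) d1.
have tK : t \notin K by apply/negP => /dm; rewrite dt.
have [ct|nct] := pselect (edge c t).
  exfalso; apply: (nep _ _ ct).
  have cE : h c = p c by apply: hp; exact: edge_core ct.
  have jdK j : j \in J -> exists2 k : W, k \in L & j * (c * d) = c * d * k.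
    move=> jJ; have [k kL e] := dL _ (full_in cK jJ); exists k => //.
    by rewrite gmulA (gconjC j c) -gmulA e gmulA.
  have fpL : inW L (dl (f (c * d)) (p (c * d))).
    by apply: pf => //; exact: full_lmin cK dm.
  have [k' [v' [ev kL vm l]]] := lmin_decomp hWS (c^-1 * w)^-1 LS.
  have hv : inW L (dl (h (c * v'^-1)) (h w)).
    have -> : w = c * v'^-1 * k'^-1.
      by rewrite -gmulA -ginvM -ev invgK mulVKg.
    by rewrite (apt_dl hWS hM) // mulKg; exact: (inWV hWS).
  have eq1 : p (c * d) = h (c * v'^-1).
    apply: (gate_uniq hWS hM LS (C := h c)).
    - by rewrite cE (apt_dl hWS hM) // ginvM mulgVK.
    - by rewrite (apt_dl hWS hM) // ginvM mulgVK invgK.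
    - apply: (res_trans hWS hM _ _ LS (Y := f (c * d))); first exact: (res_sym hWS hM).
      by apply: (res_trans hWS hM _ _ LS (Y := h w)); exact: (res_sym hWS hM).
  have vd : v'^-1 = d.
    have := apt_dl hWS hM c (c * d) pA; rewrite eq1 -cE (apt_dl hWS hM) // !mulKg => //.
  rewrite vd in eq1.
  apply: (isproj_uniq hWS hM tS (D := h c) (C := h (c * d))).
    by apply: (apt_isproj hWS hM) => //; rewrite mulKg.
  by rewrite cE -eq1; apply: (apt_isproj hWS hM) => //; rewrite mulKg.
have [L' [d' [ML' par' d't]]] : exists L' d', [/\ M (f (c * d')) L', parallel K d' L' & inv d' t].
  apply: contrapT => no; apply: nct; exists K; split=> // L' d' ML' par'.
  by apply/negP => d't; apply: no; exists L', d'.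
have [y [z [K' [dE fK' MK' par2 lz]]]] := neighbour cK MK tS LS par dt ML' par' d't.
rewrite dE gmulA; apply: (IH _ K') => //; first exact: leq_trans lz dn.
by rewrite -gmulA -dE.
Qed.

(** Agreement on a finite set can suffice because the core and [S] are finite, so only finitely many
    edges have to be guarded. *)
Theorem separation : thick3 S dl -> J = fset0 \/ thick4 S dl ->
  finite_set [set e | exists K, M (f e) K /\ lmin S K e^-1] ->
  exists g F, [/\ apt g, finite_set F & forall h, apt h -> {in F, h =1 g} ->
    forall C K, M C K <-> aptM f C K /\ aptM h C K].
Proof.
move=> thk3 thk fin.
have [D' [E [p [[pA p1] D'J [ha hb] _ pf]]]] := generic_chamber hWS hM (erefl _) JS thk fA.
(* Besides the core, the chambers [E s] around [D'] are prescribed: they keep [h] from meeting [f]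
   in a simplex larger than the maximal one of [M]. *)
pose G := [set m : W * Ch | core m.1 /\ m.2 = p m.1] `|`
          [set m : W * Ch | m.1 \in J /\ m.2 = E m.1].
have core1 : core 1 by exists J; split=> //; exact: parallel1.
have pE s e : s \in J -> inv e s = false -> dl (E s) (p e) = s * e.
  move=> sJ es; have sS := gen_sub JS sJ; have [D'E _] := hb s sJ.
  have p1e : dl (p 1) (p e) = e by rewrite (apt_dl hWS hM) // invg1 mul1g.
  by rewrite (dl_up hM (s := s) (C := p 1)) ?p1e // p1.
have EE s s' : s \in J -> s' \in J -> dl (E s) (E s') = s^-1 * s'.
  move=> sJ s'J; have sS := gen_sub JS sJ; have s'S := gen_sub JS s'J.
  have [<-|ss'] := eqVneq s s'; first by rewrite (dlxx hM) mulVg.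
  have [D'E _] := hb s sJ; have [D'E' _] := hb s' s'J.
  rewrite (dl_up hM (s := s) (C := D')) ?D'E' ?(gen_inv hWS sS) //.
  by rewrite (inv_gen hWS) //; exact/negbTE.
have core_min e s : core e -> s \in J -> inv e s = false.
  by case=> K [_ [em _ _]]; exact: em.
have iG : iso dl G.
  move=> [x X] [y Y] [] /= [xc ->] [] /= [yc ->].
  - by rewrite (apt_dl hWS hM).
  - rewrite (dl_sym hM) pE //; last exact: core_min.
    by rewrite ginvM (gen_inv hWS (gen_sub JS yc)).
  - by rewrite pE ?(gen_inv hWS (gen_sub JS xc)) //; exact: core_min.
  - exact: EE.
have G1 : G (1, p 1) by left.
pose bd := [set m : W * W | edge m.1 m.2].
have bdP c t : bd (c, t) -> [/\ t \in S, G (c, p c) &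
    forall n, G n -> inv (c^-1 * n.1) t = false].
  rewrite /bd /= => ct; split; first by case: ct => K [].
    by left; split=> //; exact: edge_core ct.
  by move=> [x X] [] /= [xc _]; [exact: core_side ct xc|exact: edge_side ct xc].
have [g [gA gG gbd]] := iso_avoid hWS hM thk3 pA iG G1 bdP.
have fin_core : finite_set [set e | core e].
  by apply: sub_finite_set fin => e /= [K [MK [_ em _]]]; exists K.
pose F := [set e | core e] `|` [set` J] `|`
  [set c * t | c in [set e | core e] & t in [set` S]].
exists g, F; split=> //.
  rewrite !finite_setU; split; first by split; [exact: fin_core|exact: finite_fset].
  by apply: finite_image2; [exact: fin_core|exact: finite_fset].
move=> h hA hg.
have hcore e : core e -> h e = p e.
  move=> ec; rewrite hg; last by rewrite inE; left; left.
  by apply: (gG (e, p e)); left.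
have hE s : s \in J -> h s = E s.
  move=> sJ; rewrite hg; last by rewrite inE; left; right.
  by apply: (gG (s, E s)); right.
have hedge c t : edge c t -> h (c * t) <> p (c * t).
  move=> ct; rewrite hg; first exact: gbd.
  rewrite inE; right; exists c; first exact: edge_core ct.
  by exists t => //=; case: ct => K [].
have Mmax C K : M C K -> inW J (dl (f 1) C) -> (K `<=` J)%fset -> K = J.
  move=> MK _ KJ; apply/eqP; rewrite eqEfcard KJ; exact: Jmin MK.
have toh C K : M C K -> aptM h C K.
  move=> MK; have KS := MS MK; have [_ [w wC]] := Msub MK.
  have fwK : M (f w) K by apply: Mres MK _; exact: (res_sym hWS hM).
  have [d [par dw]] := projection_closed_parallel fA Mclosed Mproj MJ Mmax fwK.
  have dK : M (f d) K.
    by apply: Mres fwK _; apply: (res_sym hWS hM) => //; rewrite (apt_dl hWS hM).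
  have dc : core d by exists K.
  split=> //; exists d; rewrite hcore //.
  case: par => dm _ dJ; apply: (res_trans hWS hM (Y := f d)) => //.
    by apply: (res_sym hWS hM) => //; exact: pf.
  by apply: (res_trans hWS hM (Y := f w)) => //; rewrite (apt_dl hWS hM).
(* The intersection of the two apartments has the same closure properties as [M] and the same
   maximal simplex, so its simplices too are parallel to that one and come within the scope of
   [reach]. *)
pose N C K := aptM f C K /\ aptM h C K.
have Nclosed : simplex_closed N.
  have [f1 f2 f3] := aptM_closed f; have [h1 h2 h3] := aptM_closed h.
  split=> [C K [fK _]|C D K [fK hK] CD|C K L [fK hK] KL LS]; first exact: f1 fK.
    by split; [exact: f2 CD|exact: h2 CD].
  by split; [exact: f3 KL LS|exact: h3 KL LS].
have Nproj : projection_closed N.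
  move=> C K C' K' Z L [fK hK] [fK' hK'] LS hyp.
  by split; [apply: (aptM_projection fA fK fK')|apply: (aptM_projection hA hK hK')].
(* A larger common simplex yields a chamber [h v] of the link. If [v = 1], then [D'] shares a vertex
   with [f]; otherwise, for a descent [s] of [v], [E s = h s] is the projection of a chamber of [f].
   Genericity excludes both. *)
have Nmax C K : N C K -> inW J (dl (f 1) C) -> (K `<=` J)%fset -> K = J.
  move=> [[KS [w wC]] [_ [w' w'C]]] oneC KJ.
  have [k' [v' [ev kK vm l]]] := lmin_decomp hWS w'^-1 KS; pose v := v'^-1.
  have ew' : w' = v * k'^-1 by rewrite -[w']invgK ev ginvM.
  have vm' : lmin S K v^-1 by rewrite invgK.
  have hvC : inW K (dl (h v) C).
    apply: (res_trans hWS hM _ w'C KS).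
    by rewrite (apt_dl hWS hM) // ew' mulKg; exact: (inWV hWS).
  have h1 : h 1 = D' by rewrite hcore.
  have vJ : inW J v.
    have -> : v = dl D' (h v) by rewrite -h1 (apt_dl hWS hM) // invg1 mul1g.
    apply: (res_trans hWS hM (Y := f 1)) => //; first exact: (res_sym hWS hM).
    apply: (res_trans hWS hM oneC) => //; apply: (res_sym hWS hM) => //.
    exact: inWS KJ hvC.
  have hvw : inW K (dl (h v) (f w)).
    by apply: (res_trans hWS hM hvC) => //; exact: (res_sym hWS hM).
  have wJ : inW J w.
    have -> : w = dl (f 1) (f w) by rewrite (apt_dl hWS hM) // invg1 mul1g.
    apply: (res_trans hWS hM oneC) => //; apply: (res_sym hWS hM) => //.
    exact: inWS KJ wC.
  have D'v : dl D' (h v) = v by rewrite -h1 (apt_dl hWS hM) // invg1 mul1g.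
  have D'w : dl D' (f w) = v * dl (h v) (f w).
    by rewrite -{1}D'v; apply: (dl_add hWS hM); rewrite D'v (rminM hWS KS vm' hvw).
  have [v1|/eqP v1] := eqVneq v 1.
    apply/eqP; rewrite eqEfsubset KJ /=; apply/fsubsetP => s sJ.
    apply: contrapT => /negP sK; apply: (ha w s) => //.
    apply: (inWS (J := K)).
      apply/fsubsetP => k0 k0K; apply/fsetD1P; split; last exact: (fsubsetP KS).
      by apply: contraNneq sK => <-.
    rewrite -h1 -v1; exact: (res_sym hWS hM).
  exfalso; have [s sJ vs] := inW_descent hWS JS vJ v1; have sS := gen_sub JS sJ.
  have [D'E noproj] := hb s sJ; apply: (noproj w) => //; split=> //.
    rewrite D'w; apply: (weak_le_inv hWS (u := v)) vs; last exact: refl_gen.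
    by rewrite /weak_le mulKg (rminM hWS KS vm').
  have Ehv : dl (E s) (h v) = s * v by rewrite -hE // (apt_dl hWS hM) // (gen_inv hWS sS).
  rewrite D'w gmulA -Ehv; apply: (dl_add hWS hM).
  have l1 := lenSl hWS v sS; rewrite vs in l1.
  have l2 := rminM hWS KS vm' hvw; apply/eqP; rewrite eqn_leq (lenM hWS) Ehv.
  have := lenS_le hWS (v * dl (h v) (f w)) sS; rewrite l2 l1 addSn ltnS gmulA => -> //.
move=> C K; split=> [MK|NK]; first by split; [exact: Msub|exact: toh].
have [[KS [w wC]] hK] := NK.
have MN C' K' : M C' K' -> N C' K' by move=> MK; split; [exact: Msub|exact: toh].
have Nw : N (f w) K.
  have [_ res _] := Nclosed; apply: res NK _; exact: (res_sym hWS hM).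
have [d [par dw]] := projection_closed_parallel fA Nclosed Nproj (MN _ _ MJ) Nmax Nw.
have fdw : inW K (dl (f d) (f w)) by rewrite (apt_dl hWS hM).
have hd : aptM h (f (1 * d)) K.
  have [_ res _] := aptM_closed h; rewrite mul1g.
  by apply: res (proj2 Nw) _; exact: (res_sym hWS hM).
have := reach pA hA pf hcore hedge (ltnSn (len d)) full1 MJ hd par.
rewrite mul1g => Md; apply: (Mres Md); exact: (res_trans hWS hM fdw wC).
Qed.

End Separation.
End Residues.

(** * Charts and types *)

Section Charts.
Variables (W : groupType) (S : {fset W}) (V : choiceType).
Hypothesis hWS : coxeter_system S.
Implicit Types (s t w a b : W) (A B C D : {fset V}) (Sigma : set {fset V}) (vx : W -> W -> V).

Definition cell vx w : {fset V} := [fset vx w s | s in S]%fset.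

(* vx w s is the vertex of type s of the chamber cell vx w. *)
Definition chart Sigma vx :=
  (forall w w' s t, s \in S -> t \in S ->
     vx w s = vx w' t <-> s = t /\ inW (S `\ s)%fset (w^-1 * w')) /\
  Sigma = [set A | exists w, (A `<=` cell vx w)%fset].

Lemma cellP vx w v : reflect (exists2 s : W, s \in S & v = vx w s) (v \in cell vx w).
Proof. by apply: (iffP (imfsetP _ _ _ _)) => -[s sS e]; exists s. Qed.

Lemma in_cell vx w s : s \in S -> vx w s \in cell vx w.
Proof. by move=> sS; apply/cellP; exists s. Qed.

Lemma gensD1_sub s : (S `\ s `<=` S)%fset.
Proof. exact: fsubD1set. Qed.

Lemma coxeter_vertex_eq w w' s t : s \in S -> t \in S ->
  coxeter_vertex S w s = coxeter_vertex S w' t <-> s = t /\ inW (S `\ s)%fset (w^-1 * w').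
Proof.
move=> sS tS; have mem a r x : coxeter_vertex S a r x <-> inW (S `\ r)%fset (a^-1 * x).
  split=> [[y /= /(generated_inW hWS _ (gensD1_sub r)) yr <-]|h]; first by rewrite mulKg.
  by exists (a^-1 * x); [apply/(generated_inW hWS _ (gensD1_sub r))|rewrite mulVKg].
split=> [e|[<- h]].
  have h : inW (S `\ s)%fset (w^-1 * w').
    by apply/mem; rewrite e; apply/mem; rewrite mulVg; exact: inW1.
  split=> //; apply: contrapT => /eqP st.
  have ht : inW (S `\ s)%fset (w^-1 * (w' * s)).
    apply/mem; rewrite e; apply/mem; rewrite mulKg; apply: inW_gen.
    by rewrite !inE st.
  have hs : inW (S `\ s)%fset s.
    have e2 : (w^-1 * w')^-1 * (w^-1 * (w' * s)) = s by rewrite (gmulA w^-1) mulKg.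
    by rewrite -[X in inW _ X]e2; apply: inWM => //; exact: (inWV hWS (gensD1_sub s)).
  by have := gen_inW hWS (gensD1_sub s) sS hs; rewrite !inE eqxx.
apply/seteqP; split=> x /mem xs; apply/mem.
  have -> : w'^-1 * x = (w^-1 * w')^-1 * (w^-1 * x) by rewrite ginvM invgK -gmulA mulVKg.
  by apply: inWM => //; exact: (inWV hWS (gensD1_sub s)).
have -> : w^-1 * x = (w^-1 * w') * (w'^-1 * x) by rewrite -gmulA mulVKg.
exact: inWM.
Qed.

Lemma coxeter_cell w : coxeter_complex S [fset coxeter_vertex S w s | s in S]%fset.
Proof. by exists w, S; rewrite ?fsubset_refl. Qed.

Lemma chart_of_iso (v0 : V) Sigma : simplicial_complex Sigma ->
  isomorphic_to_coxeter S Sigma -> exists vx, chart Sigma vx.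
Proof.
move=> [_ Sdown] [f [finj fim]].
have ex w : exists h : W -> V, forall s, s \in S ->
    vertices Sigma (h s) /\ f (h s) = coxeter_vertex S w s.
  have := coxeter_cell w; rewrite -fim => -[A SA eA].
  have ex s : exists v, s \in S -> v \in A /\ f v = coxeter_vertex S w s.
    have [sS|nsS] := boolP (s \in S); last by exists v0.
    have : coxeter_vertex S w s \in (f @` A)%fset by rewrite eA in_imfset.
    by case/imfsetP => v vA ->; exists v.
  have [h hP] := choice ex; exists h => s /hP[hA ->]; split=> //.
  by apply: (Sdown A) => //; rewrite fsub1set.
have [vx vxP] := choice ex.
have fx w s : s \in S -> f (vx w s) = coxeter_vertex S w s by move=> /(vxP w)[].
have vv w s : s \in S -> vx w s \in vertices Sigma by move=> /(vxP w)[h _]; exact: mem_set.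
exists vx; split.
  move=> w w' s t sS tS; rewrite -(coxeter_vertex_eq w w' sS tS) -!fx //.
  by split=> [->//|]; apply: finj; exact: vv.
apply/seteqP; split=> A.
  move=> SA; have : coxeter_complex S (f @` A)%fset by rewrite -fim; exists A.
  case=> w [J JS eA]; exists w; apply/fsubsetP => v vA.
  have : f v \in (f @` A)%fset by rewrite in_imfset.
  rewrite eA => /imfsetP[s /= sJ fv]; have sS := fsubsetP JS s sJ.
  apply/cellP; exists s => //; apply: finj; rewrite ?vv // ?fx //.
  by apply: mem_set; apply: (Sdown A) => //; rewrite fsub1set.
move=> [w Aw]; have := coxeter_cell w; rewrite -fim => -[B SB eB].
apply: (Sdown B) => //; apply: (fsubset_trans Aw); apply/fsubsetP => _ /cellP[s sS ->].
have : f (vx w s) \in (f @` B)%fset by rewrite eB fx //; exact: in_imfset.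
case/imfsetP => v vB e; suff -> : vx w s = v by [].
apply: finj; rewrite ?vv //.
by apply: mem_set; apply: (Sdown B) => //; rewrite fsub1set.
Qed.

(** A vertex is sent to the set of all [w] whose chamber contains it, and this set is the required
    coset. *)
Lemma iso_of_chart Sigma vx : chart Sigma vx -> isomorphic_to_coxeter S Sigma.
Proof.
move=> [vxP SE]; pose f v : set W := [set w | exists2 s : W, s \in S & v = vx w s].
have fx w s : s \in S -> f (vx w s) = coxeter_vertex S w s.
  move=> sS; apply/seteqP; split=> x.
    case=> t tS /(vxP _ _ _ _ sS tS)[_ h]; exists (w^-1 * x); last by rewrite mulVKg.
    exact/(generated_inW hWS _ (gensD1_sub s)).
  case=> y /= /(generated_inW hWS _ (gensD1_sub s)) h <-; exists s => //.
  by apply/vxP => //; split=> //; rewrite mulKg.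
have vert v : vertices Sigma v -> exists w s, s \in S /\ v = vx w s.
  by rewrite /vertices SE => -[w]; rewrite fsub1set => /cellP[s sS ->]; exists w, s.
exists f; split.
  move=> u v /set_mem/vert[w [s [sS ->]]] /set_mem/vert[w' [t [tS ->]]].
  by rewrite !fx // => /(coxeter_vertex_eq _ _ sS tS)/(vxP _ _ _ _ sS tS).
apply/seteqP; split=> A.
  move=> [B + <-]; rewrite SE => -[w Bw].
  exists w, [fset s in S | vx w s \in B]%fset; first exact: fset_sub.
  apply/fsetP => x; apply/imfsetP/imfsetP => [[v /= vB ->]|[s /=]].
    have /cellP[s sS e] := fsubsetP Bw v vB.
    by exists s; rewrite ?e ?fx //= !inE sS -e.
  by rewrite !inE => /andP[sS vB] ->; exists (vx w s); rewrite ?fx.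
case=> w [J JS ->]; exists [fset vx w s | s in J]%fset.
  rewrite SE; exists w; apply/fsubsetP => _ /imfsetP[s /= sJ ->].
  by apply: in_cell; exact: (fsubsetP JS).
apply/fsetP => x; apply/imfsetP/imfsetP => [[_ /= /imfsetP[s /= sJ ->] ->]|[s /= sJ ->]].
  by exists s; rewrite // fx //; exact: (fsubsetP JS).
by exists (vx w s); rewrite ?in_imfset // fx //; exact: (fsubsetP JS).
Qed.

Lemma chart_complex Sigma vx : chart Sigma vx -> simplicial_complex Sigma.
Proof.
case=> _ ->; split; first by exists 1; exact: fsub0set.
by move=> A B BA [w Aw]; exists w; exact: fsubset_trans Aw.
Qed.

Lemma chart_cell Sigma vx w : chart Sigma vx -> Sigma (cell vx w).
Proof. by case=> _ ->; exists w; exact: fsubset_refl. Qed.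

Lemma card_cell Sigma vx w : chart Sigma vx -> #|` cell vx w| = #|` S|.
Proof.
case=> vxP _; rewrite card_in_imfset //= => s t sS tS /vxP; case=> //.
Qed.

Lemma chart_sub Sigma vx A : chart Sigma vx -> Sigma A -> exists w, (A `<=` cell vx w)%fset.
Proof. by case=> _ ->. Qed.

Lemma chart_mul Sigma vx a : chart Sigma vx -> chart Sigma (fun w => vx (a * w)).
Proof.
case=> vxP ->; split=> [w w' s t sS tS|].
  by rewrite vxP // ginvM -gmulA mulKg.
apply/seteqP; split=> A [w Aw]; last by exists (a * w).
by exists (a^-1 * w); rewrite /cell mulVKg.
Qed.

Lemma simplicial_iso_sub Sigma Sigma' (g : V -> V) A : simplicial_iso Sigma Sigma' g ->
  Sigma A -> Sigma' (g @` A)%fset.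
Proof. by case=> _ <- SA; exists A. Qed.

Lemma chart_iso Sigma Sigma' vx (g : V -> V) : simplicial_iso Sigma Sigma' g ->
  chart Sigma vx -> chart Sigma' (fun w s => g (vx w s)).
Proof.
move=> [ginj gim] cvx; have [vxP SE] := cvx.
have vv w s : s \in S -> vx w s \in vertices Sigma.
  by move=> sS; apply: mem_set; rewrite /vertices SE; exists w; rewrite fsub1set in_cell.
split=> [w w' s t sS tS|].
  by rewrite -vxP //; split=> [|->//]; apply: ginj; exact: vv.
have ecell w : cell (fun w s => g (vx w s)) w = (g @` cell vx w)%fset.
  apply/fsetP => v; apply/cellP/imfsetP => [[s sS ->]|[_ /cellP[s sS ->] ->]].
    by exists (vx w s); first exact: in_cell.
  by exists s.
rewrite -gim SE; apply/seteqP; split=> A.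
  move=> [B [w Bw] <-]; exists w; rewrite ecell; apply/fsubsetP => _ /imfsetP[v /= vB ->].
  by apply: in_imfset; exact: (fsubsetP Bw).
move=> [w]; rewrite ecell => Aw; exists [fset v in cell vx w | g v \in A]%fset.
  by exists w; exact: fset_sub.
apply/fsetP => u; apply/imfsetP/idP => [[v /=]|uA]; first by rewrite !inE => /andP[_ ?] ->.
have /imfsetP[v /= vw e] := fsubsetP Aw u uA.
by exists v; rewrite // !inE vw -e.
Qed.

Lemma chart_adj Sigma vx w s t : chart Sigma vx -> s \in S -> t \in S -> s != t ->
  vx (w * t) s = vx w s.
Proof.
move=> [vxP _] sS tS st; apply/vxP => //; split=> //.
by rewrite ginvM -gmulA mulVg mulg1 (gen_inv hWS) //; apply: inW_gen; rewrite !inE eq_sym st.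
Qed.

(* A labelling of the vertices that is injective on chambers is determined by
   its values on one chamber, as adjacent chambers differ in one vertex only. *)
Lemma labelling_rigid Sigma vx (lam : V -> W) (sig : W -> W) a : chart Sigma vx ->
  (forall w, {in cell vx w &, injective lam}) -> (forall w s, s \in S -> lam (vx w s) \in S) ->
  (forall s, s \in S -> lam (vx a s) = sig s) -> forall w s, s \in S -> lam (vx w s) = sig s.
Proof.
move=> cvx linj lS la w; have [vxP _] := cvx.
have vinj w1 s t : s \in S -> t \in S -> lam (vx w1 s) = lam (vx w1 t) -> s = t.
  move=> sS tS e; have [] // : s = t /\ inW (S `\ s)%fset (w1^-1 * w1).
  by apply/vxP => //; apply: linj e; exact: in_cell.
have sigS s : s \in S -> exists2 r : W, r \in S & sig r = s.
  pose T := [fset sig r | r in S]%fset.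
  have TS : (T `<=` S)%fset.
    by apply/fsubsetP => _ /imfsetP[r /= rS ->]; rewrite -la // lS.
  have TE : T = S.
    apply/eqP; rewrite eqEfcard TS /= card_in_imfset //= => r r' rS r'S e.
    by apply: (vinj a) => //; rewrite !la.
  by rewrite -{1}TE => /imfsetP[r /= rS ->]; exists r.
have [p pS <-] : exists2 p, word S p & a * wprod p = w.
  by have [p pS e] := inW_full hWS (a^-1 * w); exists p; rewrite // e mulVKg.
elim/last_ind: p pS => [_|p t IH]; first by rewrite mulg1.
rewrite -cats1 word_cat wprod_cat /= mulg1 gmulA => /andP[/IH{}IH /andP[tS _]] s sS.
have [->|st] := eqVneq s t; last by rewrite (chart_adj _ cvx) // IH.
have [r rS er] := sigS _ (lS (a * wprod p * t) t tS).
have [rt|/eqP rt] := eqVneq r t; first by rewrite -er rt.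
case: (rt).
apply: (vinj (a * wprod p * t)) => //.
by rewrite (chart_adj (a * wprod p) cvx rS tS (introN eqP rt)) IH.
Qed.

End Charts.

(** * Types of the vertices of a building *)

Section Typing.
Variables (W : groupType) (S : {fset W}) (V : choiceType) (v0 : V).
Variables (Delta : set {fset V}) (Aps : set (set {fset V})).
Hypotheses (hWS : coxeter_system S) (hT : tits_axioms S Delta Aps).
Implicit Types (s t w a b : W) (A B C D P X : {fset V}) (Sigma : set {fset V}) (vx : W -> W -> V).

Local Notation cell := (@cell W S V).
Local Notation chart := (@chart W S V).

Lemma aps_sub Sigma : Aps Sigma -> Sigma `<=` Delta.
Proof. by case: hT => h _ _ /h[[_]]. Qed.

Lemma aps_chart Sigma : Aps Sigma -> exists vx, chart Sigma vx.
Proof. by case: hT => h _ _ /h[[sc _] iso]; exact: (chart_of_iso hWS v0). Qed.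

Lemma aps_ex A B : Delta A -> Delta B -> exists Sigma, [/\ Aps Sigma, Sigma A & Sigma B].
Proof. by case: hT => _ h _; exact: h. Qed.

Lemma aps_iso Sigma Sigma' A B : Aps Sigma -> Aps Sigma' ->
  Sigma A -> Sigma B -> Sigma' A -> Sigma' B ->
  exists2 g : V -> V, simplicial_iso Sigma Sigma' g & {in A, g =1 id} /\ {in B, g =1 id}.
Proof. by case: hT => _ _ h; exact: h. Qed.

Lemma cell_chamber Sigma vx w : Sigma `<=` Delta -> chart Sigma vx -> chamber Delta (cell vx w).
Proof.
move=> SD cvx; split; first by apply: SD; exact: chart_cell.
move=> A DA cA; have [Sigma' [ap SA _]] := aps_ex DA DA.
have [vx' cvx'] := aps_chart ap; have [w' Aw'] := chart_sub cvx' SA.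
apply/esym/eqP; rewrite eqEfcard cA (card_cell w cvx) -(card_cell w' cvx').
exact: fsubset_leq_card.
Qed.

Lemma chamber_cell Sigma vx C : Sigma `<=` Delta -> chart Sigma vx ->
  chamber Delta C -> Sigma C -> exists w, C = cell vx w.
Proof.
move=> SD cvx [DC Cmax] /(chart_sub cvx)[w Cw]; exists w.
by apply/esym; apply: Cmax => //; apply: SD; exact: chart_cell.
Qed.

Lemma chamber_aps C D : chamber Delta C -> chamber Delta D ->
  exists Sigma vx a b, [/\ Aps Sigma, chart Sigma vx, C = cell vx a & D = cell vx b].
Proof.
move=> cC cD; have [Sigma [ap SC SD]] := aps_ex (proj1 cC) (proj1 cD).
have [vx cvx] := aps_chart ap.
have [a eC] := chamber_cell (aps_sub ap) cvx cC SC.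
have [b eD] := chamber_cell (aps_sub ap) cvx cD SD.
by exists Sigma, vx, a, b.
Qed.

Lemma card_chamber C : chamber Delta C -> #|` C| = #|` S|.
Proof.
by move=> cC; have [Sigma [vx [a [_ [_ cvx -> _]]]]] := chamber_aps cC cC; rewrite (card_cell a cvx).
Qed.

Lemma simplex_chamber A : Delta A -> exists2 C, chamber Delta C & (A `<=` C)%fset.
Proof.
move=> DA; have [Sigma [ap SA _]] := aps_ex DA DA; have [vx cvx] := aps_chart ap.
by have [w Aw] := chart_sub cvx SA; exists (cell vx w) => //; exact: cell_chamber (aps_sub ap) cvx.
Qed.

Definition typed (lam : V -> W) vx := forall w s, s \in S -> lam (vx w s) = s.

Definition typing (lam : V -> W) :=
  (forall C, chamber Delta C -> {in C &, injective lam} /\ [fset lam v | v in C]%fset = S) /\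
  forall Sigma, Aps Sigma -> exists2 vx, chart Sigma vx & typed lam vx.

Lemma cell_type_inj Sigma vx w s t : chart Sigma vx -> s \in S -> t \in S ->
  vx w s = vx w t -> s = t.
Proof. by move=> [vxP _] sS tS /(vxP _ _ _ _ sS tS)[]. Qed.

(** The types read off from [vx'] label the vertices injectively on chambers and agree with those of
    [vx] on one chamber, so [labelling_rigid] applies. *)
Lemma chart_types Sigma vx vx' a b : Sigma `<=` Delta -> chart Sigma vx -> chart Sigma vx' ->
  (forall s, s \in S -> vx a s = vx' b s) ->
  forall w w' s t, s \in S -> t \in S -> vx w s = vx' w' t -> s = t.
Proof.
move=> SD cvx cvx' e; pose ty v := xget 1 [set s | s \in S /\ exists w, v = vx' w s].
have tyE w s : s \in S -> ty (vx' w s) = s.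
  move=> sS; have [_ h] : [set r | r \in S /\ exists w1, vx' w s = vx' w1 r] (ty (vx' w s)).
    by apply: (@xgetPex _ 1); exists s; split=> //; exists w.
  have tS : ty (vx' w s) \in S.
    by have [] : [set r | r \in S /\ exists w1, vx' w s = vx' w1 r] (ty (vx' w s));
      [apply: (@xgetPex _ 1); exists s; split=> //; exists w|].
  by have [w1 /(proj1 cvx' _ _ _ _ sS tS)[]] := h.
have cells w : exists w', cell vx w = cell vx' w'.
  by apply: (chamber_cell SD cvx'); [exact: cell_chamber SD cvx|exact: chart_cell].
have rig := @labelling_rigid _ _ _ hWS Sigma vx ty id a cvx.
move=> w w' s t sS tS est; rewrite -(tyE w' t tS) -est.
apply/esym; apply: rig => //.
- move=> w1; have [w2 ->] := cells w1 => _ _ /cellP[r rS ->] /cellP[r' r'S ->].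
  by rewrite !tyE // => ->.
- move=> w1 r rS; have [w2 ew] := cells w1.
  have := in_cell vx w1 rS; rewrite ew => /cellP[r' r'S ->].
  by rewrite tyE.
- by move=> r rS; rewrite e // tyE.
Qed.

Lemma typing_chart lam Sigma vx a : typing lam -> Sigma `<=` Delta -> chart Sigma vx ->
  (forall s, s \in S -> lam (vx a s) = s) -> typed lam vx.
Proof.
move=> [lch _] SD cvx la; apply: (@labelling_rigid _ _ _ hWS Sigma vx lam id a) => //.
- by move=> w; have [] := lch _ (cell_chamber w SD cvx).
- move=> w s sS; have [_ <-] := lch _ (cell_chamber w SD cvx).
  by apply: in_imfset; exact: in_cell.
Qed.

(** The types of one apartment through [C0] are carried to the others by isomorphisms fixing [C0].
    Two transports give the same type to [v], because an isomorphism fixing both [C0] and [v]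
    compares them. *)
Lemma typing_ex C0 : chamber Delta C0 -> exists lam, typing lam.
Proof.
move=> cC0; have [Sigma0 [vx [a [_ [ap0 cvx eC0 _]]]]] := chamber_aps cC0 cC0.
pose vx0 w := vx (a * w).
have cvx0 : chart Sigma0 vx0 := chart_mul a cvx.
have eC : C0 = cell vx0 1 by rewrite eC0 /vx0 /cell mulg1.
have S0C : Sigma0 C0 by rewrite eC; exact: chart_cell.
pose P v s := exists Sigma g w, [/\ Aps Sigma, simplicial_iso Sigma0 Sigma g,
  {in C0, g =1 id}, s \in S & v = g (vx0 w s)].
have Puniq v s t : P v s -> P v t -> s = t.
  move=> [Sigma [g [w [ap gi gC sS ev]]]] [Sigma' [g' [w' [ap' gi' gC' tS ev']]]].
  have fixC (g1 : V -> V) : {in C0, g1 =1 id} -> (g1 @` C0)%fset = C0.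
    move=> h; apply/fsetP => u; apply/imfsetP/idP => [[x /= xC ->]|uC]; first by rewrite h.
    by exists u; rewrite ?h.
  have SC : Sigma C0 by rewrite -(fixC g gC); exact: simplicial_iso_sub gi S0C.
  have S'C : Sigma' C0 by rewrite -(fixC g' gC'); exact: simplicial_iso_sub gi' S0C.
  have c1 := chart_iso gi cvx0; have c2 := chart_iso gi' cvx0.
  have vS : Sigma [fset v]%fset.
    by rewrite (proj2 c1); exists w; rewrite fsub1set; apply/cellP; exists s.
  have vS' : Sigma' [fset v]%fset.
    by rewrite (proj2 c2); exists w'; rewrite fsub1set; apply/cellP; exists t.
  have [h hi [hC hv]] := aps_iso ap ap' SC vS S'C vS'.
  have c3 := chart_iso hi c1.
  apply: (chart_types (a := 1) (b := 1) (aps_sub ap') c3 c2 _ (w := w) (w' := w') sS tS).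
    move=> r rS; have rC : vx0 1 r \in C0 by rewrite eC; exact: in_cell.
    by rewrite gC // hC // gC'.
  by rewrite -ev -ev' hv // inE.
pose lam v := xget 1 [set s | P v s].
have lamP v s : P v s -> lam v = s.
  move=> Pvs; apply: (Puniq v) => //.
  by have : [set r | P v r] (lam v) by apply: (@xgetPex _ 1); exists s.
have typed0 Sigma : Aps Sigma -> Sigma C0 ->
    exists vx1, chart Sigma vx1 /\ typed lam vx1.
  move=> ap SC; have [g gi [gC _]] := aps_iso ap0 ap S0C S0C SC SC.
  exists (fun w s => g (vx0 w s)); split; first exact: chart_iso gi cvx0.
  by move=> w s sS; apply: lamP; exists Sigma, g, w.
have lch C : chamber Delta C -> {in C &, injective lam} /\ [fset lam v | v in C]%fset = S.
  move=> cC; have [Sigma [ap SC0 SC]] := aps_ex (proj1 cC0) (proj1 cC).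
  have [vx1 [c1 t1]] := typed0 Sigma ap SC0.
  have [w ->] := chamber_cell (aps_sub ap) c1 cC SC; split.
    by move=> _ _ /cellP[s sS ->] /cellP[t tS ->]; rewrite !t1 // => ->.
  apply/fsetP => r; apply/imfsetP/idP => [[_ /= /cellP[s sS ->] ->]|rS]; first by rewrite t1.
  by exists (vx1 w r); rewrite ?t1 //; exact: in_cell.
exists lam; split=> // Sigma ap.
(* An apartment that may miss [C0] receives its chart from an apartment containing [C0] and one of
   its chambers. *)
have [vx1 c1] := aps_chart ap; have cD := cell_chamber 1 (aps_sub ap) c1.
have SD : Sigma (cell vx1 1) := chart_cell 1 c1.
have [Sigma1 [ap1 S1C S1D]] := aps_ex (proj1 cC0) (proj1 cD).
have [vx2 [c2 t2]] := typed0 Sigma1 ap1 S1C.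
have [g gi [gD _]] := aps_iso ap1 ap S1D S1D SD SD.
have [b eb] := chamber_cell (aps_sub ap1) c2 cD S1D.
exists (fun w s => g (vx2 w s)); first exact: chart_iso gi c2.
apply: (@labelling_rigid _ _ _ hWS Sigma _ lam id b (chart_iso gi c2)).
- move=> w; have cw := cell_chamber w (aps_sub ap) (chart_iso gi c2).
  by have [] := lch _ cw.
- move=> w s sS; have cw := cell_chamber w (aps_sub ap) (chart_iso gi c2).
  by have [_ <-] := lch _ cw; apply: in_imfset; apply/cellP; exists s.
- by move=> s sS; rewrite gD ?t2 // eb; exact: in_cell.
Qed.

End Typing.

(** * The Weyl distance of a building *)

Section WeakMetric.
Variables (W : groupType) (S : {fset W}) (Ch : Type) (dl : Ch -> Ch -> W).
Hypothesis hWS : coxeter_system S.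

(** The descent condition is automatic: without it, [s * dl C D] would be the product of a subword
    of a reduced word of [dl C D] although it is longer. *)
Lemma wmetric_of_weak : (forall C D, dl C D = 1 <-> C = D) ->
  (forall C D, dl D C = (dl C D)^-1) ->
  (forall (s : W) C C' D, s \in S -> dl C C' = s -> dl C' D = s * dl C D \/ dl C' D = dl C D) ->
  (forall (s : W) C D, s \in S -> exists C', dl C C' = s /\ dl C' D = s * dl C D) ->
  wmetric S dl.
Proof.
move=> deq dsym dstep dex; split=> // s C C' D sS CC'.
have stepr (t : W) X Y Y' : t \in S -> dl Y Y' = t -> dl X Y' = dl X Y * t \/ dl X Y' = dl X Y.
  move=> tS e; rewrite !(dsym _ X); case: (dstep t _ _ X tS e) => ->; [left|by right].
  by rewrite ginvM (gen_inv hWS tS).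
have subs p X Y D' : word S p -> dl X D' = wprod p ->
    exists2 q, subseq q p & dl Y D' = dl Y X * wprod q.
  elim: p X => [|t p IH] X /=; first by move=> _ /deq->; exists [::]; rewrite //= mulg1.
  case/andP => tS pS XD; have [X' [XX' X'D]] := dex t X D' tS.
  have [|q qp YD] := IH X' pS; first by rewrite X'D XD (genK hWS).
  case: (stepr t Y X X' tS XX') => e; rewrite YD e.
    by exists (t :: q); rewrite /= ?eqxx // gmulA.
  by exists q => //; apply: subseq_trans qp (subseq_cons _ _).
case: (dstep s C C' D sS CC') => e; [by left|right; split=> //].
apply: contrapT => /negP /negbTE ni.
have [pS pE _] := rwordP hWS (dl C D).
have [q qp e2] := subs _ C C' D pS (esym pE).
have sC : dl C' C = s by rewrite dsym CC' (gen_inv hWS sS).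
rewrite e sC in e2.
have e3 : s * dl C D = wprod q by rewrite e2 (genK hWS).
have := lenSl hWS (dl C D) sS; rewrite ni e3.
have qS : word S q by apply/allP => t /(mem_subseq qp)/(allP pS).
have := len_wprod hWS qS; have := size_subseq qp; rewrite -/(len S (dl C D)).
by move=> h1 h2 h3; move: (leq_trans h2 h1); rewrite h3 ltnn.
Qed.

End WeakMetric.

Section BuildingMetric.
Variables (W : groupType) (S : {fset W}) (V : choiceType) (v0 : V).
Variables (Delta : set {fset V}) (Aps : set (set {fset V})) (lam : V -> W).
Hypotheses (hWS : coxeter_system S) (hT : tits_axioms S Delta Aps) (hL : typing S Delta Aps lam).
Implicit Types (s t w a b : W) (A B C D P X : {fset V}) (Sigma : set {fset V}) (vx : W -> W -> V).

Local Notation cell := (@cell W S V).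
Local Notation chart := (@chart W S V).
Local Notation typed := (@typed W S V lam).

Definition typed_chart Sigma vx := [/\ Aps Sigma, chart Sigma vx & typed vx].

Definition weyl C D := xget 1 [set w | exists Sigma vx a b,
  typed_chart Sigma vx /\ [/\ C = cell vx a, D = cell vx b & w = a^-1 * b]].

Lemma typed_chart_ex A B : Delta A -> Delta B -> exists Sigma vx, [/\ typed_chart Sigma vx, Sigma A & Sigma B].
Proof.
move=> DA DB; have [Sigma [ap SA SB]] := aps_ex hT DA DB.
by have [vx cvx t] := (proj2 hL) _ ap; exists Sigma, vx.
Qed.

Lemma typed_chart_sub Sigma vx : typed_chart Sigma vx -> Sigma `<=` Delta.
Proof. by case=> ap _ _; exact: aps_sub hT _ ap. Qed.

Lemma typed_chart_chamber Sigma vx w : typed_chart Sigma vx -> chamber Delta (cell vx w).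
Proof. by move=> G; have [_ c _] := G; exact: (cell_chamber v0 hWS hT w (typed_chart_sub G) c). Qed.

Lemma typed_chart_cell Sigma vx C : typed_chart Sigma vx -> chamber Delta C -> Sigma C -> exists w, C = cell vx w.
Proof. by move=> G; have [_ c _] := G; exact: (chamber_cell (typed_chart_sub G) c). Qed.

Lemma typed_chart_chambers C D : chamber Delta C -> chamber Delta D -> exists Sigma vx a b,
  [/\ typed_chart Sigma vx, C = cell vx a & D = cell vx b].
Proof.
move=> cC cD; have [Sigma [vx [G SC SD]]] := typed_chart_ex (proj1 cC) (proj1 cD).
have [a ea] := typed_chart_cell G cC SC; have [b eb] := typed_chart_cell G cD SD.
by exists Sigma, vx, a, b.
Qed.

Lemma typed_eq vx vx' w w' s : typed vx -> typed vx' -> cell vx w = cell vx' w' -> s \in S ->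
  vx w s = vx' w' s.
Proof.
move=> t t' e sS; have := in_cell vx w sS; rewrite e => /cellP[r rS e'].
by have := t w s sS; rewrite e' t' // => <-.
Qed.

Lemma chart_inj Sigma vx a b : chart Sigma vx -> (forall s, s \in S -> vx a s = vx b s) -> a = b.
Proof.
move=> [vxP _] e; apply: (mulgI a^-1); rewrite mulVg; symmetry.
have h : inW fset0 (a^-1 * b).
  have := @inW_all _ S hWS S (a^-1 * b); rewrite fsetDv; apply => s sS.
  by have [] := (vxP a b s s sS sS).1 (e s sS).
by case: h => -[|//] _ <-.
Qed.

Lemma chart_neighbour Sigma vx a b t : chart Sigma vx -> t \in S ->
  (forall s, s \in S -> s != t -> vx a s = vx b s) -> b = a \/ b = a * t.
Proof.
move=> [vxP _] tS e.
have h : inW [fset t]%fset (a^-1 * b).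
  have := @inW_all _ S hWS (S `\ t)%fset (a^-1 * b).
  have -> : (S `\` (S `\ t) = [fset t])%fset.
    by apply/fsetP => x; rewrite !inE; case: eqVneq => [->|_]; rewrite ?tS //=; case: (x \in S).
  apply => s; rewrite !inE => /andP[st sS].
  by have [] := (vxP a b s s sS sS).1 (e s sS st).
have -> : b = a * (a^-1 * b) by rewrite mulVKg.
suff [->|->] : a^-1 * b = 1 \/ a^-1 * b = t by [left; rewrite mulg1|right].
case: h => p pJ <-; elim: p pJ => [_|r p IH /= /andP[/fset1P-> pJ]]; first by left.
by case: (IH pJ) => ->; rewrite ?mulg1 ?(gen_sq hWS tS); [right|left].
Qed.

(** The same word, read in either chart from the common chamber, runs through the same chambers,
    since an apartment has only one neighbour of a given type. *)
Lemma two_charts Sigma vx vx' a b a' b' : Sigma `<=` Delta -> chart Sigma vx -> chart Sigma vx' ->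
  typed vx -> typed vx' -> cell vx a = cell vx' a' -> cell vx b = cell vx' b' ->
  a^-1 * b = a'^-1 * b'.
Proof.
move=> SD c c' t t' ea eb.
have cells w : exists w', cell vx w = cell vx' w'.
  by apply: (chamber_cell SD c'); [exact: (cell_chamber v0 hWS hT w SD c)|exact: chart_cell].
have move_ p : word S p -> cell vx (a * wprod p) = cell vx' (a' * wprod p).
  elim/last_ind: p => [_|p r IH]; first by rewrite !mulg1.
  rewrite -cats1 word_cat wprod_cat /= mulg1 !gmulA => /andP[/IH{}IH /andP[rS _]].
  have [x ex] := cells (a * wprod p * r); rewrite ex; congr cell.
  have vxx s : s \in S -> vx (a * wprod p * r) s = vx' x s by exact: (typed_eq t t' ex).
  have vyy s : s \in S -> vx (a * wprod p) s = vx' (a' * wprod p) s by exact: (typed_eq t t' IH).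
  case: (@chart_neighbour Sigma vx' (a' * wprod p) x r c' rS) => // [s sS sr|e].
    by rewrite -vxx // -vyy // (chart_adj hWS (a * wprod p) c).
  have : a * wprod p = a * wprod p * r.
    by apply: (chart_inj c) => s sS; rewrite vxx // vyy // e.
  rewrite -[X in X = _]mulg1 => /mulgI e1; case: (gen_neq1 hWS rS (esym e1)).
have [p pS pE] := inW_full hWS (a^-1 * b).
have := move_ p pS; rewrite pE mulVKg eb => e.
have -> : b' = a' * (a^-1 * b).
  by apply: (chart_inj c') => s sS; exact: (typed_eq t' t' e sS).
by rewrite mulKg.
Qed.

Lemma typed_chart_iso Sigma Sigma' vx (g : V -> V) C : typed_chart Sigma vx -> Aps Sigma' ->
  simplicial_iso Sigma Sigma' g -> chamber Delta C -> Sigma C -> {in C, g =1 id} ->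
  typed_chart Sigma' (fun w s => g (vx w s)).
Proof.
move=> G ap' gi cC SC gC; have [ap c t] := G; split=> //; first exact: chart_iso gi c.
have [a ea] := typed_chart_cell G cC SC.
apply: (typing_chart v0 hWS hT hL (aps_sub hT ap') (chart_iso gi c) (a := a)) => s sS.
by rewrite gC ?ea ?in_cell // t.
Qed.

Lemma fixed_cell vx (g : V -> V) w : {in cell vx w, g =1 id} ->
  cell (fun w s => g (vx w s)) w = cell vx w.
Proof.
move=> h; apply/fsetP => v; apply/cellP/cellP => -[s sS ->]; exists s; rewrite ?h //; exact: in_cell.
Qed.

Lemma weylE Sigma vx a b : typed_chart Sigma vx -> weyl (cell vx a) (cell vx b) = a^-1 * b.
Proof.
move=> G; rewrite /weyl; set Q := (X in xget _ X).
have : Q (xget 1 Q) by apply: (@xgetPex _ 1); exists (a^-1 * b), Sigma, vx, a, b.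
move: (xget 1 Q) => w [Sigma' [vx' [a' [b' [G' [ea eb ->]]]]]].
have [ap c t] := G; have [ap' c' t'] := G'.
have SC := chart_cell a c; have SD := chart_cell b c.
have S'C := chart_cell a' c'; have S'D := chart_cell b' c'.
rewrite -ea in S'C; rewrite -eb in S'D.
have [g gi [gC gD]] := aps_iso hT ap ap' SC SD S'C S'D.
have [_ c2 t2] := typed_chart_iso G ap' gi (typed_chart_chamber a G) SC gC.
symmetry; apply: (two_charts (aps_sub hT ap') c2 c' t2 t'); rewrite ?fixed_cell //.
Qed.

Definition vtx C s := xget v0 [set v | v \in C /\ lam v = s].

Lemma vtx_cell vx w s : typed vx -> s \in S -> vtx (cell vx w) s = vx w s.
Proof.
move=> t sS; have : [set v | v \in cell vx w /\ lam v = s] (vtx (cell vx w) s).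
  by apply: (@xgetPex _ v0); exists (vx w s); split; rewrite ?in_cell ?t.
by case=> /cellP[r rS ->]; rewrite t // => ->.
Qed.

Lemma weyl_vtx C D s : chamber Delta C -> chamber Delta D -> s \in S ->
  vtx C s = vtx D s <-> inW (S `\ s)%fset (weyl C D).
Proof.
move=> cC cD sS; have [Sigma [vx [a [b [G -> ->]]]]] := typed_chart_chambers cC cD.
have [_ c t] := G; rewrite (weylE _ _ G) !vtx_cell //.
by rewrite (proj1 c a b s s sS sS); split=> [[]|].
Qed.

Lemma weyl_eq C D : chamber Delta C -> chamber Delta D -> weyl C D = 1 <-> C = D.
Proof.
move=> cC cD; split=> [|<-].
  have [Sigma [vx [a [b [G -> ->]]]]] := typed_chart_chambers cC cD; rewrite (weylE _ _ G) => e.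
  by congr cell; apply: (mulgI a^-1); rewrite e mulVg.
have [Sigma [vx [a [_ [G -> _]]]]] := typed_chart_chambers cC cC; rewrite (weylE _ _ G).
by rewrite mulVg.
Qed.

Lemma weyl_sym C D : chamber Delta C -> chamber Delta D -> weyl D C = (weyl C D)^-1.
Proof.
move=> cC cD; have [Sigma [vx [a [b [G -> ->]]]]] := typed_chart_chambers cC cD.
by rewrite !(weylE _ _ G) ginvM invgK.
Qed.

Lemma weyl_adj C C' s t : chamber Delta C -> chamber Delta C' -> t \in S -> weyl C C' = t ->
  s \in S -> s != t -> vtx C s = vtx C' s.
Proof.
move=> cC cC' tS e sS st; apply/weyl_vtx => //; rewrite e; apply: inW_gen.
by rewrite !inE eq_sym st.
Qed.

(** The isomorphism of apartments is taken to fix [D] and the common panel of [C] and [C']. The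
    image of [C] contains this panel, so in the second apartment it is [C'] or its neighbour of type
    [s]. *)
Lemma weyl_step s C C' D : chamber Delta C -> chamber Delta C' -> chamber Delta D -> s \in S ->
  weyl C C' = s -> weyl C' D = s * weyl C D \/ weyl C' D = weyl C D.
Proof.
move=> cC cC' cD sS CC'.
have [Sigma [vx [a [b [G eC eD]]]]] := typed_chart_chambers cC cD.
have [Sigma' [vx' [a' [b' [G' eC' eD']]]]] := typed_chart_chambers cC' cD.
have [ap c t] := G; have [ap' c' t'] := G'.
pose P : {fset V} := [fset vx a r | r in (S `\ s)%fset]%fset.
have PC : (P `<=` cell vx a)%fset.
  by apply/fsubsetP => _ /imfsetP[r /= /fsetD1P[_ rS] ->]; exact: in_cell.
have PC' : (P `<=` cell vx' a')%fset.
  apply/fsubsetP => _ /imfsetP[r /= /fsetD1P[rs rS] ->].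
  by rewrite -(vtx_cell a t rS) -eC (weyl_adj cC cC' sS CC' rS rs) eC' vtx_cell // in_cell.
have SP : Sigma P by rewrite (proj2 c); exists a.
have S'P : Sigma' P by rewrite (proj2 c'); exists a'.
have SD : Sigma D by rewrite eD; exact: chart_cell.
have S'D : Sigma' D by rewrite eD'; exact: chart_cell.
have [g gi [gP gD]] := aps_iso hT ap ap' SP SD S'P S'D.
have G2 := typed_chart_iso G ap' gi cD SD gD; have [_ c2 t2] := G2.
have cX : chamber Delta (cell (fun w r => g (vx w r)) a) by exact: typed_chart_chamber G2.
have [x ex] := typed_chart_cell G' cX (chart_cell a c2).
have e2 : a^-1 * b = x^-1 * b'.
  apply: (two_charts (aps_sub hT ap') c2 c' t2 t' ex).
  by rewrite fixed_cell -?eD // -?eD'.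
have h : a' = x \/ a' = x * s.
  apply: (chart_neighbour c' sS) => r rS rs; rewrite -(typed_eq t2 t' ex rS).
  have vP : vx a r \in P by apply: in_imfset; rewrite !inE rs.
  rewrite gP //; have := fsubsetP PC' _ vP => /cellP[r' r'S e].
  by have := t a r rS; rewrite e t' // => <-.
have -> : weyl C D = x^-1 * b' by rewrite eC eD (weylE _ _ G).
have -> : weyl C' D = a'^-1 * b' by rewrite eC' eD' (weylE _ _ G').
by case: h => ->; [right|left; rewrite ginvM (gen_inv hWS sS) gmulA].
Qed.

Definition chambers := {C : {fset V} | `[< chamber Delta C >]}.
Definition dl (X Y : chambers) := weyl (val X) (val Y).

Lemma chamberP (X : chambers) : chamber Delta (val X).
Proof. by case: X => C /= /asboolP. Qed.

Definition Chamber C (cC : chamber Delta C) : chambers := exist _ C (introT (asboolP _) cC).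

Lemma dl_wmetric : wmetric S dl.
Proof.
apply: (wmetric_of_weak hWS).
- move=> C D; rewrite /dl weyl_eq; [|exact: chamberP|exact: chamberP].
  by split=> [/val_inj//|->].
- by move=> C D; apply: weyl_sym; exact: chamberP.
- by move=> s C C' D sS; apply: weyl_step => //; exact: chamberP.
- move=> s C D sS; have [Sigma [vx [a [b [G eC eD]]]]] := typed_chart_chambers (chamberP C) (chamberP D).
  exists (Chamber (typed_chart_chamber (a * s) G)).
  rewrite /dl eC eD /= !(weylE _ _ G) mulKg ginvM (gen_inv hWS sS) gmulA.
  by [].
Qed.

End BuildingMetric.

(** The exponent is written as a successor so that [iter N f] is the inverse of [f] on [A]. *)
Lemma iter_permutation (T : choiceType) (A : {fset T}) (f : T -> T) :
  (forall x, x \in A -> f x \in A) -> {in A &, injective f} ->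
  exists N : nat, forall x, x \in A -> iter N.+1 f x = x.
Proof.
move=> fA finj; pose h (x : A) : A := [` fA _ (valP x)]%fset.
have hinj : injective h.
  by move=> x y /(congr1 val) /= e; apply: val_inj; apply: finj e; exact: valP.
have hE n (x : A) : val (iter n h x) = iter n f (val x) by elim: n => //= n ->.
pose N := (\prod_(x : A) fingraph.order h x)%N.
have N0 : 0 < N by apply: prodn_gt0 => x; exact: fingraph.order_gt0.
exists N.-1 => x xA; rewrite prednK // -[x]/(val ([` xA]%fset)) -hE; congr val.
have : fingraph.order h [` xA]%fset %| N by rewrite /N (bigD1 [` xA]%fset) //= dvdn_mulr.
case/dvdnP => k ->; elim: k => //= k IH.
by rewrite mulSn iterD IH iter_order.
Qed.

(** * Apartments as isometries *)

Section Diagram.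
Variables (W : groupType) (S : {fset W}) (Ch : Type) (dl : Ch -> Ch -> W).
Hypotheses (hWS : coxeter_system S) (hM : wmetric S dl).
Implicit Types (s t w a b : W).

Section Twisted.
Variables (f : W -> Ch) (sig : W -> W).
Hypotheses (sigS : forall s, s \in S -> sig s \in S) (siginj : {in S &, injective sig}).
Hypothesis fP : forall w s, s \in S -> dl (f w) (f (w * s)) = sig s.

Lemma twisted_word (p : seq W) a : word S p -> len S (wprod (map sig p)) = size p ->
  dl (f a) (f (a * wprod p)) = wprod (map sig p).
Proof.
elim: p a => [|s p IH] a /=; first by rewrite mulg1 (dlxx hM).
case/andP => sS pS; rewrite gmulA => lp.
have mS : word S (map sig p) by apply/allP => _ /mapP[t /(allP pS)/sigS ? ->].
have l1 := len_wprod hWS mS; rewrite size_map in l1.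
have l2 := lenM hWS (sig s) (wprod (map sig p)); rewrite lp (len_gen hWS (sigS sS)) in l2.
have l3 : len S (wprod (map sig p)) = size p by apply/eqP; rewrite eqn_leq l1.
have e1 := IH (a * s) pS l3.
have := @dl_add _ S _ dl hWS hM (f a) (f (a * s)) (f (a * s * wprod p)).
by rewrite fP // e1; apply; rewrite lp l3 (len_gen hWS (sigS sS)).
Qed.

(** If no smaller power were trivial, both alternating words of length [m.+1] in [sig s] and [sig t]
    would be reduced and give the distances from [f 1] to the ends. The braid relation of [s] and
    [t] makes the two ends equal, hence the two products. *)
Lemma twisted_order s t m : s \in S -> t \in S -> (s * t) ^+ m.+1 = 1 ->
  exists2 k : nat, k <= m & (sig s * sig t) ^+ k.+1 = 1.
Proof.
move=> sS tS stm; apply: contrapT => no.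
have no2 k : 0 < k < m.+1 -> (sig s * sig t) ^+ k <> 1.
  by case: k => // k /andP[_ km] e; case: no; exists k => //; exact: (@ltnW k m km).
have no3 k : 0 < k < m.+1 -> (sig t * sig s) ^+ k <> 1.
  move=> km e; apply: (no2 k km).
  have -> : sig s * sig t = (sig t * sig s) ^ (sig t).
    by rewrite gconjE !gmulA mulVg mul1g.
  by rewrite -conjXg e conj1g.
have e : wprod (altw m.+1 s t) = wprod (altw m.+1 t s).
  apply: (mulIg (wprod (altw m.+1 t s))^-1).
  by rewrite mulgV (altw_div hWS m.+1 sS tS) stm.
have mapE (n : nat) r r' : map sig (altw n r r') = altw n (sig r) (sig r').
  by elim: n r r' => //= n IH r r'; rewrite IH.
have szE (n : nat) r r' : size (altw n r r') = n by elim: n r r' => //= n IH r r'; rewrite IH.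
have g r r' : r \in S -> r' \in S -> (forall k, 0 < k < m.+1 -> (sig r * sig r') ^+ k <> 1) ->
    dl (f 1) (f (wprod (altw m.+1 r r'))) = wprod (altw m.+1 (sig r) (sig r')).
  move=> rS r'S nor; rewrite -mapE -[wprod (altw m.+1 r r')]mul1g.
  apply: twisted_word; first exact: word_altw.
  by rewrite mapE szE (len_altw hWS) // sigS.
have := g s t sS tS no2; rewrite e (g t s tS sS no3) => e2.
have := altw_div hWS m.+1 (sigS sS) (sigS tS); rewrite -e2 mulgV => e3.
by apply: no; exists m.
Qed.

(** Orders of products cannot increase under [sig], hence are constant along its cycles. So the
    inverse [iter N sig] respects the relations and extends to an endomorphism [g], which cancels
    the permutation of types. *)
Lemma twisted_apt : exists (g : W -> W), (forall w, exists w', g w' = w) /\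
  apt S dl (fun w => f (g w)).
Proof.
have [N NP] := iter_permutation sigS siginj.
have iS n s : s \in S -> iter n sig s \in S by move=> sS; elim: n => //= n /sigS.
have ord n s t m : s \in S -> t \in S -> (s * t) ^+ m.+1 = 1 ->
    exists2 k : nat, k <= m & (iter n sig s * iter n sig t) ^+ k.+1 = 1.
  move=> sS tS h; elim: n => [|n [k km e]]; first by exists m.
  have [k' k'k e'] := twisted_order (iS n s sS) (iS n t tS) e.
  by exists k' => //; exact: leq_trans km.
have [_ _ univ] := hWS.
have [s t n sS tS|g gP] := univ W (iter N sig).
  case: n => // n e.
  have ex : exists k, (s * t) ^+ k.+1 == 1 by exists n; apply/eqP.
  have [m /eqP em mmin] := ex_minnP ex.
  have [k km ek] := ord N s t m sS tS em.
  have [k' k'k ek'] := twisted_order (iS N s sS) (iS N t tS) ek.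
  have mk' : m <= k' by apply: mmin; move: ek'; rewrite -!iterS !NP // => ->.
  have ekm : k = m by apply/eqP; rewrite eqn_leq km (leq_trans mk').
  rewrite ekm in ek; rewrite (divn_eq n.+1 m.+1).
  have r0 : (n.+1 %% m.+1 = 0)%N.
    case E: (n.+1 %% m.+1)%N => [//|r].
    have : (s * t) ^+ r.+1 == 1.
      move: e; rewrite (divn_eq n.+1 m.+1) E expgnDr mulnC expgnA em expg1n mul1g => ->.
      by [].
    move/mmin; have := ltn_pmod n.+1 (ltn0Sn m); rewrite E => h1 h2; move: h1 h2; len_lia.
  by rewrite r0 addn0 mulnC expgnA ek expg1n.
exists g; split.
  move=> w; have [p pS <-] := inW_full hWS w; elim: p pS => [_|s p IH /= /andP[sS pS]].
    by exists 1; apply: (mulgI (g 1)); rewrite -gmulfM !mulg1.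
  have [w' <-] := IH pS; exists (sig s * w').
  by rewrite gmulfM gP ?sigS // -iterSr NP.
move=> w s sS; have -> : g (w * s) = g w * iter N sig s by rewrite -(gP s sS); exact: gmulfM.
by rewrite fP ?iS // -iterS NP.
Qed.

End Twisted.
End Diagram.

Section Apartments.
Variables (W : groupType) (S : {fset W}) (V : choiceType) (v0 : V).
Variables (Delta : set {fset V}) (Aps : set (set {fset V})) (lam : V -> W).
Hypotheses (hWS : coxeter_system S) (hT : tits_axioms S Delta Aps) (hL : typing S Delta Aps lam).
Hypothesis hsc : simplicial_complex Delta.
Implicit Types (s t w a b : W) (A B C D P : {fset V}) (Sigma : set {fset V}) (vx : W -> W -> V).

Local Notation cell := (@cell W S V).
Local Notation chart := (@chart W S V).
Local Notation Ch := (chambers Delta).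
Local Notation dl := (@dl W S V Delta Aps lam).
Local Notation vtx := (@vtx W V v0 lam).
Implicit Types (X Y Z : Ch) (f g h : W -> Ch).

Let hM : wmetric S dl := dl_wmetric v0 hWS hT hL.

Lemma vtxP C s : chamber Delta C -> s \in S -> vtx C s \in C /\ lam (vtx C s) = s.
Proof.
move=> cC sS; have [Sigma [vx [a [_ [G -> _]]]]] := typed_chart_chambers hT hL cC cC.
by have [_ _ t] := G; rewrite (vtx_cell v0 a t sS) in_cell // t.
Qed.

Lemma cell_vtx C : chamber Delta C -> C = cell (fun=> vtx C) 1.
Proof.
move=> cC; have [Sigma [vx [a [_ [G e _]]]]] := typed_chart_chambers hT hL cC cC.
have [_ _ t] := G; rewrite {1}e; apply/fsetP => v; apply/cellP/cellP => -[s sS ->]; exists s => //.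
  by rewrite e vtx_cell.
by rewrite e vtx_cell.
Qed.

Lemma vtx_lam C v : chamber Delta C -> v \in C -> lam v \in S /\ vtx C (lam v) = v.
Proof.
move=> cC; rewrite {1}(cell_vtx cC) => /cellP[s sS ->].
by have [_ ->] := vtxP cC sS.
Qed.

Lemma vtx_dl X Y s : s \in S -> vtx (val X) s = vtx (val Y) s <-> inW (S `\ s)%fset (dl X Y).
Proof. by apply: (weyl_vtx v0 hWS hT hL); exact: chamberP. Qed.

Definition apset f : set {fset V} := [set A | exists w, (A `<=` val (f w))%fset].

Lemma apt_chart f : apt S dl f -> chart (apset f) (fun w s => vtx (val (f w)) s).
Proof.
move=> fA; split.
  move=> w w' s t sS tS; split=> [e|[<-]].
    have est : s = t.
      have [_ <-] := vtxP (chamberP (f w)) sS.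
      by rewrite e; have [_ ->] := vtxP (chamberP (f w')) tS.
    by split=> //; rewrite -(apt_dl hWS hM w w' fA); apply/(vtx_dl _ _ sS); rewrite e est.
  by rewrite -(apt_dl hWS hM w w' fA) => /(vtx_dl _ _ sS).
apply/seteqP; split=> A [w Aw]; exists w; move: Aw; rewrite {1}(cell_vtx (chamberP (f w))) //.
Qed.

Lemma apt_apartment f : apt S dl f -> complete_apartment_system S Delta (apset f).
Proof.
move=> fA; have c := apt_chart fA; split; last exact: iso_of_chart hWS _ _ c.
split; first exact: chart_complex c.
move=> A [w Aw]; have [_ h] := hsc; apply: (h _ _ Aw).
by have [] := chamberP (f w).
Qed.

Lemma dl_adj X Y t : t \in S -> (forall s, s \in S -> s != t -> vtx (val X) s = vtx (val Y) s) ->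
  dl X Y = 1 \/ dl X Y = t.
Proof.
move=> tS e; rewrite /dl.
have [Sigma [vx [a [b [G eX eY]]]]] := typed_chart_chambers hT hL (chamberP X) (chamberP Y).
have [_ c ty] := G; rewrite eX eY (weylE v0 hWS hT hL _ _ G).
case: (@chart_neighbour _ S V hWS Sigma vx a b t c tS) => [s sS st|->|->].
- by have := e s sS st; rewrite eX eY !vtx_cell.
- by left; rewrite mulVg.
- by right; rewrite mulKg.
Qed.

(** The given isomorphism with the Coxeter complex need not respect [lam]; by rigidity it permutes
    the types by one [sig], which [twisted_apt] removes. *)
Lemma apartment_apt Sigma : complete_apartment_system S Delta Sigma ->
  exists2 f, apt S dl f & Sigma = apset f.
Proof.
move=> [[sc SD] iso]; have [vx c] := chart_of_iso hWS v0 sc iso.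
have cc w := cell_chamber v0 hWS hT w SD c.
pose sig s := lam (vx 1 s).
have lS w s : s \in S -> lam (vx w s) \in S.
  by move=> sS; have [] := vtx_lam (cc w) (in_cell vx w sS).
have linj w : {in cell vx w &, injective lam}.
  move=> u v uC vC e; have [_ <-] := vtx_lam (cc w) uC.
  by have [_ <-] := vtx_lam (cc w) vC; rewrite e.
have ls := labelling_rigid hWS c linj lS (sig := sig) (a := 1) (fun s _ => erefl).
have sigS s : s \in S -> sig s \in S by exact: lS.
have siginj : {in S &, injective sig}.
  move=> s t sS tS /(linj 1 _ _ (in_cell vx 1 sS) (in_cell vx 1 tS)).
  exact: cell_type_inj c sS tS.
have vE w s : s \in S -> vtx (cell vx w) (sig s) = vx w s.
  by move=> sS; rewrite -(ls w) //; have [] := vtx_lam (cc w) (in_cell vx w sS).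
have sigonto t : t \in S -> exists2 s : W, s \in S & sig s = t.
  move=> tS; have [vC vt] := vtxP (cc 1) tS.
  by move: vC vt => /cellP[s sS ->] <-; exists s.
pose f0 w : Ch := Chamber (cc w).
have f0P w s : s \in S -> dl (f0 w) (f0 (w * s)) = sig s.
  move=> sS; case: (@dl_adj (f0 w) (f0 (w * s)) (sig s) (sigS s sS)) => //.
    move=> t tS ts; have [r rS er] := sigonto t tS; rewrite -er /= !vE //.
    rewrite (chart_adj hWS w c rS sS) //.
    by apply: contra_neq ts => rs; rewrite -er rs.
  move/(dl_eq1 hM) => /(congr1 val) /= e.
  have ews : w = w * s by apply: (chart_inj hWS c) => t tS; rewrite -!vE // e.
  by case: (gen_neq1 hWS sS); apply: (mulgI w); rewrite mulg1 -ews.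
have [g [gonto gA]] := twisted_apt hWS hM sigS siginj f0P.
exists (fun w => f0 (g w)) => //; rewrite (proj2 c); apply/seteqP; split=> A [w Aw].
  by have [w' e] := gonto w; exists w'; rewrite /= e.
by exists (g w).
Qed.

End Apartments.

(** * Galleries and convexity *)

Section Faces.
Variables (W : groupType) (S : {fset W}) (V : choiceType) (v0 : V).
Variables (Delta : set {fset V}) (Aps : set (set {fset V})) (lam : V -> W).
Hypotheses (hWS : coxeter_system S) (hT : tits_axioms S Delta Aps) (hL : typing S Delta Aps lam).
Hypothesis hsc : simplicial_complex Delta.
Implicit Types (s t w a b : W) (A B C D P : {fset V}) (K J : {fset W}).

Local Notation Ch := (chambers Delta).
Local Notation dl := (@dl W S V Delta Aps lam).
Local Notation vtx := (@vtx W V v0 lam).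
Local Notation len := (len S).
Implicit Types (X Y Z E : Ch) (f g h : W -> Ch) (L : set {fset V}) (kappa : set Ch).

Let hM : wmetric S dl := dl_wmetric v0 hWS hT hL.

Definition face X K : {fset V} := [fset v in val X | lam v \notin K]%fset.
Definition cotype A : {fset W} := (S `\` [fset lam v | v in A])%fset.

Lemma face_sub X K : (face X K `<=` val X)%fset.
Proof. exact: fset_sub. Qed.

Lemma cotype_sub A : (cotype A `<=` S)%fset.
Proof. exact: fsubsetDl. Qed.

Lemma lam_inj X : {in val X &, injective lam}.
Proof. by have [] := (proj1 hL) _ (chamberP X). Qed.

Lemma face_cotype X A : (A `<=` val X)%fset -> face X (cotype A) = A.
Proof.
move=> AX; apply/fsetP => v; rewrite !inE /=; apply/andP/idP => [[vX]|vA].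
  rewrite negb_and negbK => /orP[|/negP[]].
    by case/imfsetP => u /= uA /(lam_inj vX (fsubsetP AX u uA)) ->.
  by have [] := vtx_lam v0 hT hL (chamberP X) vX.
split; first exact: (fsubsetP AX).
by rewrite negb_and negbK in_imfset.
Qed.

Lemma cotype_face X K : (K `<=` S)%fset -> cotype (face X K) = K.
Proof.
move=> KS; apply/fsetP => s; rewrite !inE; apply/andP/idP => [[+ sS]|sK].
  apply: contraNT => nK; have [vX vs] := vtxP v0 hT hL (chamberP X) sS.
  by apply/imfsetP; exists (vtx (val X) s); rewrite //= !inE vX vs.
split; last exact: (fsubsetP KS).
by apply/negP => /imfsetP[v /=]; rewrite !inE => /andP[_ /negP nK] e; apply: nK; rewrite -e.
Qed.

Lemma face_in X Y A : (A `<=` val X)%fset -> (A `<=` val Y)%fset <-> inW (cotype A) (dl X Y).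
Proof.
move=> AX; split=> [AY|].
  apply: inW_all => // s /imfsetP[v /= vA es].
  have [lX eX] := vtx_lam v0 hT hL (chamberP X) (fsubsetP AX v vA).
  have [_ eY] := vtx_lam v0 hT hL (chamberP Y) (fsubsetP AY v vA).
  by rewrite es; apply/(vtx_dl v0 hWS hT hL) => //; rewrite eX eY.
move=> h; apply/fsubsetP => v vA.
have [lX eX] := vtx_lam v0 hT hL (chamberP X) (fsubsetP AX v vA).
have : inW (S `\ lam v)%fset (dl X Y).
  apply: inWS h; apply/fsubsetP => s; rewrite !inE => /andP[nA sS]; rewrite sS andbT.
  by apply: contraNneq nA => ->; exact: in_imfset.
move/(vtx_dl v0 hWS hT hL _ _ lX); rewrite eX => ->.
by have [] := vtxP v0 hT hL (chamberP Y) lX.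
Qed.

Lemma face_eq X Y K : (K `<=` S)%fset -> inW K (dl X Y) -> face X K = face Y K.
Proof.
move=> KS h; have fX := face_sub X K.
have fY : (face X K `<=` val Y)%fset by apply/(face_in _ fX); rewrite cotype_face.
by rewrite -{1}(face_cotype fY) cotype_face.
Qed.

Lemma face_face X K K' : (K `<=` K')%fset -> (face X K' `<=` face X K)%fset.
Proof.
move=> /fsubsetP KK'; apply/fsubsetP => v; rewrite !inE /= => /andP[-> nK] /=.
by apply: contra nK; exact: KK'.
Qed.

Lemma simplex_ch A : Delta A -> exists X, (A `<=` val X)%fset.
Proof. by case/(simplex_chamber v0 hWS hT) => C cC AsC; exists (Chamber cC). Qed.

Definition simplices L X K := (K `<=` S)%fset /\ L (face X K).

Lemma simplicesP L X A : (A `<=` val X)%fset -> simplices L X (cotype A) <-> L A.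
Proof.
by move=> AX; rewrite /simplices face_cotype //; split=> [[]|] //; split=> //; exact: cotype_sub.
Qed.

Lemma simplices_closed L : simplicial_complex L -> simplex_closed S dl (simplices L).
Proof.
move=> [_ Ld]; split=> [C K []//|C D K [KS LC] CD|C K K' [KS LC] KK' K'S]; split=> //.
  by rewrite -(face_eq KS CD).
by apply: Ld LC; exact: face_face.
Qed.

Lemma simplices_apset f X K : simplices (apset f) X K <-> aptM S dl f X K.
Proof.
rewrite /simplices /aptM; split=> -[KS [w fw]]; split=> //; exists w.
  by apply: (res_sym hWS hM KS); move/(face_in _ (face_sub X K)): fw; rewrite cotype_face.
by apply/(face_in _ (face_sub X K)); rewrite cotype_face //; exact: (res_sym hWS hM KS).
Qed.

Lemma face_inj X Y K K' : (K `<=` S)%fset -> (K' `<=` S)%fset -> face X K = face Y K' ->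
  K = K' /\ inW K (dl X Y).
Proof.
move=> KS K'S e; have eK : K = K' by rewrite -(cotype_face X KS) e cotype_face.
split=> //; have : (face X K `<=` val Y)%fset by rewrite e face_sub.
by move/(face_in _ (face_sub X K)); rewrite cotype_face.
Qed.

Lemma card_ch C : chamber Delta C -> #|` C| = #|` S|.
Proof. exact: (card_chamber v0 hWS hT). Qed.

Lemma panel_face X s : s \in S -> panel Delta (face X [fset s]%fset).
Proof.
move=> sS; exists (val X); split; [exact: chamberP|exact: face_sub|].
have [vX vs] := vtxP v0 hT hL (chamberP X) sS.
rewrite (cardfsD1 (vtx (val X) s)) vX; congr _.+1; congr #|` _|; apply/fsetP => v.
rewrite !inE /= andbC; have [vX'|//] := boolP (v \in val X); rewrite /=.
congr (~~ _); apply/eqP/eqP => [->//|ev]; apply: (lam_inj vX' vX); by rewrite vs.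
Qed.

Lemma panel_dl X Y s : s \in S -> X <> Y -> (face X [fset s] `<=` val Y)%fset -> dl X Y = s.
Proof.
move=> sS XY; move/(face_in _ (face_sub X _)); rewrite cotype_face ?fsub1set //.
case=> -[|t p] /=; first by move=> _ /esym/(dl_eq1 hM).
case/andP => /fset1P-> pJ e.
case: (@dl_adj _ S _ v0 _ _ _ hWS hT hL X Y s sS) => // [r rS rs|/(dl_eq1 hM)//].
apply/(vtx_dl v0 hWS hT hL) => //; apply: (@inWS _ [fset s]%fset).
  by rewrite fsub1set !inE sS eq_sym rs.
by exists (s :: p); rewrite //= inE eqxx.
Qed.

Lemma adjacentP X Y : adjacent Delta (val X) (val Y) <-> exists2 s : W, s \in S & dl X Y = s.
Proof.
split=> [[_ _ XY [P [[C [cC PC cP]] PX PY]]]|[s sS e]].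
  have cot : #|` cotype P| = 1%N.
    rewrite cardfsD; have /fsetIidPr -> : ([fset lam v | v in P] `<=` S)%fset.
      apply/fsubsetP => _ /imfsetP[v /= vP ->].
      by have [] := vtx_lam v0 hT hL (chamberP X) (fsubsetP PX v vP).
    rewrite card_in_imfset /=; last first.
      by move=> u v uP vP; apply: lam_inj; apply: (fsubsetP PX).
    by rewrite -(card_ch cC) cP subSnn.
  have /cardfs1P[s es] : #|` cotype P| == 1%N by apply/eqP.
  have sS : s \in S by apply: (fsubsetP (cotype_sub P)); rewrite es inE.
  exists s => //; case: (@dl_adj _ S _ v0 _ _ _ hWS hT hL X Y s sS) => // [r rS rs|].
    apply/(vtx_dl v0 hWS hT hL) => //; apply: inWS (proj1 (face_in Y PX) PY).
    by rewrite es fsub1set !inE sS eq_sym rs.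
  by move/(dl_eq1 hM) => eXY; case: XY; rewrite eXY.
have KS : ([fset s] `<=` S)%fset by rewrite fsub1set.
split; [exact: chamberP|exact: chamberP| |].
  move=> /val_inj eXY; move: e; rewrite eXY (dlxx hM) => e.
  exact: (gen_neq1 hWS sS (esym e)).
exists (face X [fset s]%fset); split; [exact: panel_face|exact: face_sub|].
by rewrite (@face_eq X Y) ?face_sub //; rewrite e; apply: inW_gen; exact: fset11.
Qed.

Let adj C D := `[< adjacent Delta C D >].

Lemma gallery_len X p : path adj (val X) p -> exists Y, last (val X) p = val Y /\ len (dl X Y) <= size p.
Proof.
elim: p X => [|D p IH] X /=; first by move=> _; exists X; rewrite (dlxx hM) (len1 hWS).
case/andP => /asboolP XD pp; have [_ cD _ _] := XD.
have [Y [eY lY]] := IH (Chamber cD) pp; exists Y; split=> //.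
have [s sS e] := proj1 (adjacentP X (Chamber cD)) XD.
have := lenS_le hWS (dl X Y) sS; have h2 := lenM hWS s (dl X Y).
case: (dl_step hM Y sS e) => [e2|[e2 _]]; rewrite e2 in lY; last by move=> _; apply: leqW.
by move/leq_trans; apply.
Qed.

Lemma gallery_word X Y : exists p, [/\ path adj (val X) p, last (val X) p = val Y & size p = len (dl X Y)].
Proof.
move En : (len (dl X Y)) => n; elim: n X En => [|n IH] X Xn.
  by exists [::]; have /(dl_eq1 hM)-> := len_eq0 hWS Xn.
have [s sS [us un]] := len_pos hWS Xn; have [X' [XX' X'Y]] := dl_ex hM X Y sS.
have [|p [pp pl ps]] := IH X'; first by rewrite X'Y.
exists (val X' :: p); rewrite /= ps pp andbT; split=> //.
by apply/asboolP/adjacentP; exists s.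
Qed.

Lemma dl_triangle X Y Z : len (dl X Z) <= len (dl X Y) + len (dl Y Z).
Proof.
have [p [pp pl ps]] := gallery_word X Y; have [q [qp ql qs]] := gallery_word Y Z.
have [|Z' [eZ lZ]] := @gallery_len X (p ++ q); first by rewrite cat_path pp pl.
rewrite last_cat pl ql in eZ; have eZ' : Z = Z' by exact: val_inj.
rewrite -eZ' in lZ.
by rewrite -ps -qs -size_cat.
Qed.

Lemma minimal_galleryP X Y p : minimal_gallery Delta (val X) (val Y) p <->
  [/\ path adj (val X) p, last (val X) p = val Y & size p = len (dl X Y)].
Proof.
split=> [[[_ pp pl] pmin]|[pp pl ps]]; last first.
  split; first by split=> //; exact: chamberP.
  move=> q [_ qp ql]; have [Z [eZ lZ]] := gallery_len qp.
  by rewrite ps; have -> : Y = Z by apply: val_inj; rewrite -ql.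
split=> //; have [Z [eZ lZ]] := gallery_len pp.
have eYZ : Y = Z by apply: val_inj; rewrite -pl.
apply/eqP; rewrite eqn_leq {2}eYZ lZ andbT.
have [q [qp ql <-]] := gallery_word X Y; apply: pmin; split=> //; exact: chamberP.
Qed.

Lemma minimal_gallery_dbtw X Y p E : minimal_gallery Delta (val X) (val Y) p -> val E \in p ->
  dbtw S dl X E Y.
Proof.
move=> /minimal_galleryP[pp pl ps] Ep; have tri := dl_triangle X E Y.
rewrite /dbtw; apply/eqP; rewrite eqn_leq tri andbT -ps.
case/splitPr: Ep pp pl => p1 p2; rewrite cat_path last_cat /= => /and3P[p1p p1E p2p] pl.
have [|E' [eE' lE]] := @gallery_len X (rcons p1 (val E)); first by rewrite rcons_path p1p.
rewrite last_rcons in eE'; have eE : E = E' by exact: val_inj.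
have [Y' [eY' lY]] := gallery_len p2p.
have eY : Y = Y' by apply: val_inj; exact: etrans (esym pl) eY'.
rewrite -eE size_rcons in lE; rewrite -eY in lY.
by rewrite size_cat /= -addSnnS; exact: leq_add.
Qed.

Lemma dbtw_minimal_gallery X Y E : dbtw S dl X E Y ->
  exists2 p, minimal_gallery Delta (val X) (val Y) p & E = X \/ val E \in p.
Proof.
move=> b; have [p [pp pl ps]] := gallery_word X E; have [q [qp ql qs]] := gallery_word E Y.
exists (p ++ q); first by apply/minimal_galleryP; rewrite cat_path last_cat size_cat pp pl qp ps qs.
case: p pl {pp ps} => [/val_inj ->|D p /= <-]; first by left.
by right; rewrite inE mem_cat; have := mem_last D p; rewrite inE => /orP[->//|->]; rewrite orbT.
Qed.

Lemma convexP (k : set {fset V}) : convex_chambers Delta k <-> k `<=` chamber Delta /\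
  forall X Y E, k (val X) -> k (val Y) -> dbtw S dl X E Y -> k (val E).
Proof.
split=> -[kD h]; split=> //.
  move=> X Y E kX kY /dbtw_minimal_gallery[p mp [->//|Ep]]; exact: h mp _ Ep.
move=> C D p kC kD' mp E Ep.
pose X := Chamber (kD _ kC); pose Y := Chamber (kD _ kD').
have cE : chamber Delta E.
  have [[_ + _] _] := mp; elim: p C {kC X mp} Ep => //= B p IH C + /andP[/asboolP[_ cB _ _] pp].
  by rewrite inE => /orP[/eqP->//|Ep]; exact: IH Ep pp.
by apply: (h X Y (Chamber cE)) => //; exact: (@minimal_gallery_dbtw X Y p (Chamber cE)).
Qed.

Lemma complex_chamber L A : chamber_complex L -> L A -> exists2 C, chamber L C & (A `<=` C)%fset.
Proof.
case=> _ [n Ln] _ _; move En : (n - #|` A|) => m; elim/ltn_ind: m A En => m IH A Em LA.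
have [[B [LB AB nAB]]|no] := pselect (exists B, [/\ L B, (A `<=` B)%fset & B <> A]); last first.
  exists A => //; split=> // B LB AB; apply: contrapT => nAB; apply: no; by exists B.
have lt : #|` A| < #|` B|.
  by apply: fproper_ltn_card; rewrite fproperEneq AB andbT; apply/eqP => e; apply: nAB.
have [|C cC BC] := IH (n - #|` B|) _ B erefl LB.
  by rewrite -Em ltn_sub2l //; exact: leq_trans lt (Ln _ LB).
by exists C => //; exact: fsubset_trans BC.
Qed.

Lemma sub_chamber L C : L `<=` Delta -> chamber Delta C -> L C -> chamber L C.
Proof. by move=> LD [_ Cmax] LC; split=> // A /LD; exact: Cmax. Qed.

Lemma chamber_generated (k : set {fset V}) : k `<=` chamber Delta -> chamber (generated_subcomplex k) = k.
Proof.
move=> kD; apply/seteqP; split=> C.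
  case=> -[C' kC' CC'] Cmax; rewrite -(Cmax C') //; by exists C'; rewrite ?fsubset_refl.
move=> kC; split; first by exists C; rewrite ?fsubset_refl.
move=> A [C' kC' AsC'] CA; have [_ Cmax] := kD C kC; apply: Cmax => //.
have [_ h] := hsc; apply: h AsC' _; by have [] := kD C' kC'.
Qed.

Lemma generated_convex (k : set {fset V}) : k !=set0 -> convex_chambers Delta k ->
  convex_chamber_subcomplex Delta (generated_subcomplex k).
Proof.
move=> [C0 kC0] kc; have [kD kcl] := kc; have ech := chamber_generated kD.
have sc : simplicial_complex (generated_subcomplex k).
  split; first by exists C0 => //; exact: fsub0set.
  by move=> A B BA [C kC AsC]; exists C => //; exact: fsubset_trans AsC.
have sub : generated_subcomplex k `<=` Delta.
  by move=> A [C kC AsC]; have [_ h] := hsc; apply: (h C A AsC); have [] := kD C kC.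
split; last by rewrite ech.
split; [by split| |by rewrite ech].
split=> //; rewrite ?ech.
- exists #|` S| => A [C /kD cC AsC]; rewrite -(card_ch cC); exact: fsubset_leq_card.
- by move=> C D /kD cC /kD cD; rewrite !card_ch.
- move=> C D kC kD'; have cC := kD _ kC; have cD := kD _ kD'.
  have [p [pp pl ps]] := gallery_word (Chamber cC) (Chamber cD).
  have mp : minimal_gallery Delta C D p by apply/(minimal_galleryP (Chamber cC) (Chamber cD)).
  have kp := kcl C D p kC kD' mp; exists p; split=> //; first by rewrite ech.
  move: pp; rewrite /= {pl ps mp}; elim: p C {cC} kC kp => //= B p IH C kC kp.
  have kB : k B by apply: kp; exact: mem_head.
  case/andP => /asboolP[cC cB nCB [P [[C' [cC' PC' eP]] PC PB]]] pp; apply/andP; split.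
    apply/asboolP; split; rewrite ?ech //; exists P; split=> //.
    by exists C; rewrite ech; split=> //; rewrite (card_ch cC) -(card_ch cC').
  by apply: IH => // E Ep; apply: kp; rewrite inE Ep orbT.
Qed.

Lemma convex_single L : convex_chamber_subcomplex Delta L -> convex_subcomplex Delta L.
Proof.
move=> Lc; exists [set L]; first by split; [exists L|move=> _ ->].
by rewrite bigcap_set1.
Qed.

Lemma convex_complex L : convex_subcomplex Delta L -> subcomplex L Delta.
Proof.
move=> [F [[M0 FM0] Fc] ->]; split; last by move=> A /(_ M0 FM0); have [[[_ h] _ _] _] := Fc _ FM0; exact: h.
split=> [M /Fc[[[[]]]]//|A B BA h M FM]; have [[[[_ d] _] _ _] _] := Fc _ FM.
exact: d BA (h M FM).
Qed.

Definition hull X Y : set {fset V} := [set C | exists2 E, dbtw S dl X E Y & C = val E].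

Lemma apt_through X Y : exists f (b : W), [/\ apt S dl f, f 1 = X & f b = Y].
Proof.
have i1 : iso dl [set (1, X)] by move=> _ _ -> -> /=; rewrite (dlxx hM) mulVg.
have i2 : iso dl ([set (1, X)] `|` [set (dl X Y, Y)]).
  by apply: (iso_add hM i1) => _ -> /=; rewrite (dl_sym hM) mulg1.
have [f [fA fP]] := iso_extend hWS hM i2 (or_introl erefl).
exists f, (dl X Y); split=> //; first exact: (fP (1, X) (or_introl erefl)).
exact: (fP (dl X Y, Y) (or_intror erefl)).
Qed.

Lemma hull_apt f a b : apt S dl f ->
  hull (f a) (f b) = [set C | exists2 c : W, btw S a c b & C = val (f c)].
Proof.
move=> fA; apply/seteqP; split=> C.
  by move=> [E /(dbtw_apt hWS hM fA)[c -> bc] ->]; exists c.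
by move=> [c bc ->]; exists (f c) => //; exact: (apt_dbtw hWS hM).
Qed.

Lemma hull_convex X Y : convex_chambers Delta (hull X Y).
Proof.
apply/convexP; split; first by move=> _ [E _ ->]; exact: chamberP.
have [f [b [fA <- <-]]] := apt_through X Y; rewrite !hull_apt // => {X Y}X' Y' E.
move=> [u bu /val_inj->] [v bv /val_inj->] /(dbtw_apt hWS hM fA)[w -> bw].
by exists w => //; exact: (btw_trans hWS bu bv bw).
Qed.

Lemma hull_ends X Y : hull X Y (val X) /\ hull X Y (val Y).
Proof.
split; [exists X|exists Y] => //; rewrite /dbtw (dlxx hM) (len1 hWS) ?addn0 //.
Qed.

Lemma hull_finite X Y : finite_set (hull X Y).
Proof.
have [f [b [fA <- <-]]] := apt_through X Y; rewrite hull_apt //.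
apply: (@sub_finite_set _ _ [set val (f w) | w in [set w | len w <= len b]]).
  move=> _ [c bc ->]; exists c => //=; move: bc; rewrite /btw invg1 !mul1g => <-.
  exact: leq_addr.
by apply: finite_image; exact: (ball_finite hWS).
Qed.

(** A convex subcomplex containing the two chambers is an intersection of convex chamber complexes,
    and both are chambers of each of these. *)
Lemma convex_closure_hull X Y :
  convex_closure Delta [set val X; val Y] = generated_subcomplex (hull X Y).
Proof.
have [hX hY] := hull_ends X Y; apply/seteqP; split=> A.
  apply; split.
    apply: convex_single; apply: generated_convex (hull_convex X Y); by exists (val X).
  by move=> _ [->|->]; [exists (val X)|exists (val Y)]; rewrite ?fsubset_refl.
move=> [_ [E bE ->] AE] L [[F [_ Fc] ->] XYL] M FM; have [[[[_ Md] MD] _ _] /convexP[_ Mc]] := Fc M FM.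
have cX : chamber M (val X).
  by apply: (sub_chamber MD (chamberP X)); apply: XYL => //; left.
have cY : chamber M (val Y).
  by apply: (sub_chamber MD (chamberP Y)); apply: XYL => //; right.
by apply: Md AE _; have [] := Mc X Y E cX cY bE.
Qed.

(** The projection of a chamber of [L] to a residue of another chamber of [L] lies on a minimal
    gallery between the two, hence in [L]. *)
Lemma chamber_subcomplex_projection L : convex_chamber_subcomplex Delta L ->
  projection_closed S dl (simplices L).
Proof.
move=> [[[[_ Ld] LD] Lcc Lch] /convexP[_ Lc]] C K C' K' Z J [KS LC] [K'S LC'] JS h; split=> //.
have [X0 cX0 CX] := complex_chamber Lcc LC; have [Y0 cY0 CY] := complex_chamber Lcc LC'.
pose X := Chamber (Lch _ cX0); pose Y := Chamber (Lch _ cY0).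
have [P [YP PX]] := gate_ex hWS hM X Y K'S.
have bP : dbtw S dl Y P X.
  rewrite /dbtw (gate_add hWS hM K'S PX YP); exact/esym/(lminM hWS K'S PX YP).
have [LP _] := Lc Y X P cY0 cX0 bP.
have CX' : inW K (dl C X) by have := proj1 (face_in X (face_sub C K)) CX; rewrite cotype_face.
have CY' : inW K' (dl C' Y) by have := proj1 (face_in Y (face_sub C' K')) CY; rewrite cotype_face.
rewrite (face_eq JS (h X P CX' (res_trans hWS hM CY' YP K'S) PX)).
exact: Ld (face_sub _ _) LP.
Qed.

Lemma convex_projection L : convex_subcomplex Delta L -> projection_closed S dl (simplices L).
Proof.
move=> [F [_ Fc] ->] C K C' K' Z J [KS LC] [K'S LC'] JS h; split=> // M FM.
have [] // := @chamber_subcomplex_projection M (Fc M FM) C K C' K' Z J.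
- by split=> //; exact: LC.
- by split=> //; exact: LC'.
Qed.

End Faces.

Definition spanned (W : groupType) (S : {fset W}) :=
  forall F : set W, finite_set F -> exists a b, forall w, F w -> btw S a w b.

(** * Convex subcomplexes as intersections *)

Section Criterion.
Variables (W : groupType) (S : {fset W}) (V : choiceType) (v0 : V).
Variables (Delta : set {fset V}) (Aps : set (set {fset V})) (lam : V -> W).
Hypotheses (hWS : coxeter_system S) (hT : tits_axioms S Delta Aps) (hL : typing S Delta Aps lam).
Hypothesis hsc : simplicial_complex Delta.
Implicit Types (s t w a b c : W) (A B C D P : {fset V}) (K J : {fset W}).

Local Notation Ch := (chambers Delta).
Local Notation dl := (@dl W S V Delta Aps lam).
Local Notation hull := (@hull W S V Delta Aps lam).
Local Notation simplices := (@simplices W S V Delta lam).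
Local Notation face := (@face W V Delta lam).
Local Notation cotype := (@cotype W S V lam).
Implicit Types (X Y Z E : Ch) (f g h : W -> Ch) (L : set {fset V}).

Let hM : wmetric S dl := dl_wmetric v0 hWS hT hL.

Lemma apset_chamber f X : apset f (val X) -> exists w, X = f w.
Proof.
move=> [w Xw]; exists w; apply: val_inj; have [_ Xmax] := chamberP X.
by rewrite -(Xmax (val (f w))) //; have [] := chamberP (f w).
Qed.

Lemma chamber_apset f w : apset f (val (f w)).
Proof. by exists w; exact: fsubset_refl. Qed.

Lemma apset_mul f a : apset (fun w => f (a * w)) = apset f.
Proof.
apply/seteqP; split=> A [w Aw]; first by exists (a * w).
by exists (a^-1 * w); rewrite mulVKg.
Qed.

(** The successor counts [X], which has to be avoided besides the members of [Y]. *)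
Lemma avoid_chambers n X s (Y : seq Ch) : at_least_chambers_per_panel n Delta -> s \in S ->
  (size Y).+1 < n -> exists Z, dl X Z = s /\ forall E, List.In E Y -> Z <> E.
Proof.
move=> hn sS Yn; have memY E : List.In E Y -> val E \in [seq val E' | E' <- Y].
  by elim: Y {Yn} => //= E' Y IH [->|/IH h]; rewrite inE ?eqxx // h orbT.
have [Q [Qn QP]] := hn _ (panel_face v0 hT hL X sS).
pose T := (val X |` seq_fset tt [seq val E | E <- Y])%fset.
have Tn : #|` T| < n.
  apply: leq_ltn_trans Yn; rewrite cardfsU1 -add1n; apply: leq_add; first by case: (_ \notin _).
  by rewrite -(size_map (fun E : Ch => val E)) size_seq_fset size_undup.
have [C CQ CT] : exists2 C, C \in Q & C \notin T.
  apply: contrapT => no; have : (Q `<=` T)%fset.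
    apply/fsubsetP => C CQ; apply: contrapT => /negP nT; by apply: no; exists C.
  by move/fsubset_leq_card; rewrite leqNgt (leq_trans Tn Qn).
have [cC PC] := QP C CQ; exists (Chamber cC).
have neq E : val E \in T -> Chamber cC <> E by move=> ET e; move: CT ET; rewrite -e /= => /negbTE->.
split; last first.
  move=> E EY; apply: neq; rewrite !inE; apply/orP; right; rewrite seq_fsetE.
  exact: memY.
apply: (panel_dl v0 hWS hT hL (Y := Chamber cC) sS _ PC) => e.
by apply: (neq X); rewrite ?inE ?eqxx.
Qed.

Lemma thick_thick3 : thick Delta -> thick3 S dl.
Proof.
move=> h s C E sS; have [Z [CZ ZE]] := avoid_chambers C (Y := [:: E]) h sS isT.
by exists Z; split=> //; apply: ZE; left.
Qed.

Lemma four_thick4 : at_least_chambers_per_panel 4 Delta -> thick4 S dl.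
Proof.
move=> h s C E E' sS; have [Z [CZ ZE]] := avoid_chambers C (Y := [:: E; E']) h sS isT.
by exists Z; split=> //; apply: ZE; [left|right; left].
Qed.

Lemma apt_through_apartment Sigma g a b : complete_apartment_system S Delta Sigma ->
  apt S dl g -> Sigma (val (g a)) -> Sigma (val (g b)) ->
  exists h, [/\ apt S dl h, Sigma = apset h, h a = g a & h b = g b].
Proof.
move=> /(apartment_apt v0 hWS hT hL)[h hA ->] gA /apset_chamber[u gu] /apset_chamber[v gv].
exists (fun w => h (u * a^-1 * w)); split; rewrite ?apset_mul //; [exact: apt_mul|by rewrite -gmulA mulVg mulg1|].
rewrite gv; congr h; have := apt_dl hWS hM a b gA; rewrite gu gv (apt_dl hWS hM) // => e.
by rewrite -gmulA -e mulVKg.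
Qed.

Lemma convex_intersection Ap (kappa : set {fset V}) : thick Delta -> spanned S ->
  apartment_system S Delta Ap -> finite_set kappa -> convex_subcomplex Delta kappa ->
  (exists2 Sigma, Ap Sigma & kappa `<=` Sigma) ->
  (exists X : Ch, kappa (val X)) \/ at_least_chambers_per_panel 4 Delta ->
  intersection_of_two Ap kappa.
Proof.
move=> th sp [ApC Apex] kfin kc [Sigma ApS kS] four.
have [f0 f0A eS] := apartment_apt v0 hWS hT hL (ApC _ ApS).
have [ksc kD] := convex_complex kc.
have Mcl := simplices_closed v0 hWS hT hL ksc.
have Mproj := convex_projection v0 hWS hT hL kc.
pose P n := `[< exists (C : Ch) K, simplices kappa C K /\ #|` K| = n >].
have exP : exists n, P n.
  (* The empty simplex has cotype [S] and lies in every subcomplex, so a simplex of smallest cotype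
     exists. *)
  exists #|` S|; apply/asboolP; exists (f0 1), S; split=> //; split; first exact: fsubset_refl.
  case: ksc => k0 kd; suff -> : face (f0 1) S = fset0 by [].
  apply/fsetP => v; rewrite !inE; apply/negP => /andP[vX /negP nv].
  by case: nv; have [] := vtx_lam v0 hT hL (chamberP (f0 1)) vX.
have [n /asboolP[C0 [J [MC0 cJ]]] nmin] := ex_minnP exP.
have Msub (C : Ch) K : simplices kappa C K -> aptM S dl f0 C K.
  move=> [KS kF]; apply/(simplices_apset v0 hWS hT hL); split=> //.
  by rewrite -eS; exact: kS.
have [JS [w0 w0C]] := Msub _ _ MC0.
pose f w := f0 (w0 * w).
have fA : apt S dl f by exact: apt_mul.
have MJ : simplices kappa (f 1) J.
  have [_ h _] := Mcl; apply: h MC0 _; rewrite /f mulg1.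
  exact: (res_sym hWS hM).
have Msub' (C : Ch) K : simplices kappa C K -> aptM S dl f C K.
  by move/Msub => [KS [w wC]]; split=> //; exists (w0^-1 * w); rewrite /f mulVKg.
have Jmin (C : Ch) K : simplices kappa C K -> #|` J| <= #|` K|.
  by move=> MCK; rewrite cJ; apply: nmin; apply/asboolP; exists C, K.
have J4 : J = fset0 \/ thick4 S dl.
  case: four => [[X kX]|/four_thick4]; [left|by right].
  apply/cardfs0_eq/eqP; rewrite -leqn0 -(@cardfs0 W); apply: (Jmin X); split; first exact: fsub0set.
  have -> : face X fset0 = val X; last by [].
  by apply/fsetP => v; rewrite !inE andbT.
(* A simplex determines the shortest element of its coset, so this set is no larger than [kappa]. *)
have fin : finite_set [set e | exists K, simplices kappa (f e) K /\ lmin S K e^-1].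
  pose hh A := xget 1 [set e | exists K, [/\ simplices kappa (f e) K, lmin S K e^-1 & A = face (f e) K]].
  apply: (@sub_finite_set _ _ [set hh A | A in kappa]); last exact: finite_image.
  move=> e /= [K [[KS kF] Km]]; exists (face (f e) K) => //; rewrite /hh.
  set Q := (X in xget _ X); have : Q (xget 1 Q).
    by apply: (@xgetPex _ 1); exists e, K.
  move: (xget 1 Q) => e' [K' [[K'S _] Km' ef]].
  have [eK] := face_inj v0 hWS hT hL KS K'S ef; rewrite -eK in Km'.
  rewrite (apt_dl hWS hM) // => ee.
  have [|_ /(congr1 (fun x => x^-1))] := lmin_uniq hWS KS Km Km' (inW1 K) ee.
    by rewrite mul1g -gmulA mulgV mulg1.
  by rewrite !invgK.
have [g [F [gA Ffin gF]]] :=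
  separation hWS hM fA Mcl Mproj Msub' MJ Jmin (thick_thick3 th) J4 fin.
have [a [b Fab]] := sp F Ffin.
have [Sigma' [ApS' Sa Sb]] := Apex _ _ (chamberP (g a)) (chamberP (g b)).
have [h [hA eS' ha hb]] := apt_through_apartment (ApC _ ApS') gA Sa Sb.
have hF : {in F, h =1 g} by move=> w /set_mem/Fab; exact: (apt_btw hWS hM hA gA ha hb).
exists Sigma, Sigma'; split=> //.
have key X A : (A `<=` val X)%fset -> kappa A <-> Sigma A /\ Sigma' A.
  move=> AX; rewrite -(simplicesP v0 hT hL kappa AX) (gF h hA hF) eS eS' -(apset_mul f0 w0).
  by rewrite -!(simplices_apset v0 hWS hT hL) !(simplicesP v0 hT hL).
apply/seteqP; split=> A.
  by move=> kA; have [X AX] := simplex_ch v0 hWS hT (kD _ kA); apply/(key X).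
move=> [SA S'A]; have [[_ SD] _] := ApC _ ApS.
by have [X AX] := simplex_ch v0 hWS hT (SD _ SA); apply/(key X).
Qed.

End Criterion.

(** * Hulls of neighbours *)

Section Exits.
Variables (W : groupType) (S : {fset W}).
Hypothesis hWS : coxeter_system S.
Implicit Types (a b c e g x y s t w : W).

(** The first step out of [Q] on a minimal gallery from [e] to [x]. *)
Lemma exit_ex (Q : set W) e x : Q e -> ~ Q x -> exists c t,
  [/\ Q c, t \in S, ~ Q (c * t) & btw S c (c * t) x].
Proof.
move En : (len S (e^-1 * x)) => n; elim: n e En => [|n IH] e en Qe nQx.
  case: nQx; have -> : x = e * (e^-1 * x) by rewrite mulVKg.
  by rewrite (len_eq0 hWS en) mulg1.
have [t tS [et tn]] := len_pos hWS en.
have e2 : (e * t)^-1 * x = t * (e^-1 * x) by rewrite ginvM (gen_inv hWS tS) gmulA.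
have [Qet|nQ] := pselect (Q (e * t)); first by apply: IH Qet nQx; rewrite e2.
exists e, t; split=> //; rewrite /btw e2 mulKg (len_gen hWS tS) tn en; exact: add1n.
Qed.

(* The wall between c and c * t does not separate e from g, so it leaves the
   whole hull of e and g on the side of c. *)
Lemma exit_side e g c t n : btw S e c g -> t \in S -> ~ btw S e (c * t) g -> btw S e n g ->
  inverts S (c^-1 * n) t = false.
Proof.
rewrite !btwP // => hc tS nct hn; set r := t ^ c^-1.
have rr : reflection S r by apply: (refl_conj c^-1); exact: refl_gen.
have er : inverts S e r = inverts S g r.
  apply: contrapT => ner; apply: nct => r' rr' er'; rewrite (invertsM hWS) (inv_gen hWS _ tS).
  have [e1|_] := eqVneq (r' ^ c) t; last by rewrite addbF; exact: hc.
  by case: ner; rewrite /r -e1 conjgK.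
by rewrite (invertsM hWS) (invertsV hWS) -/r (hn r rr er) (hc r rr er) addbb.
Qed.

Lemma spanned_of_neighbours : (forall a b c s, s \in S -> btw S a c b ->
    exists a' b', [/\ btw S a' a b', btw S a' b b' & btw S a' (c * s) b']) -> spanned S.
Proof.
move=> nb F /finite_seqP[q ->] {F}.
have grow p a b c : word S p -> btw S a c b ->
    exists a' b', [/\ btw S a' a b', btw S a' b b' & btw S a' (c * wprod p) b'].
  elim: p a b c => [|s p IH] a b c /=.
    by move=> _ bc; exists a, b; rewrite mulg1; split=> //; [exact: btw_l|exact: btw_r].
  case/andP => sS pS bc; have [a1 [b1 [aa bb cs]]] := nb a b c s sS bc.
  have [a2 [b2 [aa1 bb1 csp]]] := IH a1 b1 (c * s) pS cs.
  exists a2, b2; rewrite gmulA; split=> //; first exact: (btw_trans hWS aa1 bb1 aa).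
  exact: (btw_trans hWS aa1 bb1 bb).
elim: q => [|w q [a [b qab]]]; first by exists 1, 1.
have [p pS pE] := inW_full hWS (a^-1 * w).
have [a' [b' [aa bb wab]]] := grow p a b a pS (btw_l hWS a b).
rewrite pE mulVKg in wab; exists a', b' => x /=; rewrite inE => /orP[/eqP->//|xq].
exact: (btw_trans hWS aa bb (qab x xq)).
Qed.

End Exits.

Section Equivalence.
Variables (W : groupType) (S : {fset W}) (V : choiceType) (v0 : V).
Variables (Delta : set {fset V}) (Aps : set (set {fset V})) (lam : V -> W).
Hypotheses (hWS : coxeter_system S) (hT : tits_axioms S Delta Aps) (hL : typing S Delta Aps lam).
Hypothesis hsc : simplicial_complex Delta.
Implicit Types (e g s t w a b c : W) (A B C D P : {fset V}) (K J : {fset W}).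

Local Notation Ch := (chambers Delta).
Local Notation dl := (@dl W S V Delta Aps lam).
Local Notation hull := (@hull W S V Delta Aps lam).
Implicit Types (X Y Z E : Ch) (f h : W -> Ch) (L : set {fset V}).

Let hM : wmetric S dl := dl_wmetric v0 hWS hT hL.

(** [h'] follows [h] on the hull of [e] and [g] and leaves it at the exit [c * t] towards [x]. If it
    contained [h x], it would do so at [x], and rigidity between [c] and [x] would force
    [h' (c * t) = h (c * t)]. *)
Lemma apartment_avoiding h e g x : thick Delta -> apt S dl h -> ~ btw S e x g ->
  exists h', [/\ apt S dl h', h' e = h e, h' g = h g & ~ apset h' (val (h x))].
Proof.
move=> th hA nx.
have [c [t [bc tS nct ctx]]] := exit_ex hWS (btw_l hWS e g : [set w | btw S e w g] e) nx.
pose G := [set m : W * Ch | btw S e m.1 g /\ m.2 = h m.1].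
have iG : iso dl G by move=> m m' [_ ->] [_ ->]; exact: (apt_dl hWS hM).
have Ge : G (e, h e) by split=> //; exact: btw_l.
have Gg : G (g, h g) by split=> //; exact: btw_r.
have Gc : G (c, h c) by [].
have avoid := iso_avoid hWS hM (bd := [set (c, t)]) (thick_thick3 v0 hWS hT hL th) hA iG Ge.
case: avoid => [_ _ [-> ->]|h' [h'A h'G h't]].
  by split=> // n [bn _]; exact: (exit_side hWS bc tS nct bn).
exists h'; split=> //; [exact: (h'G _ Ge)|exact: (h'G _ Gg)|].
move=> /apset_chamber[x' ex]; apply: (h't c t erefl).
have hc := h'G _ Gc; rewrite /= in hc.
have xx := apt_eq hWS hM hA h'A (esym hc) ex; rewrite -xx in ex.
exact: (apt_btw hWS hM h'A hA hc (esym ex) ctx).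
Qed.

Lemma hulls_spanned : thick Delta -> hulls_are_intersections S Delta -> spanned S.
Proof.
move=> th hulls; apply: spanned_of_neighbours => // a b c s sS bc; apply: contrapT => no.
have [C0 cC0] : exists C, chamber Delta C.
  have [X _] := simplex_ch v0 hWS hT (proj1 hsc); exists (val X); exact: chamberP.
have [f [_ [fA _ _]]] := apt_through v0 hWS hT hL (Chamber cC0) (Chamber cC0).
pose C := val (f a); pose D := val (f b); pose Y := val (f (c * s)).
pose Ap := [set Sigma | complete_apartment_system S Delta Sigma /\
  (Sigma C -> Sigma D -> Sigma Y)].
have ApA : apartment_system S Delta Ap.
  split=> [Sigma []//|E' G' cE cG].
  have [h [g [hA he hg]]] := apt_through v0 hWS hT hL (Chamber cE) (Chamber cG).
  have bad h' : apt S dl h' -> h' 1 = Chamber cE -> h' g = Chamber cG ->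
      (apset h' C -> apset h' D -> apset h' Y) ->
      exists Sigma, [/\ Ap Sigma, Sigma E' & Sigma G'].
    move=> h'A h'1 h'g imp; exists (apset h'); split.
    - by split=> //; exact: (apt_apartment v0 hWS hT hL).
    - by have := chamber_apset h' 1; rewrite h'1.
    - by have := chamber_apset h' g; rewrite h'g.
  have [[hC hD]|nCD] := pselect (apset h C /\ apset h D); last first.
    by apply: (bad h) => // hC hD; case: nCD.
  (* The apartment is relabelled so as to agree with [f] at [a] and [b], so that positions can be
     compared in [W]. *)
  have [h2 [h2A eh ha hb]] := apt_through_apartment v0 hWS hT hL
    (apt_apartment v0 hWS hT hL hsc hA) fA hC hD.
  have [e2 he2] : exists e2, h2 e2 = h 1.
    have : apset h2 (val (h 1)) by rewrite -eh; exact: chamber_apset.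
    by move/apset_chamber => [e2 ->]; exists e2.
  have [g2 hg2] : exists g2, h2 g2 = h g.
    have : apset h2 (val (h g)) by rewrite -eh; exact: chamber_apset.
    by move/apset_chamber => [g2 ->]; exists g2.
  have good' h' : apt S dl h' -> h' e2 = h2 e2 -> h' g2 = h2 g2 ->
      (apset h' C -> apset h' D -> apset h' Y) ->
      exists Sigma, [/\ Ap Sigma, Sigma E' & Sigma G'].
    move=> h'A h'1 h'g imp; exists (apset h'); split.
    - by split=> //; exact: (apt_apartment v0 hWS hT hL).
    - by have := chamber_apset h' e2; rewrite h'1 he2 he.
    - by have := chamber_apset h' g2; rewrite h'g hg2 hg.
  have [ba|na] := pselect (btw S e2 a g2); last first.
    have [h' [h'A h'e h'g nC]] := apartment_avoiding th h2A na.
    by apply: (good' h') => // hC'; case: nC; rewrite ha.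
  have [bb|nb] := pselect (btw S e2 b g2); last first.
    have [h' [h'A h'e h'g nD]] := apartment_avoiding th h2A nb.
    by apply: (good' h') => // _ hD'; case: nD; rewrite hb.
  have bc2 := btw_trans hWS ba bb bc.
  (* By assumption the hull of [e2] and [g2], which contains [a], [b] and [c], cannot contain
     [c * s]. Hence the value at [c * s] is still free and may be chosen as [Y]. *)
  have nY : ~ btw S e2 (c * s) g2 by move=> bY; apply: no; exists e2, g2.
  pose G := [set m : W * Ch | btw S e2 m.1 g2 /\ m.2 = h2 m.1].
  have iG : iso dl G by move=> m m' [_ ->] [_ ->]; exact: (apt_dl hWS hM).
  have hc : h2 c = f c := apt_btw hWS hM h2A fA ha hb bc.
  have Gc : G (c, h2 c) by [].
  have iG' : iso dl (G `|` [set (c * s, f (c * s))]).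
    apply: (iso_free hWS hM iG sS Gc); first by rewrite hc; exact: fA.
    by move=> n [bn _]; exact: (exit_side hWS bc2 sS nY bn).
  have [h' [h'A h'G]] := iso_extend hWS hM iG' (or_introl Gc).
  apply: (good' h') => //.
  - by apply: (h'G (e2, h2 e2)); left; split=> //; exact: btw_l.
  - by apply: (h'G (g2, h2 g2)); left; split=> //; exact: btw_r.
  - move=> _ _; have := h'G (c * s, f (c * s)) (or_intror erefl) => /= e.
    by rewrite /Y -e; exact: chamber_apset.
have [S1 [S2 [[_ A1] [_ A2] eH]]] := hulls _ ApA _ _ (chamberP (f a)) (chamberP (f b)).
rewrite (convex_closure_hull v0 hWS hT hL hsc) in eH.
have [hX hY] := hull_ends v0 hWS hT hL (f a) (f b).
have gen X : hull (f a) (f b) (val X) -> S1 (val X) /\ S2 (val X).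
  by move=> hXX; have : (S1 `&` S2) (val X) by rewrite -eH; exists (val X); rewrite ?fsubset_refl.
have [C1 C2] := gen _ hX; have [D1 D2] := gen _ hY.
have : (S1 `&` S2) Y by split; [exact: A1|exact: A2].
rewrite -eH => -[B kB YB].
have [Z bZ eB] := kB; rewrite eB in YB.
have eYB : f (c * s) = Z.
  by apply: val_inj; have [_ Ymax] := chamberP (f (c * s)); rewrite (Ymax (val Z)) //; have [] := chamberP Z.
move: bZ; rewrite -eYB => /(dbtw_apt hWS hM fA)[d /(apt_inj hWS hM fA)<- bd].
by apply: no; exists a, b; split=> //; [exact: btw_l|exact: btw_r].
Qed.

Lemma convex_sets_hulls : convex_sets_are_intersections S Delta -> hulls_are_intersections S Delta.
Proof.
move=> cv Ap ApA C D cC cD; pose X := Chamber cC; pose Y := Chamber cD.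
rewrite (_ : [set C; D] = [set val X; val Y]) // (convex_closure_hull v0 hWS hT hL hsc).
apply: cv => //.
- exact: (hull_finite v0 hWS hT hL).
- by exists (val X); have [] := hull_ends v0 hWS hT hL X Y.
- exact: (hull_convex v0 hWS hT hL).
have [Sigma [ApS SC SD]] := proj2 ApA C D cC cD; exists Sigma => //.
have [f fA eS] := apartment_apt v0 hWS hT hL (proj1 ApA _ ApS).
move: SC SD; rewrite eS => /(@apset_chamber _ _ _ f X)[a ea] /(@apset_chamber _ _ _ f Y)[b eb].
rewrite ea eb (hull_apt v0 hWS hT hL _ _ fA) => _ [c _ ->]; exact: chamber_apset.
Qed.

Lemma spanned_convex_sets : thick Delta -> spanned S -> convex_sets_are_intersections S Delta.
Proof.
move=> th sp Ap ApA kappa kfin [C kC] kc [Sigma ApS kS].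
have [kD _] := kc.
have [[Ssc SD] _] := proj1 ApA _ ApS.
apply: (convex_intersection v0 hWS hT hL th sp ApA).
- apply: (@sub_finite_set _ _ (\bigcup_(D in kappa) [set` fpowerset D])).
    by move=> A [D kD' AD]; exists D => //=; rewrite fpowersetE.
  apply: bigcup_finite => // D _; exact: finite_fset.
- apply: (convex_single); apply: (generated_convex v0 hWS hT hL hsc) => //; by exists C.
- exists Sigma => // A [D kD' AD]; have [_ d] := Ssc; apply: d AD _; exact: kS.
- left; exists (Chamber (kD _ kC)); exists C => //; exact: fsubset_refl.
Qed.

End Equivalence.

(** * The Coxeter complex *)

Section CoxeterComplex.
Variables (W : groupType) (S : {fset W}).
Hypothesis hWS : coxeter_system S.

Lemma coxeter_chart : chart S (coxeter_complex S) (coxeter_vertex S).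
Proof.
split=> [w w' s t sS tS|]; first exact: coxeter_vertex_eq.
apply/seteqP; split=> A.
  move=> [w [J JS ->]]; exists w; apply/fsubsetP => _ /imfsetP[s /= sJ ->].
  by apply: in_cell; exact: (fsubsetP JS).
move=> [w Aw]; exists w, [fset s in S | coxeter_vertex S w s \in A]%fset; first exact: fset_sub.
apply/fsetP => x; apply/idP/imfsetP => [xA|[s /=]]; last by rewrite !inE => /andP[_ ?] ->.
by have /cellP[s sS e] := fsubsetP Aw x xA; exists s; rewrite //= !inE sS -e.
Qed.

(** Regarded as a building with itself as its only apartment, the Coxeter complex inherits the
    description of hulls, which turns (III) into a statement on [W]. *)
Lemma coxeter_tits : tits_axioms S (coxeter_complex S) [set coxeter_complex S].
Proof.
have isoid : simplicial_iso (coxeter_complex S) (coxeter_complex S) id.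
  split; first by move=> u v _ _.
  have idE (A : {fset (set W)}) : (id @` A)%fset = A.
    by apply/fsetP => v; apply/imfsetP/idP => [[u /= uA ->]|vA] //; exists v.
  apply/seteqP; split=> A; first by move=> [B SB <-]; rewrite idE.
  by move=> SA; exists A.
split=> [Sigma ->|A B SA SB|Sigma Sigma' A B -> -> _ _ _ _].
- split; last by exists id.
  by split=> //; exact: chart_complex coxeter_chart.
- by exists (coxeter_complex S).
- by exists id.
Qed.

Lemma finite_sets_in_hulls_spanned : finite_sets_in_hulls S <-> spanned S.
Proof.
have hT := coxeter_tits; have sc := chart_complex coxeter_chart.
have v0 : set W := set0.
have cC := cell_chamber v0 hWS hT 1 (fun _ => id) coxeter_chart.
have [lam hL] := typing_ex v0 hWS hT cC.
have ap : complete_apartment_system S (coxeter_complex S) (coxeter_complex S).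
  by case: hT => h _ _; exact: h.
have [f fA ef] := apartment_apt v0 hWS hT hL ap.
have hM := dl_wmetric v0 hWS hT hL.
have chE C : chamber (coxeter_complex S) C -> exists w, C = val (f w).
  move=> cC'; have : apset f (val (Chamber cC')) by rewrite -ef; case: cC'.
  by case/apset_chamber => w e; exists w; rewrite -e.
have hullE a b w : convex_closure (coxeter_complex S) [set val (f a); val (f b)] (val (f w)) <->
    btw S a w b.
  rewrite (convex_closure_hull v0 hWS hT hL sc) (hull_apt v0 hWS hT hL a b fA); split; last first.
    by move=> h; exists (val (f w)); rewrite ?fsubset_refl //; exists w.
  move=> [_ [c bc ->] wc]; suff -> : w = c by [].
  apply: (apt_inj hWS hM fA); apply: val_inj; have [_ wmax] := chamberP (f w).
  by rewrite (wmax (val (f c))) //; have [] := chamberP (f c).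
split=> [h F Ffin|h F Ffin Fch].
  have [||C [D [cC' cD hF]]] := h [set val (f w) | w in F].
  - exact: finite_image.
  - by move=> _ [w _ <-]; exact: chamberP.
  have [a ea] := chE _ cC'; have [b eb] := chE _ cD; rewrite ea eb in hF.
  by exists a, b => w Fw; apply/hullE; apply: hF; exists w.
have [|a [b Fab]] := h [set w | F (val (f w))].
  pose hh C := xget 1 [set w | C = val (f w)].
  apply: (@sub_finite_set _ _ [set hh C | C in F]); last exact: finite_image.
  move=> w /= Fw; exists (val (f w)) => //; rewrite /hh.
  have : [set w' | val (f w) = val (f w')] (xget 1 [set w' | val (f w) = val (f w')]).
    by apply: (@xgetPex _ 1); exists w.
  by move/val_inj/(apt_inj hWS hM fA).
exists (val (f a)), (val (f b)); split; [exact: chamberP|exact: chamberP|].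
by move=> C FC; have [w ew] := chE _ (Fch _ FC); rewrite ew; apply/hullE/Fab; rewrite /= -ew.
Qed.

End CoxeterComplex.

(** * The degenerate case of an empty [V] *)

Section NoVertices.
Variables (W : groupType) (S : {fset W}) (V : choiceType) (Delta : set {fset V}).
Hypotheses (noV : V -> False) (hD : building S Delta).

Lemma convex_subcomplex0 (U : choiceType) (K L : set {fset U}) : convex_subcomplex K L -> L fset0.
Proof. by move=> [F [_ Fc] ->] M /Fc[[[[]]]]. Qed.

Lemma fset_noV (A : {fset V}) : A = fset0.
Proof. by apply/fsetP => v; case: (noV v). Qed.

Lemma set_noV (L L' : set {fset V}) : L fset0 -> L' fset0 -> L = L'.
Proof. by move=> L0 L'0; apply/seteqP; split=> A _; rewrite (fset_noV A). Qed.

Lemma noV_two Aps Sigma (L : set {fset V}) : Aps Sigma -> Sigma fset0 -> L fset0 ->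
  intersection_of_two Aps L.
Proof. by move=> ap S0 L0; exists Sigma, Sigma; split=> //; apply: set_noV. Qed.

Lemma noV_hulls : hulls_are_intersections S Delta.
Proof.
move=> Ap [ApC Apex] C D cC cD; have [Sigma [ap SC _]] := Apex C D cC cD.
apply: (noV_two ap); first by rewrite -(fset_noV C).
by move=> L [/convex_subcomplex0].
Qed.

Lemma noV_convex_sets : convex_sets_are_intersections S Delta.
Proof.
move=> Ap ApA kappa _ [C kC] _ [Sigma ap kS].
apply: (noV_two ap); first by rewrite -(fset_noV C); exact: kS.
by exists C; rewrite ?fsub0set.
Qed.

Lemma noV_finite_sets : finite_sets_in_hulls S.
Proof.
have [[D0 _] _ _ _] := proj1 hD; have [Aps [T1 T2 _]] := proj2 hD.
have [Sigma [ap S0 _]] := T2 _ _ D0 D0.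
have [_ [f [_ im]]] := T1 _ ap.
have cox A : coxeter_complex S A -> A = fset0.
  by rewrite -im => -[B _ <-]; rewrite (fset_noV B) imfset0.
have cc : chamber (coxeter_complex S) fset0.
  by split=> [|A /cox//]; rewrite -im; exists fset0; rewrite ?imfset0.
move=> F _ FC; exists fset0, fset0; split=> // A /FC[/cox-> _].
by move=> L [/convex_subcomplex0].
Qed.

End NoVertices.

Theorem theorem2p4 (W : groupType) (S : {fset W}) (V : choiceType)
    (Delta : set {fset V}) (hWS : coxeter_system S) (hD : building S Delta)
    (hthick : thick Delta) :
  [/\ hulls_are_intersections S Delta <-> convex_sets_are_intersections S Delta,
      convex_sets_are_intersections S Delta <-> finite_sets_in_hulls S &
      at_least_chambers_per_panel 4 Delta -> finite_sets_in_hulls S ->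
      forall Aps, apartment_system S Delta Aps ->
      forall kappa : set {fset V}, finite_set kappa ->
        convex_subcomplex Delta kappa ->
        (exists2 Sigma, Aps Sigma & (kappa `<=` Sigma)%classic) ->
        intersection_of_two Aps kappa].
Proof.
(* An element of [V] serves as default value in the choice of vertices; if there is none, the empty
   simplex is the only one. *)
have [[v0 _]|noV0] := pselect (exists v0 : V, True); last first.
  have noV (v : V) : False by apply: noV0; exists v.
  split; [split=> _|split=> _|].
  - exact: (noV_convex_sets noV).
  - exact: (noV_hulls noV).
  - exact: (noV_finite_sets noV hD).
  - exact: (noV_convex_sets noV).
  - move=> _ _ Ap _ kappa _ kc [Sigma ap kS]; have k0 := convex_subcomplex0 kc.
    exact: (noV_two noV ap (kS _ k0) k0).
have [[hsc _ _ _] [Aps hT]] := hD.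
have [C0 cC0 _] := simplex_chamber v0 hWS hT (proj1 hsc).
have [lam hL] := typing_ex v0 hWS hT cC0.
have I_III := hulls_spanned v0 hWS hT hL hsc hthick.
have III_II := spanned_convex_sets v0 hWS hT hL hsc hthick.
have II_I := convex_sets_hulls v0 hWS hT hL hsc.
split.
- by split=> [/I_III/III_II|/II_I].
- by rewrite (finite_sets_in_hulls_spanned hWS); split=> [/II_I/I_III|/III_II].
- move=> h4 /(finite_sets_in_hulls_spanned hWS) sp Ap ApA kappa kfin kc kS.
  by apply: (convex_intersection v0 hWS hT hL hthick sp ApA kfin kc kS); right.
Qed.
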